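(* Let $R$ be a Euclidean domain with field of fractions $K$. Let $p\in R$ be a prime and $\mathbb F=R/(p)$. Suppose the natural map $R^\times\to\mathbb F^\times$ is surjective. Then for all $n\ge1$ there is an isomorphism $$\bigl(\mathrm{St}^\omega_{2n}(K)\bigr)_{\Gamma^\omega_{2n}(p)}\cong\mathrm{St}^\omega_{2n}(\mathbb F).$$
   Context: For a field $k$, let $k^{2n}$ carry the standard symplectic form $\omega$ (basis $e_1,e_{\bar1},\dots,e_n,e_{\bar n}$ with $\omega(e_i,e_{\bar i})=-\omega(e_{\bar i},e_i)=1$, all other pairings $0$). The symplectic Tits building $\mathbb T^\omega_{2n}(k)$ is the simplicial complex whose $j$-simplices are flags $0\subsetneq V_0\subsetneq\cdots\subsetneq V_j\subset k^{2n}$ of nonzero isotropic subspaces (subspaces on which $\omega$ vanishes), and the symplectic Steinberg module is $\mathrm{St}^\omega_{2n}(k)=\widetilde H_{n-1}(\mathbb T^\omega_{2n}(k);\mathbb Z)$, with the induced action of $\mathrm{Sp}_{2n}(k)$ and its subgroups. $\Gamma^\omega_{2n}(p)$ is the kernel of the reduction map $\mathrm{Sp}_{2n}(R)\to\mathrm{Sp}_{2n}(R/(p))$. A subscript group denotes coinvariants. A prime $p$ is a nonzero prime element, so that $\mathbb F$ is a field. *)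

(* Defs.v *)
From HB Require Import structures.
From mathcomp Require Import all_boot all_order all_algebra.
From mathcomp Require Import generic_quotient ring_quotient fraction.
From mathcomp Require Import boolp freeg.

Set Implicit Arguments.
Unset Strict Implicit.
Unset Printing Implicit Defensive.
From mathcomp Require Import ring zify.
Import Order.TTheory GRing.Theory.
Local Open Scope ring_scope.
Local Open Scope quotient_scope.

(* N is not required to satisfy N a <= N (a * b): any Euclidean function can be
   replaced by one that does. *)
HB.mixin Record isEuclidean R of GRing.IntegralDomain R := {
  euclidean_subproof : exists N : R -> nat, forall a b : R, b != 0 ->
    exists q r : R, a = q * b + r /\ (r = 0 \/ (N r < N b)%N)
}.

#[short(type="euclideanDomainType")]
HB.structure Definition EuclideanDomain :=
  {R of isEuclidean R & GRing.IntegralDomain R}.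

Section PrimeElement.
Variable R : comUnitRingType.

Definition divides (p x : R) : Prop := exists y, x = p * y.

Definition prime_element (p : R) : Prop :=
  [/\ p != 0, p \isn't a GRing.unit &
      forall a b, divides p (a * b) -> divides p a \/ divides p b].

(* The ideal (p); primality of p is what makes it proper, as required by the
   library's quotient rings. *)
Definition prime_ideal_of (p : R) (pr : prime_element p) : R -> bool :=
  fun x => `[< divides p x >].

Lemma prime_ideal_ofP (p : R) (pr : prime_element p) x :
  reflect (divides p x) (x \in prime_ideal_of pr).
Proof. exact: asboolP. Qed.

Lemma prime_ideal_of_closed (p : R) (pr : prime_element p) :
  idealr_closed (prime_ideal_of pr).
Proof.
have [p0 pU _] := pr; split.
- by apply/prime_ideal_ofP; exists 0; rewrite mulr0.
- apply/negP => /prime_ideal_ofP [y y1]; case/negP: pU.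
  by apply/unitrPr; exists y.
- move=> a u v /prime_ideal_ofP [x ->] /prime_ideal_ofP [y ->].
  by apply/prime_ideal_ofP; exists (a * x + y); rewrite mulrDr mulrCA.
Qed.

HB.instance Definition _ p (pr : prime_element p) :=
  isIdealr.Build R (prime_ideal_of pr) (prime_ideal_of_closed pr).

Definition prime_idealr_of p (pr : prime_element p) : idealr R :=
  prime_ideal_of pr.

End PrimeElement.

Section ResidueField.
Variables (R : euclideanDomainType) (p : R) (pr : prime_element p).

Definition residue_field : Type := {ideal_quot prime_idealr_of pr}.

HB.instance Definition _ := GRing.ComNzRing.on residue_field.
HB.instance Definition _ := NzRingQuotient.on residue_field.

Definition reduction : {rmorphism R -> residue_field} := \pi_residue_field.

Lemma reduction_eq0 x : reduction x = 0 <-> divides p x.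
Proof.
have -> : (reduction x = 0) = (reduction x = reduction 0) by rewrite rmorph0.
split=> [/eqP|dx].
  by rewrite /reduction /= -Quotient.idealrBE subr0 => /prime_ideal_ofP.
by apply/eqP; rewrite /reduction /= -Quotient.idealrBE subr0; apply/prime_ideal_ofP.
Qed.

Lemma reduction_surj (x : residue_field) : exists a, reduction a = x.
Proof. by exists (repr x); rewrite /reduction /= reprK. Qed.


Lemma bezout_mod_prime (a : R) :
  ~ divides p a -> exists b, divides p (a * b - 1).
Proof.
move=> pa; have [N hN] := @euclidean_subproof R.
have [p0 pU pP] := pr.
pose I x := x != 0 /\ exists u v, x = a * u + p * v.
have exI : exists m, `[< exists2 x, I x & N x = m >].
  exists (N p); apply/asboolP; exists p => //; split=> //.
  by exists 0, 1; rewrite mulr0 add0r mulr1.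
have [m /asboolP [d [d0 [u [v duv]]] Nd] min_m] := ex_minnP exI.
have dI x u' v' : x = a * u' + p * v' -> divides d x.
  move=> xE; have [q [r [xqr rd]]] := hN x d d0; exists q.
  have [r0 | rN0] := eqVneq r 0; first by rewrite xqr r0 addr0 mulrC.
  case: rd => [/eqP|rlt]; first by rewrite (negPf rN0).
  suff /min_m : `[< exists2 x, I x & N x = N r >] by rewrite -Nd leqNgt rlt.
  apply/asboolP; exists r => //; split=> //; exists (u' - q * u), (v' - q * v).
  have -> : r = x - q * d by rewrite xqr addrC addKr.
  by rewrite xE duv; ring.
have [c cE] : divides d a by apply: (dI a 1 0); rewrite mulr1 mulr0 addr0.
have [e eE] : divides d p by apply: (dI p 0 1); rewrite mulr1 mulr0 add0r.
case: (pP d e) => [|[f fE]|[f fE]].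
- by exists 1; rewrite mulr1 -eE.
- by case: pa; exists (f * c); rewrite mulrA -fE.
have df1 : d * f = 1.
  by apply: (mulfI p0); rewrite mulr1 {2}eE fE; ring.
exists (u * f); exists (- (v * f)); rewrite -df1 duv; ring.
Qed.

Lemma residue_field_inv_ex (x : residue_field) :
  exists y, `[< x = 0 \/ y * x = 1 >].
Proof.
have [a <-] := reduction_surj x.
have [/eqP ->|pa] := boolP (reduction a == 0).
  by exists 0; apply/asboolP; left.
have [|b [c bc]] := @bezout_mod_prime a.
  by move=> /reduction_eq0 /eqP; apply/negP.
exists (reduction b); apply/asboolP; right; apply/eqP.
rewrite -rmorphM -subr_eq0 -(rmorph1 reduction) -rmorphB; apply/eqP.
by apply/reduction_eq0; exists c; rewrite mulrC.
Qed.

Definition residue_field_inv (x : residue_field) : residue_field :=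
  if x == 0 then 0 else xchoose (residue_field_inv_ex x).

Lemma residue_field_mulVf (x : residue_field) :
  x != 0 -> residue_field_inv x * x = 1.
Proof.
move=> x0; rewrite /residue_field_inv (negPf x0).
by have /asboolP [/eqP|//] := xchooseP (residue_field_inv_ex x); rewrite (negPf x0).
Qed.

Lemma residue_field_inv0 : residue_field_inv 0 = 0.
Proof. by rewrite /residue_field_inv eqxx. Qed.

HB.instance Definition _ := GRing.ComNzRing_isField.Build residue_field
  residue_field_mulVf residue_field_inv0.

End ResidueField.

(* ker g modulo im f. The definition does not ask for g \o f = 0: it divides by
   im f restricted to ker g. *)
Section Homology.
Variables (A B C : zmodType) (f : {additive A -> B}) (g : {additive B -> C}).

Definition kernel : {pred B} := [pred x | g x == 0].

Lemma kernel_zmod_closed : zmod_closed kernel.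
Proof.
split=> [|x y]; first by rewrite inE raddf0.
by rewrite !inE raddfB => /eqP -> /eqP ->; rewrite subrr.
Qed.
HB.instance Definition _ := GRing.isZmodClosed.Build B kernel kernel_zmod_closed.

Record cycle := Cycle {cycle_val :> B; _ : cycle_val \in kernel}.
HB.instance Definition _ := [isSub for cycle_val].
HB.instance Definition _ := [Choice of cycle by <:].
HB.instance Definition _ := [SubChoice_isSubZmodule of cycle by <:].

Definition boundaries : {pred cycle} :=
  fun z => `[< exists a, f a = cycle_val z >].

Lemma boundaries_zmod_closed : zmod_closed boundaries.
Proof.
split=> [|x y /asboolP [a fa] /asboolP [b fb]]; apply/asboolP.
  by exists 0; rewrite raddf0.
by exists (a - b); rewrite raddfB fa fb.
Qed.
HB.instance Definition _ :=
  GRing.isZmodClosed.Build cycle boundaries boundaries_zmod_closed.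

Definition homology : Type := Quotient.quot (boundaries : zmodClosed cycle).
HB.instance Definition _ := ZmodQuotient.on homology.

Definition homology_class : {additive cycle -> homology} := \pi_homology.

Lemma homology_class_eq0 z :
  homology_class z = 0 <-> exists a, f a = cycle_val z.
Proof.
have -> : (homology_class z = 0) = (homology_class z = homology_class 0).
  by rewrite raddf0.
split=> [/eqP|fz].
  by rewrite /homology_class /= -Quotient.idealrBE subr0 => /asboolP.
apply/eqP; rewrite /homology_class /= -Quotient.idealrBE subr0.
exact/asboolP.
Qed.

Lemma homology_class_surj (x : homology) : exists z, homology_class z = x.
Proof. by exists (repr x); rewrite /homology_class /= reprK. Qed.

End Homology.
Arguments homology_class {A B C} f {g}.

Section HomologyMap.
Variables (A B C A' B' C' : zmodType).
Variables (f : {additive A -> B}) (g : {additive B -> C}).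
Variables (f' : {additive A' -> B'}) (g' : {additive B' -> C'}).
Variables (a : {additive A -> A'}) (b : {additive B -> B'}).
Variables (c : {additive C -> C'}).
Hypothesis abf : forall x, b (f x) = f' (a x).
Hypothesis bcg : forall x, c (g x) = g' (b x).

Lemma cycle_map_subproof (z : cycle g) : b (cycle_val z) \in kernel g'.
Proof. by case: z => z /= /eqP gz; apply/eqP; rewrite -bcg gz raddf0. Qed.

Definition cycle_map (z : cycle g) : cycle g' := Cycle (cycle_map_subproof z).

Lemma cycle_map_zmod_morphism : zmod_morphism cycle_map.
Proof. by move=> x y; apply/val_inj; rewrite /= raddfB. Qed.
HB.instance Definition _ :=
  GRing.isZmodMorphism.Build (cycle g) (cycle g') cycle_map cycle_map_zmod_morphism.

Definition homology_map_fun (x : homology f g) : homology f' g' :=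
  homology_class f' (cycle_map (repr x)).

Lemma homology_map_funE (z : cycle g) :
  homology_map_fun (homology_class f z) = homology_class f' (cycle_map z).
Proof.
apply/eqP; rewrite /homology_map_fun -subr_eq0 -!raddfB; apply/eqP.
apply/homology_class_eq0.
have /homology_class_eq0 [x fx] :
    homology_class f (repr (homology_class f z) - z) = 0.
  by rewrite raddfB {1}/homology_class /= reprK subrr.
by exists (a x); rewrite -abf fx.
Qed.

Lemma homology_map_zmod_morphism : zmod_morphism homology_map_fun.
Proof.
move=> x y; have [u <-] := homology_class_surj x.
have [v <-] := homology_class_surj y.
by rewrite -raddfB !homology_map_funE -!raddfB.
Qed.

Definition homology_map : {additive homology f g -> homology f' g'} :=
  HB.pack homology_map_fun (GRing.isZmodMorphism.Build (homology f g)
    (homology f' g') homology_map_fun homology_map_zmod_morphism).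

Lemma homology_mapE (z : cycle g) :
  homology_map (homology_class f z) = homology_class f' (cycle_map z).
Proof. exact: homology_map_funE. Qed.

End HomologyMap.

(* The order complex of a poset: its simplices are the finite chains. *)
Section OrderComplex.
Variables (d : Order.disp_t) (T : porderType d).

(* [simplex m] has m vertices, i.e. dimension m - 1; [simplex 0] is the empty
   simplex, whose presence makes the homology below reduced. *)
Record simplex (m : nat) :=
  Simplex {simplex_val :> m.-tuple T; _ : sorted <%O simplex_val}.
HB.instance Definition _ m := [isSub for @simplex_val m].
HB.instance Definition _ m := [Choice of simplex m by <:].

Lemma face_size m (i : 'I_m.+1) (s : m.+1.-tuple T) :
  size (take i s ++ drop i.+1 s) == m.
Proof.
rewrite size_cat size_takel ?size_drop size_tuple ?subSS; last exact: ltnW.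
by rewrite subnKC // -ltnS.
Qed.

Definition face_tuple m (i : 'I_m.+1) (s : m.+1.-tuple T) : m.-tuple T :=
  Tuple (face_size i s).

Lemma face_sorted m (i : 'I_m.+1) (s : simplex m.+1) : sorted <%O (face_tuple i s).
Proof.
apply: (subseq_sorted lt_trans) (valP s) => /=.
by rewrite -{3}(cat_take_drop i s) cat_subseq // -add1n -drop_drop drop_subseq.
Qed.

Definition face m (i : 'I_m.+1) (s : simplex m.+1) : simplex m :=
  Simplex (face_sorted i s).

Definition chain m := {freeg (simplex m)}.

Definition boundary m : chain m.+1 -> chain m :=
  fglift (fun s => \sum_(i < m.+1) (-1) ^+ i *: << face i s >>).

HB.instance Definition _ m := GRing.isZmodMorphism.Build (chain m.+1) (chain m)
  (@boundary m) (lift_is_additive _).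

Definition reduced_homology (i : nat) : Type :=
  homology (@boundary i.+1) (@boundary i).
HB.instance Definition _ i := ZmodQuotient.on (reduced_homology i).

End OrderComplex.

Lemma boundaryU d (T : porderType d) m (s : simplex T m.+1) :
  boundary << s >> = \sum_(i < m.+1) (-1) ^+ i *: << face i s >> :> chain T m.
Proof. by rewrite /boundary liftU scale1r. Qed.

Lemma freeg_ext (K : choiceType) (M : zmodType) (f g : {additive {freeg K} -> M}) :
  (forall k, f << k >> = g << k >>) -> f =1 g.
Proof.
move=> fg D; rewrite -[D]freeg_sumE !raddf_sum; apply: eq_bigr => k _.
have -> : << coeff k D *g k >> = << k >> *~ coeff k D :> {freeg K}.
  by rewrite freegU_mulz intz.
by rewrite !raddfMz fg.
Qed.

Section OrderComplexMap.
Variables (d d' : Order.disp_t) (T : porderType d) (T' : porderType d').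
Variables (h : T -> T') (h_mono : {homo h : x y / (x < y)%O}).

Lemma simplex_map_sorted m (s : simplex T m) : sorted <%O (map_tuple h s).
Proof. by have := valP s; apply: homo_sorted. Qed.

Definition simplex_map m (s : simplex T m) : simplex T' m :=
  Simplex (simplex_map_sorted s).

Definition chain_map m : chain T m -> chain T' m :=
  fglift (fun s => << simplex_map s >>).

HB.instance Definition _ m := GRing.isZmodMorphism.Build (chain T m) (chain T' m)
  (@chain_map m) (lift_is_additive _).

Lemma simplex_map_face m (i : 'I_m.+1) (s : simplex T m.+1) :
  simplex_map (face i s) = face i (simplex_map s).
Proof. by apply/val_inj/val_inj; rewrite /= map_cat map_take map_drop. Qed.

Lemma chain_mapU m (s : simplex T m) :
  chain_map << s >> = << simplex_map s >> :> chain T' m.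
Proof. by rewrite /chain_map liftU scale1r. Qed.

Lemma chain_map_boundary m (x : chain T m.+1) :
  chain_map (boundary x) = boundary (chain_map x).
Proof.
apply: (freeg_ext (f := @chain_map m \o @boundary _ T m)
                  (g := @boundary _ T' m \o @chain_map m.+1)) => s /=.
rewrite boundaryU chain_mapU boundaryU raddf_sum; apply: eq_bigr => i _.
have sgn_int k : (-1) ^+ k = ((-1) ^+ k)%:~R :> int by rewrite intz.
rewrite sgn_int !scaler_int raddfMz -simplex_map_face; congr (_ *~ _).
exact: chain_mapU.
Qed.

Definition reduced_homology_map i :
    {additive reduced_homology T i -> reduced_homology T' i} :=
  homology_map (@chain_map_boundary i.+1) (@chain_map_boundary i).

End OrderComplexMap.

(* Vectors of R^{2n} are columns; the (0-based) coordinates 2i and 2i+1 are those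
   along e_{i+1} and its partner \bar e_{i+1}. *)
Section Symplectic.
Variables (R : comUnitRingType) (n : nat).

Definition omega_mx : 'M[R]_(n.*2) := \matrix_(i, j)
  ((~~ odd i && (j == i.+1 :> nat))%:R - (~~ odd j && (i == j.+1 :> nat))%:R).

Definition omega (u v : 'cV[R]_(n.*2)) : R := (u^T *m omega_mx *m v) 0 0.

Definition symplectic : {pred 'M[R]_(n.*2)} :=
  fun A => `[< forall u v, omega (A *m u) (A *m v) = omega u v >].

Record Sp := MkSp {Sp_mx :> 'M[R]_(n.*2); _ : Sp_mx \in symplectic}.
HB.instance Definition _ := [isSub for Sp_mx].
HB.instance Definition _ := [Choice of Sp by <:].

Lemma omega_delta i j : omega (delta_mx i 0) (delta_mx j 0) = omega_mx i j.
Proof.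
by rewrite /omega trmx_delta -rowE -colE !mxE.
Qed.

Lemma symplecticP (A : 'M[R]_(n.*2)) :
  reflect (A^T *m omega_mx *m A = omega_mx) (A \in symplectic).
Proof.
apply: (iffP (asboolP _)) => [AP|AE u v].
  apply/matrixP => i j; rewrite -[RHS]omega_delta -AP.
  by rewrite /omega trmx_mul trmx_delta !mulmxA -!mulmxA -rowE !mulmxA -colE !mxE.
by rewrite /omega trmx_mul -{2}AE !mulmxA.
Qed.

Lemma omega_mx2 : omega_mx *m omega_mx = - 1%:M.
Proof.
apply/matrixP => i j; rewrite !mxE.
have ltp : ((if odd i then i.-1 else i.+1) < n.*2)%N.
  by have := ltn_ord i; case: ifP; lia.
rewrite (bigD1 (Ordinal ltp)) //= big1 => [|l /negP lp].
  rewrite !mxE /= addr0 -(inj_eq val_inj) /=.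
  have -> : (i == j :> nat) = (j == i :> nat) by rewrite eq_sym.
  have [oi | ei] := boolP (odd i) => /=.
    have -> : odd i.-1 = false by lia.
    have -> : (i == i.-1.+1 :> nat) = true by lia.
    have -> : (j == i.-1.+1 :> nat) = (j == i :> nat) by lia.
    have [|_] := eqVneq (j : nat) i => /= [ji|].
      have -> : (i.-1 == j.+1) = false by lia.
      by rewrite ?andbF /= mulr1n; ring.
    have -> : ~~ odd j && (i.-1 == j.+1) = false by lia.
    by rewrite ?andbF /= !mulr0n; ring.
  have -> : (i == i.+2 :> nat) = false by lia.
  rewrite eqxx /= ei andbF /= eqSS [(i : nat) == j :> nat]eq_sym.
  by have [->|_] := eqVneq (j : nat) i; rewrite ?ei ?andbF /= ?mulr1n ?mulr0n; ring.
rewrite !mxE; have -> : ~~ odd i && (l == i.+1 :> nat) = false.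
  apply/negP => /andP [oi /eqP li]; case: lp; apply/eqP/val_inj => /=.
  by rewrite (negPf oi).
have -> : ~~ odd l && (i == l.+1 :> nat) = false.
  apply/negP => /andP [ol /eqP li]; case: lp; apply/eqP/val_inj => /=.
  by rewrite li /= ol.
by rewrite subr0 mul0r.
Qed.

Lemma Sp_unit (A : Sp) : (A : 'M[R]__) \in unitmx.
Proof.
have /symplecticP AE := valP A.
suff /mulmx1_unit [] : (- (omega_mx *m (val A)^T *m omega_mx)) *m val A = 1%:M by [].
have E : omega_mx *m (val A)^T *m omega_mx *m val A =
    omega_mx *m ((val A)^T *m omega_mx *m val A) by rewrite !mulmxA.
by rewrite mulNmx E AE omega_mx2 opprK.
Qed.

Lemma Sp_one_subproof : 1%:M \in symplectic.
Proof. by apply/asboolP => u v; rewrite !mul1mx. Qed.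
Lemma Sp_mul_subproof (A B : Sp) : val A *m val B \in symplectic.
Proof.
apply/asboolP => u v; rewrite -!mulmxA.
by move/asboolP: (valP A) => ->; move/asboolP: (valP B) => ->.
Qed.
Lemma Sp_inv_subproof (A : Sp) : invmx (val A) \in symplectic.
Proof.
apply/asboolP => u v; move/asboolP: (valP A) => <-.
by rewrite !mulmxA mulmxV ?mul1mx ?Sp_unit.
Qed.

Definition Sp_one : Sp := MkSp Sp_one_subproof.
Definition Sp_mul (A B : Sp) : Sp := MkSp (Sp_mul_subproof A B).
Definition Sp_inv (A : Sp) : Sp := MkSp (Sp_inv_subproof A).

Lemma Sp_mulA : associative Sp_mul.
Proof. by move=> A B C; apply/val_inj; rewrite /= mulmxA. Qed.
Lemma Sp_mul1 : left_id Sp_one Sp_mul.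
Proof. by move=> A; apply/val_inj; rewrite /= mul1mx. Qed.
Lemma Sp_mulr1 : right_id Sp_one Sp_mul.
Proof. by move=> A; apply/val_inj; rewrite /= mulmx1. Qed.
Lemma Sp_mulV : left_inverse Sp_one Sp_inv Sp_mul.
Proof. by move=> A; apply/val_inj; rewrite /= mulVmx ?Sp_unit. Qed.
Lemma Sp_mulrV : right_inverse Sp_one Sp_inv Sp_mul.
Proof. by move=> A; apply/val_inj; rewrite /= mulmxV ?Sp_unit. Qed.

HB.instance Definition _ :=
  isGroup.Build Sp Sp_mulA Sp_mul1 Sp_mulr1 Sp_mulV Sp_mulrV.

End Symplectic.

Section SpMap.
Variables (R S : comUnitRingType) (f : {rmorphism R -> S}) (n : nat).

Lemma map_omega_mx : map_mx f (omega_mx R n) = omega_mx S n.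
Proof. by apply/matrixP => i j; rewrite !mxE rmorphB !rmorph_nat. Qed.

Lemma Sp_map_subproof (A : Sp R n) : map_mx f A \in @symplectic S n.
Proof.
have /symplecticP AE := valP A; apply/symplecticP.
by rewrite -map_omega_mx -{2}AE !map_mxM map_trmx.
Qed.

Definition Sp_map (A : Sp R n) : Sp S n := MkSp (Sp_map_subproof A).

Lemma Sp_map_morph : {morph Sp_map : A B / (A / B)%g}.
Proof.
move=> A B; apply/val_inj; apply/(canRL (mulmxK (Sp_unit _))).
by rewrite /= -map_mxM -mulmxA mulVmx ?Sp_unit // mulmx1.
Qed.
HB.instance Definition _ := isGroupMorphism.Build (Sp R n) (Sp S n)
  Sp_map Sp_map_morph.

End SpMap.

Section TitsBuilding.
Variables (k : fieldType) (n : nat).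

Definition isotropic (V : {vspace 'cV[k]_(n.*2)}) : bool :=
  `[< forall u v, u \in V -> v \in V -> omega u v = 0 >].

Record isotropic_space := IsotropicSpace {
  space_val :> {vspace 'cV[k]_(n.*2)};
  _ : (space_val != 0%VS) && isotropic space_val
}.
HB.instance Definition _ := [isSub for space_val].
HB.instance Definition _ := [Choice of isotropic_space by <:].

Definition isotropic_space_le : rel isotropic_space :=
  fun U V => (space_val U <= space_val V)%VS.
Lemma isotropic_space_le_refl : reflexive isotropic_space_le.
Proof. by move=> U; apply: subvv. Qed.
Lemma isotropic_space_le_anti : antisymmetric isotropic_space_le.
Proof. by move=> U V UV; apply/val_inj/eqP; rewrite eqEsubv. Qed.
Lemma isotropic_space_le_trans : transitive isotropic_space_le.
Proof. by move=> V U W; apply: subv_trans. Qed.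

Fact isotropic_display : Order.disp_t. Proof. exact: Order.Disp tt tt. Qed.
HB.instance Definition _ := Order.Le_isPOrder.Build isotropic_display
  isotropic_space isotropic_space_le_refl isotropic_space_le_anti
  isotropic_space_le_trans.

(* The simplices of the symplectic Tits building are the flags, i.e. the chains of
   [isotropic_space]: the building is the order complex of that poset. *)
Definition Steinberg : Type := reduced_homology isotropic_space n.-1.
HB.instance Definition _ := ZmodQuotient.on Steinberg.

Section Action.
Variable A : Sp k n.

Definition Sp_lfun : 'End('cV[k]_(n.*2)) := linfun (mulmx (Sp_mx A)).

Lemma Sp_lfunE v : Sp_lfun v = Sp_mx A *m v.
Proof. by rewrite lfunE. Qed.

Lemma Sp_lfun_ker0 : lker Sp_lfun == 0%VS.
Proof.
by apply/lker0P => u v; rewrite !Sp_lfunE; apply/can_inj/mulKmx/Sp_unit.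
Qed.

Lemma isotropic_space_map_subproof (V : isotropic_space) :
  ((Sp_lfun @: V)%VS != 0%VS) && isotropic (Sp_lfun @: V)%VS.
Proof.
have /andP [V0 /asboolP Viso] := valP V; apply/andP; split.
  by rewrite -(limg0 Sp_lfun) eq_limg_ker0 ?Sp_lfun_ker0.
apply/asboolP => _ _ /memv_imgP [u uV ->] /memv_imgP [v vV ->].
by rewrite !Sp_lfunE; move/asboolP: (valP A) => ->; apply: Viso.
Qed.

Definition isotropic_space_map (V : isotropic_space) : isotropic_space :=
  IsotropicSpace (isotropic_space_map_subproof V).

Lemma isotropic_space_map_mono :
  {homo isotropic_space_map : U V / (U < V)%O}.
Proof.
move=> U V; rewrite !lt_def -!val_eqE /= => /andP [UV leUV].
rewrite -[X in ~~ X]/((Sp_lfun @: V)%VS == (Sp_lfun @: U)%VS).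
rewrite eq_limg_ker0 ?Sp_lfun_ker0 // UV /=; exact: limgS.
Qed.

Definition Steinberg_act : {additive Steinberg -> Steinberg} :=
  reduced_homology_map isotropic_space_map_mono n.-1.

End Action.
End TitsBuilding.

Section Coinvariants.
Variables (G : groupType) (H : {pred G}) (M : zmodType) (act : G -> M -> M).

(* The subgroup of M generated by the elements h m - m with h in H. *)
Definition coinvariant_relations : {pred M} := fun x =>
  `[< forall P : {pred M}, zmod_closed P ->
      (forall h m, h \in H -> act h m - m \in P) -> x \in P >].

Lemma coinvariant_relations_zmod_closed : zmod_closed coinvariant_relations.
Proof.
split=> [|x y /asboolP Px /asboolP Py]; apply/asboolP => P Pz PH.
  by case: Pz.
by have [_ PB] := Pz; apply: PB; [apply: Px | apply: Py].
Qed.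
HB.instance Definition _ := GRing.isZmodClosed.Build M coinvariant_relations
  coinvariant_relations_zmod_closed.

Definition coinvariants : Type :=
  Quotient.quot (coinvariant_relations : zmodClosed M).
HB.instance Definition _ := ZmodQuotient.on coinvariants.

End Coinvariants.

Section CongruenceSubgroup.
Variables (R : euclideanDomainType) (p : R) (pr : prime_element p) (n : nat).

(* Gamma^omega_{2n}(p), the kernel of Sp_{2n}(R) -> Sp_{2n}(R/(p)). *)
Definition congruence_subgroup : {pred Sp R n} :=
  [pred A | Sp_map (reduction pr) A == 1%g].

Definition Steinberg_Sp_act (A : Sp R n) :
    {additive Steinberg {fraction R} n -> Steinberg {fraction R} n} :=
  Steinberg_act (Sp_map (@tofrac R) A).

Definition Steinberg_coinvariants : Type :=
  coinvariants congruence_subgroup Steinberg_Sp_act.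
HB.instance Definition _ := ZmodQuotient.on Steinberg_coinvariants.

End CongruenceSubgroup.

(* Main.v *)
(* Over a field k, every chain of n nonzero isotropic subspaces is a full flag and
   there are no longer chains, so St(k) is the group of integral combinations z of
   full flags such that, for each i, deleting the i-th space of all flags of z gives
   0.  The part of z on the flags starting with a line l is such a combination for
   l^perp/l, which makes inductions on n possible.

   Fix e and f with omega e f = 1.  A cycle all of whose first lines are
   perpendicular to f is 0.  Hence a cycle is determined by its parts at the lines l
   not perpendicular to f, and is the sum of the suspensions by {l, f} of these
   parts.

   Over K = Frac R, the cycle module is generated by the apartments of symplectic
   bases of R^2n: by induction on the largest Euclidean norm of omega(v, f), v a
   primitive generator of a first line, one subtracts apartments whose other lines
   have smaller norm.  Modulo Gamma(p) only the reduction of the basis mod p counts,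
   and since units of R/(p) lift to units, the basis can be chosen with all
   omega(v, f) zero or invertible.  The above decomposition then involves only
   suspensions by {v, f} with v in R^2n, omega(v, f) = 1, and Gamma(p) allows v to
   be taken in a fixed set of representatives mod p.  The decomposition over R/(p)
   has the same shape, so both injectivity and surjectivity of the reduction map
   follow by induction on n. *)
Require Import Defs.
From HB Require Import structures.
From mathcomp Require Import all_boot all_order all_algebra.
From mathcomp Require Import generic_quotient ring_quotient fraction.
From mathcomp Require Import boolp freeg.
From mathcomp Require Import ring zify.
Import Order.TTheory GRing.Theory.

Set Implicit Arguments.
Unset Strict Implicit.
Unset Printing Implicit Defensive.

Local Open Scope ring_scope.
Local Open Scope quotient_scope.

(** The obstacle is that a line over K which is not perpendicular to f may reduce to one that is:
    for a primitive generator v, the number omega(v, f) can be a nonzero multiple of p. The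
    decompositions over K and over R/(p) along the lines outside f^perp therefore do not correspond,
    and over K most of these lines have no generator v in R^2n with omega(v, f) = 1. For an
    apartment moved by an integral matrix g, the numbers in question form the first row of g. If h
    has the same reduction as g, then g h^-1 lies in Gamma(p), so g can be exchanged for h; lifting
    the reduced row entrywise to zeros and units gives a row with a unit entry, which can be
    completed to a symplectic matrix. Injectivity works because distinct representatives have
    distinct reductions: the reduced suspensions share no first line outside f^perp, so a vanishing
    sum forces each term to reduce to 0. The induction closes because Gamma(p) in rank n embeds in
    Gamma(p) in rank n + 1 compatibly with suspension. *)

(** * Integer spans and free abelian groups *)

Inductive zspan (M : zmodType) (P : M -> Prop) : M -> Prop :=
| zspan_gen x : P x -> zspan P x
| zspan0 : zspan P 0
| zspanB x y : zspan P x -> zspan P y -> zspan P (x - y).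

Section ZSpan.
Variables (M : zmodType) (P : M -> Prop).

Lemma zspanN x : zspan P x -> zspan P (- x).
Proof. by move=> Px; rewrite -sub0r; apply: zspanB Px; apply: zspan0. Qed.

Lemma zspanD x y : zspan P x -> zspan P y -> zspan P (x + y).
Proof. by move=> Px Py; rewrite -[y]opprK; apply: zspanB (zspanN Py). Qed.

Lemma zspanMz x (m : int) : zspan P x -> zspan P (x *~ m).
Proof.
move=> Px.
have Pn n : zspan P (x *+ n).
  by elim: n => [|n IHn]; rewrite ?mulr0n ?mulrS; [apply: zspan0 | apply: zspanD].
by case: m => n; rewrite ?NegzE ?mulrNz; [|apply: zspanN]; apply: Pn.
Qed.

Lemma zspan_sum (I : eqType) (r : seq I) (F : I -> M) :
  (forall i, i \in r -> zspan P (F i)) -> zspan P (\sum_(i <- r) F i).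
Proof.
elim: r => [|i r IHr] PF; first by rewrite big_nil; apply: zspan0.
rewrite big_cons; apply: zspanD; first by apply: PF; rewrite mem_head.
by apply: IHr => j jr; apply: PF; rewrite inE jr orbT.
Qed.

End ZSpan.

Lemma zspan_map (M N : zmodType) (P : M -> Prop) (Q : N -> Prop)
    (f : {additive M -> N}) :
  (forall x, P x -> zspan Q (f x)) -> forall x, zspan P x -> zspan Q (f x).
Proof.
move=> PQ x; elim=> [y /PQ //||y z _ Py _ Pz]; first by rewrite raddf0; apply: zspan0.
by rewrite raddfB; apply: zspanB.
Qed.

Lemma freeg_sumMz (X : choiceType) (z : {freeg X}) :
  z = \sum_(s <- dom z) << s >> *~ coeff s z.
Proof.
rewrite -[LHS]freeg_sumE; apply: eq_bigr => s _.
by rewrite freegU_mulz intz.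
Qed.

Section LinearExtension.
Variables (X Y : choiceType).
Implicit Types (f g : X -> {freeg Y}) (z : {freeg X}).

Definition lext f : {freeg X} -> {freeg Y} := fglift f.

HB.instance Definition _ f := GRing.isZmodMorphism.Build {freeg X} {freeg Y}
  (lext f) (lift_is_additive _).

Lemma lextU f s : lext f << s >> = f s.
Proof. by rewrite /lext liftU scale1r. Qed.

Lemma lextE f z : lext f z = \sum_(s <- dom z) f s *~ coeff s z.
Proof.
rewrite {1}[z]freeg_sumMz raddf_sum; apply: eq_bigr => s _.
by rewrite raddfMz; congr (_ *~ _); apply: lextU.
Qed.

Lemma eq_lext_dom f g z : {in dom z, f =1 g} -> lext f z = lext g z.
Proof. by move=> fg; rewrite !lextE; apply: eq_big_seq => s /fg ->. Qed.

Lemma eq_lext f g : f =1 g -> lext f =1 lext g.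
Proof. by move=> fg z; apply: eq_lext_dom => s _. Qed.

Lemma coeff_lext f z t :
  coeff t (lext f z) = \sum_(s <- dom z) coeff t (f s) * coeff s z.
Proof.
rewrite lextE raddf_sum; apply: eq_bigr => s _.
by rewrite raddfMz mulrzz.
Qed.

Lemma mem_dom_lext f z t :
  t \in dom (lext f z) -> exists2 s, s \in dom z & t \in dom (f s).
Proof.
rewrite mem_dom coeff_lext => /eqP nz; apply: contrapT => none; apply: nz.
rewrite big_seq big1 // => s sz; rewrite coeff_outdom ?mul0r //.
by apply/negP => ts; apply: none; exists s.
Qed.

End LinearExtension.

Lemma lext_comp (X Y Z : choiceType) (f : X -> {freeg Y}) (g : Y -> {freeg Z}) z :
  lext g (lext f z) = lext (fun s => lext g (f s)) z.
Proof.
rewrite [lext f z]lextE [RHS]lextE raddf_sum; apply: eq_bigr => s _.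
by rewrite raddfMz.
Qed.

Lemma lext_id (X : choiceType) (z : {freeg X}) : lext (fun s => << s >>) z = z.
Proof. by rewrite lextE -freeg_sumMz. Qed.

Lemma lext_sum (X Y : choiceType) (I : Type) (r : seq I) (f : I -> X -> {freeg Y}) z :
  lext (fun s => \sum_(i <- r) f i s) z = \sum_(i <- r) lext (f i) z.
Proof.
rewrite lextE; under [RHS]eq_bigr do rewrite lextE.
rewrite exchange_big; apply: eq_bigr => s _.
by rewrite mulrz_suml.
Qed.

Lemma lext_Mz (X Y : choiceType) (f : X -> {freeg Y}) (m : int) z :
  lext (fun s => f s *~ m) z = lext f z *~ m.
Proof.
by rewrite !lextE mulrz_suml; apply: eq_bigr => s _; rewrite -!mulrzA mulrC.
Qed.

Section PushForward.
Variables (X Y : choiceType).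

Definition push (f : X -> Y) : {freeg X} -> {freeg Y} := lext (fun s => << f s >>).

HB.instance Definition _ f := GRing.Additive.on (push f).

Lemma pushU f s : push f << s >> = << f s >>.
Proof. exact: lextU. Qed.

Lemma eq_push_dom f g z : {in dom z, f =1 g} -> push f z = push g z.
Proof. by move=> fg; apply: eq_lext_dom => s /fg ->. Qed.

Lemma mem_dom_push f z t :
  t \in dom (push f z) -> exists2 s, s \in dom z & t = f s.
Proof. by case/mem_dom_lext=> s sz; rewrite domU1 inE => /eqP; exists s. Qed.

(** Nothing else in the support maps to [f s], so its coefficient is that of [s]. This is how a face
    of a flag is shown not to cancel. *)
Lemma push_isolated f z s : s \in dom z ->
  (forall t, t \in dom z -> f t = f s -> t = s) -> f s \in dom (push f z).
Proof.
move=> sz iso; rewrite mem_dom coeff_lext (bigD1_seq s) ?uniq_dom //=.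
rewrite big_seq_cond big1 ?addr0 => [|t /andP [tz ts]].
  by rewrite coeffU eqxx !mulr1 mul1r -mem_dom.
rewrite coeffU; have [/(iso t tz) /eqP|_] := eqVneq (f t) (f s).
  by rewrite (negPf ts).
by rewrite mulr0 mul0r.
Qed.

Lemma push_inj_on (f : X -> Y) (P : X -> Prop) z :
  (forall s, s \in dom z -> P s) ->
  (forall s t, P s -> P t -> f s = f t -> s = t) -> push f z = 0 -> z = 0.
Proof.
move=> zP finj fz0; apply/eqP; rewrite -dom_eq0.
case: (dom z) (@push_isolated f z) zP => [//|s d] iso zP.
have := iso s (mem_head _ _); rewrite fz0 dom0 in_nil => abs.
suff: false by []; apply: abs => t tz.
by apply: finj; apply: zP; rewrite ?mem_head.
Qed.

End PushForward.

Lemma push_comp (X Y Z : choiceType) (f : X -> Y) (g : Y -> Z) z :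
  push g (push f z) = push (g \o f) z.
Proof. by rewrite /push lext_comp; apply: eq_lext => s; rewrite lextU. Qed.

Lemma push_id (X : choiceType) (z : {freeg X}) : push id z = z.
Proof. exact: lext_id. Qed.

Lemma mem_domB (X : choiceType) (x y : {freeg X}) s :
  s \in dom (x - y) -> s \in dom x \/ s \in dom y.
Proof. by move/domB; rewrite mem_cat => /orP. Qed.

Lemma mem_dom_sum (X : choiceType) (I : eqType) (r : seq I) (F : I -> {freeg X}) s :
  s \in dom (\sum_(i <- r) F i) -> exists2 i, i \in r & s \in dom (F i).
Proof.
elim: r => [|i r IHr]; first by rewrite big_nil dom0.
rewrite big_cons => /domD_subset; rewrite mem_cat => /orP [si|/IHr [j jr sj]].
  by exists i => //; rewrite mem_head.
by exists j => //; rewrite inE jr orbT.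
Qed.

Lemma mem_domMz (X : choiceType) (x : {freeg X}) (m : int) s :
  s \in dom (x *~ m) -> s \in dom x.
Proof.
rewrite !mem_dom (raddfMz (coeff s)); apply: contraNneq => /= x0.
by rewrite x0 mul0rz.
Qed.

Lemma mx_ext (R : comUnitRingType) m n (A B : 'M[R]_(m, n)) :
  (forall v : 'cV_n, A *m v = B *m v) -> A = B.
Proof.
by move=> AB; apply/matrixP => i j; have /matrixP/(_ i 0) := AB (delta_mx j 0);
  rewrite -!colE !mxE.
Qed.

(** * The symplectic form and its unipotent isometries over a ring *)

Section OmegaForm.
Variables (R : comUnitRingType) (n : nat).
Implicit Types (u v w : 'cV[R]_(n.*2)).

Lemma omegaDl u v w : omega (u + v) w = omega u w + omega v w.
Proof. by rewrite /omega linearD /= !mulmxDl mxE. Qed.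
Lemma omegaDr u v w : omega u (v + w) = omega u v + omega u w.
Proof. by rewrite /omega mulmxDr mxE. Qed.
Lemma omegaZl a u w : omega (a *: u) w = a * omega u w.
Proof. by rewrite /omega linearZ /= -!scalemxAl mxE. Qed.
Lemma omegaZr a u w : omega u (a *: w) = a * omega u w.
Proof. by rewrite /omega -scalemxAr mxE. Qed.
Lemma omegaNl u w : omega (- u) w = - omega u w.
Proof. by rewrite -scaleN1r omegaZl mulN1r. Qed.
Lemma omegaNr u w : omega u (- w) = - omega u w.
Proof. by rewrite -scaleN1r omegaZr mulN1r. Qed.
Lemma omega0l w : omega 0 w = 0.
Proof. by rewrite -(scale0r 0) omegaZl mul0r. Qed.
Lemma omega0r w : omega w 0 = 0.
Proof. by rewrite -(scale0r 0) omegaZr mul0r. Qed.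

(** Writing the matrix of the form as B - B^T gives [omega u u = 0] also when 2 is a zero divisor,
    where antisymmetry would not. *)
Let half_omega : 'M[R]_(n.*2) :=
  \matrix_(i, j) (~~ odd i && (j == i.+1 :> nat))%:R.

Let omega_mx_half : omega_mx R n = half_omega - half_omega^T.
Proof. by apply/matrixP => i j; rewrite !mxE. Qed.

Let omega_half u v : omega u v =
  (u^T *m half_omega *m v) 0 0 - (v^T *m half_omega *m u) 0 0.
Proof.
rewrite /omega omega_mx_half mulmxBr mulmxBl [LHS]mxE [X in _ + X = _]mxE.
congr (_ - _); have -> : u^T *m half_omega^T *m v = (v^T *m half_omega *m u)^T.
  by rewrite !trmx_mul trmxK mulmxA.
by rewrite [LHS]mxE.
Qed.

Lemma omegaC u v : omega u v = - omega v u.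
Proof. by rewrite !omega_half opprB. Qed.

Lemma omega_alt u : omega u u = 0.
Proof. by rewrite omega_half subrr. Qed.

Lemma omega_rowE u (j : 'I_(n.*2)) :
  omega u (delta_mx j 0) = (u^T *m omega_mx R n) 0 j.
Proof. by rewrite /omega -colE mxE. Qed.

(** The matrix of the form is invertible over any ring, with inverse its opposite. This turns a
    family of Euclidean quotients into the vector of a unipotent map. *)
Lemma omega_solve (q : 'I_(n.*2) -> R) :
  exists w, forall j, omega w (delta_mx j 0) = q j.
Proof.
exists (- (\row_j q j *m omega_mx R n))^T => j.
by rewrite omega_rowE trmxK mulNmx -mulmxA omega_mx2 mulmxN opprK mulmx1 mxE.
Qed.

Lemma omega_nondeg u : (forall j, omega u (delta_mx j 0) = 0) -> u = 0.
Proof.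
move=> u0; apply: trmx_inj; rewrite trmx0 -[LHS]mulmx1 -[1%:M]opprK -omega_mx2.
have -> : u^T *m - (omega_mx R n *m omega_mx R n) =
    - (u^T *m omega_mx R n *m omega_mx R n) by rewrite mulmxN mulmxA.
suff -> : u^T *m omega_mx R n = 0 by rewrite mul0mx oppr0.
by apply/rowP => j; rewrite -omega_rowE u0 mxE.
Qed.

Lemma omega_sp (A : Sp R n) u v : omega (A *m u) (A *m v) = omega u v.
Proof. by move/asboolP: (valP A) => ->. Qed.

Lemma SpMv (A B : Sp R n) v : (A * B)%g *m v = A *m (B *m v).
Proof. by rewrite mulmxA. Qed.
Lemma Sp1v v : (1%g : Sp R n) *m v = v.
Proof. exact: mul1mx. Qed.
Lemma SpVKv (A : Sp R n) v : A^-1%g *m (A *m v) = v.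
Proof. by rewrite -SpMv mulVg Sp1v. Qed.
Lemma SpKVv (A : Sp R n) v : A *m (A^-1%g *m v) = v.
Proof. by rewrite -SpMv mulgV Sp1v. Qed.

Lemma Sp_ext (A B : Sp R n) : (forall v, A *m v = B *m v) -> A = B.
Proof. by move=> AB; apply/val_inj/mx_ext. Qed.

Lemma Sp_mul_eq0 (A : Sp R n) v : (A *m v == 0) = (v == 0).
Proof.
apply/eqP/eqP => [Av0|->]; last exact: mulmx0.
by rewrite -(SpVKv A v) Av0 mulmx0.
Qed.

(** The Eichler transformation attached to [u] and a vector [w] perpendicular to [u]; it fixes [u],
    and for [w = 0] it is a transvection. *)
Definition eichler_mx u w (c : R) : 'M[R]_(n.*2) :=
  1%:M + w *m (u^T *m omega_mx R n) + u *m (w^T *m omega_mx R n)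
  + c *: (u *m (u^T *m omega_mx R n)).

Lemma eichler_mxE u w c v : eichler_mx u w c *m v =
  v + omega u v *: w + omega w v *: u + (c * omega u v) *: u.
Proof.
have out (x y : 'cV[R]_(n.*2)) :
    x *m (y^T *m omega_mx R n) *m v = omega y v *: x.
  rewrite -mulmxA; apply/matrixP => i j; rewrite ord1 mxE big_ord1 /omega.
  by rewrite !mxE mulrC.
by rewrite /eichler_mx !mulmxDl mul1mx -scalemxAl !out scalerA.
Qed.

Lemma eichler_symplectic u w c : omega u w = 0 -> eichler_mx u w c \in @symplectic R n.
Proof.
move=> uw0; apply/asboolP => x y; rewrite !eichler_mxE.
have wu0 : omega w u = 0 by rewrite omegaC uw0 oppr0.
rewrite !(omegaDl, omegaDr, omegaZl, omegaZr) !omega_alt uw0 wu0.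
rewrite (omegaC x w) (omegaC x u); ring.
Qed.

(** Needed to pass from statements on the first column of a matrix to its first row. The relation
    A^T W A = W exhibits a left inverse of A, which is also a right inverse. *)
Lemma Sp_tr_subproof (A : Sp R n) : (A : 'M_(n.*2))^T \in @symplectic R n.
Proof.
have /symplecticP AE := valP A; apply/symplecticP; rewrite trmxK.
have /mulmx1C : (- (omega_mx R n *m (val A)^T *m omega_mx R n)) *m val A = 1%:M.
  have E : omega_mx R n *m (val A)^T *m omega_mx R n *m val A =
    omega_mx R n *m ((val A)^T *m omega_mx R n *m val A) by rewrite !mulmxA.
  by rewrite mulNmx E AE omega_mx2 opprK.
set W := omega_mx R n; rewrite mulmxN => /(canRL opprK) E.
rewrite -[LHS]mulmx1 -[1%:M]opprK -omega_mx2 -/W mulmxN.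
have -> : val A *m W *m (val A)^T *m (W *m W) =
    val A *m (W *m (val A)^T *m W) *m W by rewrite !mulmxA.
by rewrite E mulNmx mul1mx opprK.
Qed.

Definition Sp_tr (A : Sp R n) : Sp R n := MkSp (Sp_tr_subproof A).

End OmegaForm.

(** * The splitting of the symplectic space by a hyperbolic pair *)

Section HyperbolicSplitting.
Variables (R : comUnitRingType) (n : nat).
Implicit Types (a b : 'cV[R]_2) (y z w : 'cV[R]_(n.*2)) (v : 'cV[R]_(n.+1.*2)).

(** [n.+1.*2] and [2 + n.*2] are convertible, so block matrices apply without casts; the type
    annotations only guide unification. *)
Definition cv a y : 'cV[R]_(n.+1.*2) := col_mx a y.
Definition fstv v : 'cV[R]_2 := usubmx (v : 'cV[R]_(2 + n.*2)).
Definition sndv v : 'cV[R]_(n.*2) := dsubmx (v : 'cV[R]_(2 + n.*2)).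

Lemma cvK v : cv (fstv v) (sndv v) = v.
Proof. exact: (@vsubmxK R 2 (n.*2) 1 v). Qed.
Lemma fstvK a y : fstv (cv a y) = a.
Proof. exact: (@col_mxKu R 2 (n.*2) 1 a y). Qed.
Lemma sndvK a y : sndv (cv a y) = y.
Proof. exact: (@col_mxKd R 2 (n.*2) 1 a y). Qed.
Lemma cvD a b y z : cv a y + cv b z = cv (a + b) (y + z).
Proof. exact: (@add_col_mx R 2 (n.*2) 1). Qed.
Lemma cvZ (c : R) a y : c *: cv a y = cv (c *: a) (c *: y).
Proof. exact: (@scale_col_mx R 2 (n.*2) 1). Qed.
Lemma cv0 : cv 0 0 = 0.
Proof. exact: (@col_mx0 R 2 (n.*2) 1). Qed.

Lemma omega_mxS : omega_mx R n.+1 =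
  block_mx (omega_mx R 1) 0 0 (omega_mx R n) :> 'M_(2 + n.*2).
Proof.
apply/matrixP => i j; rewrite !mxE.
case: splitP => i' ii'; rewrite !mxE; case: splitP => j' jj'; rewrite !mxE ii' jj' //.
- have -> : ~~ odd i' && (2 + j' == i'.+1)%N = false by have := ltn_ord i'; lia.
  have -> : ~~ odd (2 + j') && (i' == (2 + j').+1 :> nat)%N = false.
    by have := ltn_ord i'; lia.
  by rewrite subr0.
- have -> : ~~ odd (2 + i') && (j' == (2 + i').+1 :> nat)%N = false.
    by have := ltn_ord j'; lia.
  have -> : ~~ odd j' && (2 + i' == j'.+1)%N = false by have := ltn_ord j'; lia.
  by rewrite subr0.
- by rewrite /= !negbK !eqSS.
Qed.

Lemma omega_cv a b y z : omega (cv a y) (cv b z) = omega (n := 1) a b + omega y z.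
Proof.
have blk : (col_mx a y)^T *m block_mx (omega_mx R 1) 0 0 (omega_mx R n) *m col_mx b z =
    a^T *m omega_mx R 1 *m b + y^T *m omega_mx R n *m z.
  by rewrite tr_col_mx mul_row_block !mulmx0 addr0 add0r mul_row_col.
by rewrite /omega omega_mxS (congr1 (fun M : 'M_1 => M 0 0) blk) mxE.
Qed.

(* [e1], [f1] are the paper's e_1, \bar e_1, and [iota_v] embeds the
   2n-dimensional symplectic space as their orthogonal complement. *)
Definition e1 := cv (delta_mx 0 0) 0.
Definition f1 := cv (delta_mx 1 0) 0.
Definition iota_v y := cv 0 y.
Definition p0 v := fstv v 0 0.
Definition p1 v := fstv v 1 0.

Lemma omega2E a b : omega (n := 1) a b = a 0 0 * b 1 0 - a 1 0 * b 0 0.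
Proof.
rewrite /omega mxE big_ord_recl big_ord1 !mxE !big_ord_recl !big_ord0 !mxE /=.
have -> : fintype.lift (ord0 : 'I_2) ord0 = 1 by apply/val_inj.
have -> : (ord0 : 'I_2) = 0 by apply/val_inj.
rewrite /=; ring.
Qed.

Lemma iota_vZ (c : R) y : iota_v (c *: y) = c *: iota_v y.
Proof. by rewrite /iota_v cvZ scaler0. Qed.
Lemma iota_v0 : iota_v 0 = 0. Proof. exact: cv0. Qed.
Lemma sndv_iota y : sndv (iota_v y) = y. Proof. exact: sndvK. Qed.
Lemma sndvD u v : sndv (u + v) = sndv u + sndv v.
Proof. by rewrite /sndv -raddfD. Qed.
Lemma sndvZ (c : R) v : sndv (c *: v) = c *: sndv v.
Proof. by rewrite /sndv -linearZ. Qed.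

Lemma vecE v : v = p0 v *: e1 + p1 v *: f1 + iota_v (sndv v).
Proof.
rewrite -[LHS]cvK /e1 /f1 /iota_v !cvZ !cvD !scaler0 !addr0 !add0r; congr cv.
rewrite /p0 /p1; move: (fstv v) => a; apply/colP => i; rewrite !mxE.
by case: i => [[|[|//]] lti] /=; rewrite ?mulr1 ?mulr0 ?addr0 ?add0r;
  congr (a _ _); apply/val_inj.
Qed.

Lemma omega_e1l v : omega e1 v = p1 v.
Proof.
rewrite -[v]cvK /p1 fstvK; move: (fstv v) (sndv v) => a y.
by rewrite omega_cv omega0l addr0 omega2E !mxE /= mul1r mul0r subr0.
Qed.
Lemma omega_f1l v : omega f1 v = - p0 v.
Proof.
rewrite -[v]cvK /p0 fstvK; move: (fstv v) (sndv v) => a y.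
by rewrite omega_cv omega0l addr0 omega2E !mxE /= mul1r mul0r sub0r.
Qed.
Lemma omega_e1r v : omega v e1 = - p1 v.
Proof. by rewrite omegaC omega_e1l. Qed.
Lemma omega_f1r v : omega v f1 = p0 v.
Proof. by rewrite omegaC omega_f1l opprK. Qed.
Lemma omega_iota y z : omega (iota_v y) (iota_v z) = omega y z.
Proof. by rewrite omega_cv omega0l add0r. Qed.
Lemma omega_iotal y v : omega (iota_v y) v = omega y (sndv v).
Proof. by rewrite -[v]cvK omega_cv omega0l add0r sndvK. Qed.
Lemma omega_iotar y v : omega v (iota_v y) = omega (sndv v) y.
Proof. by rewrite omegaC omega_iotal -omegaC. Qed.

Lemma p0D u v : p0 (u + v) = p0 u + p0 v. Proof. by rewrite -!omega_f1r omegaDl. Qed.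
Lemma p1D u v : p1 (u + v) = p1 u + p1 v. Proof. by rewrite -!omega_e1l omegaDr. Qed.
Lemma p0Z c v : p0 (c *: v) = c * p0 v. Proof. by rewrite -!omega_f1r omegaZl. Qed.
Lemma p1Z c v : p1 (c *: v) = c * p1 v. Proof. by rewrite -!omega_e1l omegaZr. Qed.
Lemma p0_e1 : p0 e1 = 1. Proof. by rewrite /p0 fstvK mxE. Qed.
Lemma p1_e1 : p1 e1 = 0. Proof. by rewrite /p1 fstvK mxE. Qed.
Lemma p0_f1 : p0 f1 = 0. Proof. by rewrite /p0 fstvK mxE. Qed.
Lemma p1_f1 : p1 f1 = 1. Proof. by rewrite /p1 fstvK mxE. Qed.
Lemma p0_iota y : p0 (iota_v y) = 0. Proof. by rewrite /p0 fstvK mxE. Qed.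
Lemma p1_iota y : p1 (iota_v y) = 0. Proof. by rewrite /p1 fstvK mxE. Qed.
Lemma sndv_e1 : sndv e1 = 0. Proof. exact: sndvK. Qed.
Lemma sndv_f1 : sndv f1 = 0. Proof. exact: sndvK. Qed.

Lemma vec_eqP u v : p0 u = p0 v -> p1 u = p1 v -> sndv u = sndv v -> u = v.
Proof. by move=> h0 h1 hs; rewrite [u]vecE [v]vecE h0 h1 hs. Qed.

Lemma e1_neq0 : e1 != 0.
Proof.
by apply/eqP => /(congr1 p0); rewrite p0_e1 -(scale0r 0) p0Z mul0r => /eqP; rewrite oner_eq0.
Qed.

Lemma f1_neq0 : f1 != 0.
Proof.
by apply/eqP => /(congr1 p1); rewrite p1_f1 -(scale0r 0) p1Z mul0r => /eqP; rewrite oner_eq0.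
Qed.

Definition ord_e1 : 'I_(n.+1.*2) := lshift n.*2 (0 : 'I_2).

Lemma e1_delta : e1 = delta_mx ord_e1 0.
Proof.
apply/matrixP => i j; rewrite !mxE; case: splitP => i' ii'; rewrite !mxE.
  by rewrite -(inj_eq val_inj) [in RHS]/eq_op /= ii' -(inj_eq val_inj).
by rewrite [in RHS]/eq_op /= ii'.
Qed.

Lemma p0E v : p0 v = v ord_e1 0.
Proof. by rewrite /p0 /fstv mxE. Qed.

Lemma delta_unsplit (x : 'I_2 + 'I_(n.*2)) :
  (delta_mx (unsplit x : 'I_(2 + n.*2)) 0 : 'cV[R]_(n.+1.*2)) =
  match x with inl i => cv (delta_mx i 0) 0 | inr j => cv 0 (delta_mx j 0) end.
Proof.
suff cvP : (delta_mx (unsplit x) 0 : 'cV[R]_(2 + n.*2)) =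
  match x with inl i => col_mx (delta_mx i 0) 0 | inr j => col_mx 0 (delta_mx j 0) end.
  by case: x cvP => i; apply.
apply/matrixP => l l0; rewrite [l0]ord1 {l0}; case: x => i; rewrite !mxE;
  case: splitP => m lm; rewrite !mxE ?andbT;
  rewrite -(inj_eq val_inj) /= lm -?(inj_eq val_inj) /= ?eqn_add2l //.
- by have -> : (2 + m == i)%N = false by have := ltn_ord i; lia.
- by have -> : (nat_of_ord m == 2 + i)%N = false by have := ltn_ord m; lia.
Qed.

Lemma f1_delta : exists j, f1 = delta_mx j 0.
Proof. by exists (@unsplit 2 n.*2 (inl 1)); rewrite (delta_unsplit (inl 1)). Qed.

Lemma iota_delta j : exists j', iota_v (delta_mx j 0) = delta_mx j' 0.
Proof. by exists (@unsplit 2 n.*2 (inr j)); rewrite (delta_unsplit (inr j)). Qed.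

Lemma delta_cases (j : 'I_(n.+1.*2)) :
  [\/ delta_mx j 0 = e1, delta_mx j 0 = f1 |
      exists k, delta_mx j 0 = iota_v (delta_mx k 0)].
Proof.
rewrite -[j](splitK (j : 'I_(2 + n.*2))) delta_unsplit.
case: split => i; last by apply: Or33; exists i.
have [->|i1] := eqVneq i 0; first by apply: Or31.
apply: Or32; suff -> : i = 1 by [].
by apply/val_inj; case: i i1 => [[|[|//]] lt].
Qed.

Lemma eichE_subproof w (c : R) : eichler_mx e1 (iota_v w) c \in @symplectic R n.+1.
Proof. by apply: eichler_symplectic; rewrite omega_e1l p1_iota. Qed.
Definition eichE w (c : R) : Sp R n.+1 := MkSp (eichE_subproof w c).

(** The signs are chosen so that [eichF w c] sends [e1] to e1 + w + c f1. Thus [e1] reaches every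
    vector of [e1] coordinate 1 by a map fixing [f1]. *)
Lemma eichF_subproof w (c : R) : eichler_mx f1 (- iota_v w) (- c) \in @symplectic R n.+1.
Proof. by apply: eichler_symplectic; rewrite omegaNr omega_f1l p0_iota !oppr0. Qed.
Definition eichF w (c : R) : Sp R n.+1 := MkSp (eichF_subproof w c).

Lemma eichE_e1 w c : eichE w c *m e1 = e1.
Proof.
by rewrite eichler_mxE omega_alt omega_iotal sndv_e1 omega0r mulr0 !scale0r !addr0.
Qed.
Lemma eichE_f1 w c : eichE w c *m f1 = f1 + iota_v w + c *: e1.
Proof.
by rewrite eichler_mxE omega_e1l omega_iotal sndv_f1 omega0r p1_f1 scale0r addr0 scale1r mulr1.
Qed.
Lemma eichE_iota w c y : eichE w c *m iota_v y = iota_v y + omega w y *: e1.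
Proof.
by rewrite eichler_mxE omega_e1l omega_iota p1_iota mulr0 !scale0r !addr0.
Qed.
Lemma eichF_f1 w c : eichF w c *m f1 = f1.
Proof.
by rewrite eichler_mxE omega_alt omegaNl omega_iotal sndv_f1 omega0r oppr0 mulr0 !scale0r !addr0.
Qed.
Lemma eichF_e1 w c : eichF w c *m e1 = e1 + iota_v w + c *: f1.
Proof.
rewrite eichler_mxE omega_f1l omegaNl omega_iotal sndv_e1 omega0r p0_e1 oppr0 scale0r addr0.
by rewrite mulrNN mulr1 scaleN1r opprK.
Qed.
Lemma eichF_iota w c y : eichF w c *m iota_v y = iota_v y - omega w y *: f1.
Proof.
rewrite eichler_mxE omega_f1l omegaNl omega_iota p0_iota oppr0 mulr0 !scale0r !addr0.
by rewrite scaleNr.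
Qed.

Definition emb_mx (h : 'M[R]_(n.*2)) : 'M[R]_(n.+1.*2) := block_mx (1%:M : 'M_2) 0 0 h.
Lemma emb_mxE (h : 'M[R]_(n.*2)) a y : emb_mx h *m cv a y = cv a (h *m y).
Proof.
have blk : block_mx (1%:M : 'M_2) 0 0 h *m col_mx a y = col_mx a (h *m y).
  by rewrite mul_block_col mul1mx !mul0mx addr0 add0r.
exact: blk.
Qed.

Lemma emb_subproof (h : Sp R n) : emb_mx h \in @symplectic R n.+1.
Proof.
apply/asboolP => u v; rewrite -[u]cvK -[v]cvK !emb_mxE !omega_cv.
by rewrite omega_sp.
Qed.
Definition emb (h : Sp R n) : Sp R n.+1 := MkSp (emb_subproof h).

Lemma embE h a y : emb h *m cv a y = cv a (h *m y).
Proof. exact: emb_mxE. Qed.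
Lemma emb_e1 h : emb h *m e1 = e1.
Proof. by rewrite embE mulmx0. Qed.
Lemma emb_f1 h : emb h *m f1 = f1.
Proof. by rewrite embE mulmx0. Qed.
Lemma emb_iota h y : emb h *m iota_v y = iota_v (h *m y).
Proof. exact: embE. Qed.
Lemma embM g h : emb (g * h)%g = (emb g * emb h)%g.
Proof. by apply: Sp_ext => v; rewrite -[v]cvK SpMv !embE SpMv. Qed.
Lemma embV h : emb h^-1%g = (emb h)^-1%g.
Proof.
apply: (mulgI (emb h)); rewrite -embM !mulgV; apply: Sp_ext => v.
by rewrite -[v]cvK embE !Sp1v.
Qed.

Lemma torus_ex (a : R) : a \is a GRing.unit -> exists D : Sp R n.+1,
  [/\ D *m e1 = a *: e1, D *m f1 = a^-1 *: f1 &
      forall y, D *m iota_v y = iota_v y].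
Proof.
move=> ua.
pose d2 : 'M[R]_2 := diag_mx (\row_(i < 2) if i == 0 then a else a^-1).
pose D : 'M[R]_(n.+1.*2) := block_mx d2 0 0 (1%:M : 'M_(n.*2)).
have DE b y : D *m cv b y = cv (d2 *m b) y.
  have blk : block_mx d2 0 0 (1%:M : 'M_(n.*2)) *m col_mx b y = col_mx (d2 *m b) y.
    by rewrite mul_block_col mul1mx !mul0mx addr0 add0r.
  exact: blk.
have d2E b : d2 *m b = \col_i ((if i == 0 then a else a^-1) * b i 0).
  by apply/colP => i; rewrite /d2 mul_diag_mx !mxE.
have Dsp : D \in @symplectic R n.+1.
  apply/asboolP => u v; rewrite -[u]cvK -[v]cvK !DE !omega_cv; congr (_ + _).
  move: (fstv u) (fstv v) => b d; rewrite !d2E !omega2E !mxE /=.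
  rewrite -[RHS]mul1r -(mulrV ua); ring.
exists (MkSp Dsp); split=> [||y] /=; rewrite DE ?mulmx0 // ?cvZ ?scaler0; congr cv.
  apply/colP => i; rewrite d2E !mxE.
  by have [_|_] := eqVneq i 0; rewrite //= !mulr0.
apply/colP => i; rewrite d2E !mxE.
have [->|_] := eqVneq i 1; last by rewrite /= !mulr0.
by [].
Qed.

Lemma stab_e1f1 (A : Sp R n.+1) : A *m e1 = e1 -> A *m f1 = f1 ->
  exists h, A = emb h.
Proof.
move=> Ae Af; pose h : 'M[R]_(n.*2) := drsubmx (val A : 'M_(2 + n.*2)).
have Aiota y : A *m iota_v y = iota_v (sndv (A *m iota_v y)).
  apply: vec_eqP; last by rewrite sndv_iota.
    by rewrite p0_iota -omega_f1r -{1}Af omega_sp omega_f1r p0_iota.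
  by rewrite p1_iota -omega_e1l -{1}Ae omega_sp omega_e1l p1_iota.
have hE y : sndv (A *m iota_v y) = h *m y.
  have blk (B : 'M[R]_(2 + n.*2)) : dsubmx (B *m col_mx 0 y) = drsubmx B *m y.
    by rewrite -{1}[B]submxK mul_block_col !mulmx0 !add0r col_mxKd.
  exact: blk.
have hsp : h \in @symplectic R n.
  apply/asboolP => y z; rewrite -!hE -omega_iota -!Aiota.
  by rewrite omega_sp omega_iota.
exists (MkSp hsp); apply: Sp_ext => v; rewrite [v]vecE !mulmxDr -!scalemxAr.
by rewrite Ae Af emb_e1 emb_f1 emb_iota /= -hE -Aiota.
Qed.

(** The image of [f1] pairs to 1 with [e1], and the maps [eichE] act transitively on such vectors;
    dividing by one of them leaves the stabilizer of the pair, which consists of block matrices. *)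
Lemma stab_e1 (A : Sp R n.+1) : A *m e1 = e1 ->
  exists w c h, A = (eichE w c * emb h)%g.
Proof.
move=> Ae; pose w := sndv (A *m f1); pose c := p0 (A *m f1).
have Af : A *m f1 = eichE w c *m f1.
  have p1f : p1 (A *m f1) = 1 by rewrite -omega_e1l -{1}Ae omega_sp omega_e1l p1_f1.
  by rewrite eichE_f1 [LHS]vecE -/w -/c p1f scale1r -addrA addrC.
have [||h hE] := @stab_e1f1 ((eichE w c)^-1 * A)%g.
- by rewrite SpMv Ae -{1}(eichE_e1 w c) SpVKv.
- by rewrite SpMv Af SpVKv.
by exists w, c, h; rewrite -hE mulgA mulgV mul1g.
Qed.

End HyperbolicSplitting.

Section SpMapSplitting.
Variables (R S : comUnitRingType) (f : {rmorphism R -> S}) (n : nat).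
Implicit Types (w y : 'cV[R]_(n.*2)).

Lemma Sp_mapM (A B : Sp R n) : Sp_map f (A * B)%g = (Sp_map f A * Sp_map f B)%g.
Proof. exact: gmulfM. Qed.
Lemma Sp_mapV (A : Sp R n) : Sp_map f A^-1%g = (Sp_map f A)^-1%g.
Proof. exact: gmulfV. Qed.

Lemma Sp_map_mul (A : Sp R n) y : map_mx f (A *m y) = Sp_map f A *m map_mx f y.
Proof. exact: map_mxM. Qed.

Lemma map_cv a y : map_mx f (cv a y) = cv (map_mx f a) (map_mx f y).
Proof. exact: (@map_col_mx _ _ f 2 (n.*2) 1). Qed.
Lemma map_iota y : map_mx f (iota_v y) = iota_v (map_mx f y).
Proof. by rewrite map_cv map_mx0. Qed.
Lemma map_e1 : map_mx f (e1 R n) = e1 S n.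
Proof. by rewrite map_cv map_mx0 map_delta_mx. Qed.
Lemma map_f1 : map_mx f (f1 R n) = f1 S n.
Proof. by rewrite map_cv map_mx0 map_delta_mx. Qed.
Lemma map_sndv (v : 'cV[R]_(n.+1.*2)) : map_mx f (sndv v) = sndv (map_mx f v).
Proof. by rewrite -[v in RHS]cvK map_cv sndvK. Qed.
Lemma map_p0 (v : 'cV[R]_(n.+1.*2)) : p0 (map_mx f v) = f (p0 v).
Proof. by rewrite -{1}[v]cvK map_cv /p0 fstvK mxE. Qed.

Lemma map_omega y z : omega (map_mx f y) (map_mx f z) = f (omega y z).
Proof. by rewrite /omega -(map_omega_mx f) map_trmx -!map_mxM mxE. Qed.

Lemma Sp_map_emb (h : Sp R n) : Sp_map f (emb h) = emb (Sp_map f h).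
Proof.
apply/val_inj; have blk (B : 'M[R]_(n.*2)) : map_mx f (block_mx (1%:M : 'M_2) 0 0 B) =
    block_mx (1%:M : 'M_2) 0 0 (map_mx f B).
  by rewrite map_block_mx !map_mx0 map_mx1.
exact: blk.
Qed.

Lemma map_eichler (u w : 'cV[R]_(n.*2)) c :
  map_mx f (eichler_mx u w c) = eichler_mx (map_mx f u) (map_mx f w) (f c).
Proof.
by rewrite /eichler_mx !map_mxD map_mxZ !map_mxM !map_trmx map_omega_mx map_mx1.
Qed.

End SpMapSplitting.

Lemma Sp_map_eichE (R S : comUnitRingType) (f : {rmorphism R -> S}) n (w : 'cV[R]_(n.*2)) c :
  Sp_map f (eichE w c) = eichE (map_mx f w) (f c).
Proof. by apply/val_inj; rewrite /= map_eichler map_e1 map_iota. Qed.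
Lemma Sp_map_eichF (R S : comUnitRingType) (f : {rmorphism R -> S}) n (w : 'cV[R]_(n.*2)) c :
  Sp_map f (eichF w c) = eichF (map_mx f w) (f c).
Proof. by apply/val_inj; rewrite /= map_eichler map_f1 map_mxN map_iota rmorphN. Qed.

(** * Transitivity and lifting over a Euclidean ring *)

(** Stated for any ring with units so that it covers both R and fields, the latter with a constant
    function. *)
Definition euclidean_function (R : comUnitRingType) (N : R -> nat) : Prop :=
  forall a b : R, b != 0 -> exists q r, a = q * b + r /\ (r = 0 \/ (N r < N b)%N).

Section Transitivity.
Variables (R : comUnitRingType) (N : R -> nat).
Hypothesis NP : euclidean_function N.

Section Orbit.
Variable n : nat.
Local Notation V := 'cV[R]_(n.+1.*2).

Definition orbit_f1 (x : V) : Prop := exists h : Sp R n.+1, x = h *m f1 R n.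

(** With [q] the quotient of a division by [omega v f1], the value of [omega v] on such a vector is
    the remainder; it must be attained on the orbit for the minimality argument. In the proof,
    [eichE] adds the basis vector to [f1], and [eichF] then subtracts (1 + q) f1. *)
Lemma orbit_iota (j : 'I_(n.*2)) q : orbit_f1 (iota_v (delta_mx j 0) - q *: f1 R n).
Proof.
have [w wj] := omega_solve (fun _ : 'I_(n.*2) => 1 + q).
exists (eichF w 0 * eichE (delta_mx j 0) 0)%g.
rewrite SpMv eichE_f1 scale0r addr0 mulmxDr eichF_f1 eichF_iota wj.
by rewrite scalerDl scale1r opprD addrCA [X in _ = _ + X]addrA subrr add0r.
Qed.

Lemma orbit_e1 q : orbit_f1 (e1 R n - q *: f1 R n).
Proof.
exists (eichF 0 (- 1 - q) * eichE 0 1)%g.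
rewrite SpMv eichE_f1 iota_v0 addr0 scale1r mulmxDr eichF_f1 eichF_e1 iota_v0 addr0.
by rewrite scalerDl scaleN1r scaleNr addrCA [X in _ = _ + X]addrA subrr add0r.
Qed.

(** All coordinates being multiples of [a], the vector is [a] times one of [e1] coordinate 1, which
    [eichF] reaches from [e1]. The case [a = 0] says that a vector with vanishing pairings is 0. *)
Lemma symplectic_pairing_dvd (v : V) (a : R) :
  omega v (f1 R n) = a -> (exists c, omega v (e1 R n) = c * a) ->
  (forall j, exists c, omega v (iota_v (delta_mx j 0)) = c * a) ->
  exists g : Sp R n.+1, v = a *: (g *m e1 R n).
Proof.
move=> va [c vc] vj; have [q qP] := choice vj.
have [w wP] := omega_solve q.
exists (eichF w (- c)); rewrite eichF_e1 [v]vecE !scalerDr scalerA.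
rewrite -omega_f1r va -omega_e1l omegaC vc -iota_vZ [RHS]addrAC.
congr (_ + _ *: _ + iota_v _); first by rewrite mulrN mulrC.
apply/eqP; rewrite -subr_eq0; apply/eqP/omega_nondeg => j.
by rewrite omegaDl omegaNl omegaZl wP -omega_iotar qP mulrC subrr.
Qed.

(* A nonzero value of [omega v] on the orbit of [f1] with minimal Euclidean norm
   divides all coordinates of [v]. *)
Lemma Sp_line_transitive (v : V) : v != 0 ->
  exists (g : Sp R n.+1) (c : R), v = c *: (g *m e1 R n).
Proof.
move=> v0.
pose att m := `[< exists h : Sp R n.+1, omega v (h *m f1 R n) != 0 /\
                     N (omega v (h *m f1 R n)) = m >].
have exm : exists m, att m.
  apply: contrapT => none.
  have all0 x : orbit_f1 x -> omega v x = 0.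
    move=> [h ->]; apply: contrapT => /eqP vh; apply: none.
    by exists (N (omega v (h *m f1 R n))); apply/asboolP; exists h.
  have [||j|g vg] := @symplectic_pairing_dvd v 0.
  - by apply: all0; exists 1%g; rewrite Sp1v.
  - exists 0; rewrite mulr0; have := all0 _ (orbit_e1 0).
    by rewrite scale0r subr0.
  - exists 0; rewrite mulr0; have := all0 _ (orbit_iota j 0).
    by rewrite scale0r subr0.
  by case/eqP: v0; rewrite vg scale0r.
have [m /asboolP [h [vh0 vhm]] min_m] := ex_minnP exm.
pose v' := h^-1%g *m v; pose a := omega v (h *m f1 R n).
have vE : v = h *m v' by rewrite SpKVv.
have v'a : omega v' (f1 R n) = a by rewrite /a {1}vE omega_sp.
have dvd x : (forall q, orbit_f1 (x - q *: f1 R n)) -> exists c, omega v' x = c * a.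
  move=> xorb; have [q [r [xqr rP]]] := NP (omega v' x) vh0.
  exists q; rewrite xqr; have [->|r0] := eqVneq r 0; first by rewrite addr0.
  case: rP => [/eqP|rlt]; first by rewrite (negPf r0).
  have [k kE] := xorb q.
  have rE : omega v (h *m (k *m f1 R n)) = r.
    rewrite {1}vE omega_sp -kE omegaDr omegaNr omegaZr v'a xqr.
    by rewrite [q * a + r]addrC addrK.
  have /min_m : att (N r).
    by apply/asboolP; exists (h * k)%g; rewrite SpMv rE.
  by rewrite -vhm leqNgt rlt.
have [|j|g v'g] := symplectic_pairing_dvd v'a.
- by apply: dvd; apply: orbit_e1.
- by apply: dvd => q; apply: orbit_iota.
by exists (h * g)%g, a; rewrite vE v'g -scalemxAr SpMv.
Qed.

(** The scalar of [Sp_line_transitive] divides a unit coordinate, hence is a unit and is absorbed by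
    a diagonal matrix. *)
Lemma Sp_unimodular_transitive (v : V) i : v i 0 \is a GRing.unit ->
  exists g : Sp R n.+1, v = g *m e1 R n.
Proof.
move=> vi; have [|g [c vg]] := @Sp_line_transitive v.
  by apply: contraTneq vi => ->; rewrite mxE unitr0.
have : c \is a GRing.unit by move: vi; rewrite vg mxE unitrM => /andP [].
move=> /(@torus_ex R n) [D [De _ _]]; exists (g * D)%g.
by rewrite SpMv De -scalemxAr.
Qed.

End Orbit.

Variables (F : fieldType) (rho : {rmorphism R -> F}).
Hypothesis rho_surj : forall x, exists a, rho a = x.
Hypothesis rho_unit : forall x, x != 0 -> exists2 u, u \is a GRing.unit & rho u = x.

Lemma unit_lift : exists s : F -> R, forall x, rho (s x) = x /\
  (s x = 0 \/ s x \is a GRing.unit).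
Proof.
suff /choice [s sP] : forall x, exists y, rho y = x /\ (y = 0 \/ y \is a GRing.unit).
  by exists s.
move=> x; have [->|/rho_unit [u uU <-]] := eqVneq x 0.
  by exists 0; rewrite rmorph0; split; [|left].
by exists u; split; [|right].
Qed.

Lemma map_mx_surj m k (A : 'M[F]_(m, k)) : exists B : 'M[R]_(m, k), map_mx rho B = A.
Proof.
have [s sP] := unit_lift; exists (map_mx s A).
by apply/matrixP => i j; rewrite !mxE; have [] := sP (A i j).
Qed.

(* The first column is lifted entrywise to units and zeros, so it is unimodular
   and extends to a symplectic matrix; the rest of the matrix is lifted inside the
   stabilizer of [e1]. *)
Lemma Sp_lift_col n (A : Sp F n.+1) : (forall B : Sp F n, exists C, Sp_map rho C = B) ->
  exists2 B : Sp R n.+1, Sp_map rho B = A &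
    forall i, (B *m e1 R n) i 0 = 0 \/ (B *m e1 R n) i 0 \is a GRing.unit.
Proof.
move=> IHn; have [s sP] := unit_lift.
pose r := map_mx s (A *m e1 F n).
have rE : map_mx rho r = A *m e1 F n.
  by apply/matrixP => i j; rewrite [LHS]mxE [X in rho X]mxE; have [] := sP ((A *m e1 F n) i j).
have rU i : r i 0 = 0 \/ r i 0 \is a GRing.unit.
  by rewrite mxE; have [] := sP ((A *m e1 F n) i 0).
have [i ri] : exists i, r i 0 \is a GRing.unit.
  apply: contrapT => none; have : A *m e1 F n != 0 by rewrite Sp_mul_eq0 e1_neq0.
  rewrite -rE; case/negP; apply/eqP/matrixP => i j; rewrite [j]ord1 [LHS]mxE.
  have [->|si] := rU i; last by case: none; exists i.
  by rewrite rmorph0 mxE.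
have [g gr] := Sp_unimodular_transitive ri.
have gA : ((Sp_map rho g)^-1 * A)%g *m e1 F n = e1 F n.
  by rewrite SpMv -rE gr Sp_map_mul map_e1 SpVKv.
have [w [c [h ghE]]] := stab_e1 gA.
have [w' w'E] := map_mx_surj w; have [c' c'E] := rho_surj c.
have [h' h'E] := IHn h.
exists (g * (eichE w' c' * emb h'))%g; last first.
  by move=> j; rewrite !SpMv emb_e1 eichE_e1 -gr.
by rewrite !Sp_mapM Sp_map_eichE Sp_map_emb w'E c'E h'E -ghE mulgA mulgV mul1g.
Qed.

Lemma Sp_lift n (A : Sp F n) : exists B : Sp R n, Sp_map rho B = A.
Proof.
elim: n => [|n IHn] in A *.
  by exists 1%g; apply/val_inj; rewrite [LHS]flatmx0 [RHS]flatmx0.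
by have [B] := Sp_lift_col A IHn; exists B.
Qed.

(** The numbers [p0 (B *m delta_mx j 0)], the pairings of the columns with [f1], form the first row
    of [B], which is the first column of its transpose. *)
Lemma Sp_lift_row n (A : Sp F n.+1) : exists2 B : Sp R n.+1, Sp_map rho B = A &
  forall j, p0 (B *m delta_mx j 0) = 0 \/ p0 (B *m delta_mx j 0) \is a GRing.unit.
Proof.
have [B BA Bcol] := Sp_lift_col (Sp_tr A) (@Sp_lift n).
exists (Sp_tr B) => [|j].
  apply/val_inj; apply: trmx_inj; rewrite -[RHS]/(val (Sp_tr A)) -BA.
  by rewrite /= -map_trmx trmxK.
by have := Bcol j; rewrite e1_delta p0E -!colE !mxE.
Qed.

End Transitivity.

(** * Isotropic subspaces and flags *)

Definition ltv (k : fieldType) (T : vectType k) (U V : {vspace T}) : bool :=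
  (U <= V)%VS && (U != V).

Lemma ltv_trans (k : fieldType) (T : vectType k) : transitive (@ltv k T).
Proof.
move=> V U W /andP [UV neUV] /andP [VW neVW]; apply/andP; split.
  exact: subv_trans VW.
apply: contraNneq neVW => UW; rewrite eqEsubv VW -UW UV //.
Qed.

Section Subspaces.
Variable k : fieldType.

Section SpAction.
Variable n : nat.
Local Notation VS := {vspace 'cV[k]_(n.*2)}.
Implicit Types (A B : Sp k n) (U V : VS).

Definition gact A V : VS := (Sp_lfun A @: V)%VS.

Lemma mem_gact A V v : (v \in gact A V) = (A^-1%g *m v \in V).
Proof.
apply/memv_imgP/idP => [[u uV ->]|vV]; first by rewrite Sp_lfunE SpVKv.
by exists (A^-1%g *m v) => //; rewrite Sp_lfunE SpKVv.
Qed.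

Lemma mem_gactE A V v : (A *m v \in gact A V) = (v \in V).
Proof. by rewrite mem_gact SpVKv. Qed.

Lemma gactM A B V : gact (A * B)%g V = gact A (gact B V).
Proof. by apply/vspaceP => v; rewrite !mem_gact invgM SpMv. Qed.

Lemma gact1 V : gact 1%g V = V.
Proof. by apply/vspaceP => v; rewrite mem_gact invg1 Sp1v. Qed.

Lemma gactK A : cancel (gact A) (gact A^-1%g).
Proof. by move=> V; rewrite -gactM mulVg gact1. Qed.

Lemma gactVK A : cancel (gact A^-1%g) (gact A).
Proof. by move=> V; rewrite -gactM mulgV gact1. Qed.

Lemma gact0 A : gact A 0%VS = 0%VS.
Proof. exact: limg0. Qed.

Lemma gact_line A v : gact A <[v]>%VS = <[A *m v]>%VS.
Proof. by rewrite /gact limg_line Sp_lfunE. Qed.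

Lemma gact_sub A U V : (gact A U <= gact A V)%VS = (U <= V)%VS.
Proof.
apply/idP/idP; last exact: limgS.
by move/(limgS (Sp_lfun A^-1%g)); rewrite -!/(gact _ _) !gactK.
Qed.

Lemma ltv_gact A U V : ltv (gact A U) (gact A V) = ltv U V.
Proof. by rewrite /ltv gact_sub (inj_eq (can_inj (gactK A))). Qed.

Lemma isotropic_gact A V : isotropic (gact A V) = isotropic V.
Proof.
apply/asboolP/asboolP => isoV u v.
  by move=> uV vV; rewrite -(omega_sp A); apply: isoV; rewrite mem_gactE.
by rewrite !mem_gact => uV vV; rewrite -(omega_sp A^-1%g); apply: isoV.
Qed.

End SpAction.

Section DirectSum.
Variable n : nat.
Local Notation VS := {vspace 'cV[k]_(n.*2)}.
Local Notation VS' := {vspace 'cV[k]_(n.+1.*2)}.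
Implicit Types (L : {vspace 'cV[k]_2}) (W : VS) (V : VS').

(** The sum of [L] and [W], written as an intersection of preimages so that membership is tested
    coordinatewise. *)
Definition dsum L W : VS' :=
  ((linfun (usubmx : 'cV[k]_(2 + n.*2) -> 'cV[k]_2) @^-1: L)
   :&: (linfun (dsubmx : 'cV[k]_(2 + n.*2) -> 'cV[k]_(n.*2)) @^-1: W))%VS.

Lemma mem_dsum L W v : (v \in dsum L W) = (fstv v \in L) && (sndv v \in W).
Proof.
have -> : fstv v = (linfun (usubmx : 'cV[k]_(2 + n.*2) -> 'cV[k]_2)) v.
  by apply/esym; exact: (lfunE (usubmx : {linear 'cV[k]_(2 + n.*2) -> 'cV[k]_2})).
have -> : sndv v = (linfun (dsubmx : 'cV[k]_(2 + n.*2) -> 'cV[k]_(n.*2))) v.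
  by apply/esym; exact: (lfunE (dsubmx : {linear 'cV[k]_(2 + n.*2) -> 'cV[k]_(n.*2)})).
by rewrite memv_cap -!memv_preim.
Qed.

Definition line_e : {vspace 'cV[k]_2} := <[(delta_mx 0 0)%R]>%VS.
Definition line_f : {vspace 'cV[k]_2} := <[(delta_mx 1 0)%R]>%VS.

Lemma mem_line_e a : (a \in line_e) = (a 1 0 == 0).
Proof.
apply/vlineP/eqP => [[c ->]|a1]; first by rewrite !mxE /= mulr0.
exists (a 0 0); apply/colP => i; rewrite !mxE.
have [->|i1] := eqVneq i 1; first by rewrite a1 /= mulr0.
suff -> : i = 0 by rewrite /= mulr1.
by apply/val_inj; case: i i1 => [[|[|//]] lt].
Qed.

Lemma mem_line_f a : (a \in line_f) = (a 0 0 == 0).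
Proof.
apply/vlineP/eqP => [[c ->]|a0]; first by rewrite !mxE /= mulr0.
exists (a 1 0); apply/colP => i; rewrite !mxE.
have [->|i0] := eqVneq i 0; first by rewrite a0 /= mulr0.
suff -> : i = 1 by rewrite /= mulr1.
by apply/val_inj; case: i i0 => [[|[|//]] lt].
Qed.

Lemma mem_dsum_e W v : (v \in dsum line_e W) = (p1 v == 0) && (sndv v \in W).
Proof. by rewrite mem_dsum mem_line_e. Qed.
Lemma mem_dsum_f W v : (v \in dsum line_f W) = (p0 v == 0) && (sndv v \in W).
Proof. by rewrite mem_dsum mem_line_f. Qed.

Lemma mem_dsum0 W v : (v \in dsum 0 W) = [&& p0 v == 0, p1 v == 0 & sndv v \in W].
Proof.
rewrite mem_dsum memv0 andbA; congr (_ && _); apply/eqP/andP => [v0|[/eqP v0 /eqP v1]].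
  by rewrite /p0 /p1 v0 !mxE.
apply/colP => i; rewrite [RHS]mxE.
by case: i => [[|[|//]] lt]; [rewrite -[RHS]v0 | rewrite -[RHS]v1];
  congr (fstv v _ _); apply/val_inj.
Qed.

Lemma dsum00 : dsum 0 0 = 0%VS.
Proof.
apply/vspaceP => v; rewrite mem_dsum0 !memv0; apply/and3P/eqP.
  by case=> /eqP v0 /eqP v1 /eqP vs; rewrite [v]vecE v0 v1 vs !scale0r iota_v0 !addr0.
by move->; rewrite -(scale0r 0) p0Z p1Z sndvZ !mul0r scale0r.
Qed.

Lemma dsum_e0 : dsum line_e 0 = <[e1 k n]>%VS.
Proof.
apply/vspaceP => v; rewrite mem_dsum_e memv0; apply/andP/vlineP => [[/eqP v1 /eqP vs]|[c ->]].
  by exists (p0 v); rewrite [LHS]vecE v1 vs scale0r iota_v0 !addr0.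
by rewrite p1Z p1_e1 mulr0 sndvZ sndv_e1 scaler0.
Qed.

Lemma dsum_f0 : dsum line_f 0 = <[f1 k n]>%VS.
Proof.
apply/vspaceP => v; rewrite mem_dsum_f memv0; apply/andP/vlineP => [[/eqP v1 /eqP vs]|[c ->]].
  by exists (p1 v); rewrite [LHS]vecE v1 vs scale0r iota_v0 addr0 add0r.
by rewrite p0Z p0_f1 mulr0 sndvZ sndv_f1 scaler0.
Qed.

Lemma dsum0_line y : dsum 0 <[y]> = <[iota_v y]>%VS.
Proof.
apply/vspaceP => v; rewrite mem_dsum0.
apply/and3P/vlineP => [[/eqP v0 /eqP v1 /vlineP [c vs]]|[c ->]].
  by exists c; rewrite [LHS]vecE v0 v1 vs iota_vZ !scale0r !add0r.
rewrite p0Z p1Z p0_iota p1_iota mulr0 sndvZ sndv_iota; split=> //.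
by rewrite memvZ ?memv_line.
Qed.

Definition proj_v V : VS :=
  (linfun (mulmx (col_mx 0 1%:M : 'M[k]_(2 + n.*2, n.*2))) @^-1: V)%VS.

Lemma mem_proj V y : (y \in proj_v V) = (iota_v y \in V).
Proof.
by rewrite -memv_preim lfunE /= mul_col_mx mul0mx mul1mx.
Qed.

Lemma dsumK L : cancel (dsum L) proj_v.
Proof.
by move=> W; apply/vspaceP => y; rewrite mem_proj mem_dsum fstvK sndvK mem0v.
Qed.

Lemma dsum_sub L W W' : (dsum L W <= dsum L W')%VS = (W <= W')%VS.
Proof.
apply/subvP/subvP => sWW' v.
  by have := sWW' (iota_v v); rewrite !mem_dsum fstvK sndvK mem0v.
by rewrite !mem_dsum => /andP [-> /sWW'].
Qed.

Lemma ltv_dsum L W W' : ltv (dsum L W) (dsum L W') = ltv W W'.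
Proof. by rewrite /ltv dsum_sub (inj_eq (can_inj (dsumK L))). Qed.

Lemma dsum_subl L W : (dsum 0 W <= dsum L W)%VS.
Proof.
by apply/subvP => v; rewrite !mem_dsum memv0 => /andP [/eqP -> ->]; rewrite mem0v.
Qed.

Lemma e1_dsum_e W : e1 k n \in dsum line_e W.
Proof. by rewrite mem_dsum_e p1_e1 eqxx sndv_e1 mem0v. Qed.
Lemma e1_dsum0 W : (e1 k n \in dsum 0 W) = false.
Proof. by rewrite mem_dsum0 p0_e1 oner_eq0. Qed.
Lemma e1_dsum_f W : (e1 k n \in dsum line_f W) = false.
Proof. by rewrite mem_dsum_f p0_e1 oner_eq0. Qed.

Lemma isotropic_dsum L W : L \in [:: 0%VS; line_e; line_f] ->
  isotropic W -> isotropic (dsum L W).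
Proof.
move=> Liso /asboolP Wiso; apply/asboolP => u v.
rewrite !mem_dsum -{3}[u]cvK -{3}[v]cvK omega_cv => /andP [uL uW] /andP [vL vW].
rewrite Wiso // addr0 omega2E; move: Liso uL vL; rewrite !inE.
case/or3P=> /eqP ->; rewrite ?mem_line_e ?mem_line_f ?memv0 => /eqP u0 /eqP v0.
- by rewrite u0 v0 !mxE !mul0r subrr.
- by rewrite u0 v0 mulr0 mul0r subrr.
by rewrite u0 v0 mulr0 mul0r subrr.
Qed.

Lemma isotropic_proj V : isotropic V -> isotropic (proj_v V).
Proof.
move=> /asboolP Viso; apply/asboolP => y z; rewrite !mem_proj -omega_iota.
exact: Viso.
Qed.

(** Such a space lies in e1^perp, and removing the [e1] component of a vector stays in it. The
    quotient e1^perp/<e1> is thus represented by the orthogonal complement of the pair. *)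
Lemma isotropic_e1 V : isotropic V -> e1 k n \in V -> V = dsum line_e (proj_v V).
Proof.
move=> /asboolP Viso eV; apply/vspaceP => v; rewrite mem_dsum_e mem_proj.
have vE : p1 v = 0 -> v = p0 v *: e1 k n + iota_v (sndv v).
  by move=> v1; rewrite [LHS]vecE v1 scale0r addr0.
apply/idP/andP => [vV|[/eqP v1 svV]]; last first.
  by rewrite vE // memvD ?memvZ.
have v1 : p1 v = 0 by rewrite -omega_e1l Viso.
rewrite v1; split=> //; have -> : iota_v (sndv v) = v - p0 v *: e1 k n.
  by rewrite {2}[v]vE // addrC addKr.
by rewrite memvB ?memvZ.
Qed.

Lemma gact_emb h L W : gact (emb h) (dsum L W) = dsum L (gact h W).
Proof.
apply/vspaceP => v; rewrite mem_gact !mem_dsum mem_gact -embV.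
by rewrite -{1 2}[v]cvK embE fstvK sndvK.
Qed.

(** [eichE] moves a vector of e1^perp only by a multiple of [e1], so it acts trivially on
    e1^perp/<e1>. *)
Lemma gact_eichE w c W : gact (eichE w c) (dsum line_e W) = dsum line_e W.
Proof.
apply/eqP; rewrite eqEdim [\dim (gact _ _)]limg_dim_eq; last first.
  by rewrite (eqP (Sp_lfun_ker0 _)) capv0.
rewrite leqnn andbT; apply/subvP => _ /memv_imgP [v vW ->]; rewrite Sp_lfunE.
move: vW; rewrite !mem_dsum_e => /andP [/eqP v1 vW].
rewrite [v]vecE v1 scale0r addr0 !mulmxDr -scalemxAr eichE_e1 eichE_iota.
rewrite p1D p1Z p1_e1 mulr0 add0r p1D p1_iota p1Z p1_e1 mulr0 add0r eqxx /=.
by rewrite !sndvD !sndvZ sndv_e1 !scaler0 add0r addr0 sndv_iota.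
Qed.

End DirectSum.

End Subspaces.

Definition del (T : Type) (i : nat) (s : seq T) : seq T := take i s ++ drop i.+1 s.

Lemma map_del (T T' : Type) (f : T -> T') i s : map f (del i s) = del i (map f s).
Proof. by rewrite /del map_cat map_take map_drop. Qed.

Section Flags.
Variable k : fieldType.

Lemma field_line_transitive n (v : 'cV[k]_(n.+1.*2)) : v != 0 ->
  exists (g : Sp k n.+1) (c : k), v = c *: (g *m e1 k n).
Proof.
apply: (@Sp_line_transitive _ (fun=> 0%N)) => a b b0.
by exists (a / b), 0; rewrite divfK // addr0; split; [|left].
Qed.

(** Lists of bare subspaces, so that faces, prisms and images can be written down before they are
    known to be flags. The path starts at 0, which makes the first space nonzero. *)
Definition flag n (s : seq {vspace 'cV[k]_(n.*2)}) : Prop :=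
  [/\ size s = n, path (@ltv _ _) 0%VS s & all (@isotropic k _) s].

(* A flag of e1^perp/<e1> and the flag starting with <e1> that it induces. *)
Definition joinq n (s : seq {vspace 'cV[k]_(n.*2)}) : seq {vspace 'cV[k]_(n.+1.*2)} :=
  map (dsum (line_e k)) (0%VS :: s).

Definition projq n (s : seq {vspace 'cV[k]_(n.+1.*2)}) : seq {vspace 'cV[k]_(n.*2)} :=
  map (@proj_v k n) (behead s).

Lemma joinqK n : cancel (@joinq n) (@projq n).
Proof. by move=> s; rewrite /projq /joinq /= -map_comp (eq_map (@dsumK k n _)) map_id. Qed.

Lemma path_gact n (A : Sp k n) V s :
  path (@ltv _ _) (gact A V) (map (gact A) s) = path (@ltv _ _) V s.
Proof. by rewrite path_map; apply: eq_path => U W; rewrite /= ltv_gact. Qed.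

Lemma flag_gact n (A : Sp k n) s : flag s -> flag (map (gact A) s).
Proof.
move=> [sz p iso]; split; first by rewrite size_map.
  by rewrite -[0%VS](gact0 A) path_gact.
by rewrite all_map; apply: sub_all iso => V; rewrite /= isotropic_gact.
Qed.

Lemma e1_proj_flag n (V : {vspace _}) (s : seq {vspace 'cV[k]_(n.+1.*2)}) :
  e1 k n \in V -> path (@ltv _ _) V s -> isotropic V -> all (@isotropic k _) s ->
  [/\ V :: s = map (dsum (line_e k)) (map (@proj_v k n) (V :: s)),
      path (@ltv _ _) (proj_v V) (map (@proj_v k n) s) &
      all (@isotropic k _) (map (@proj_v k n) (V :: s))].
Proof.
move=> eV p isoV isos.
have eW W : W \in V :: s -> e1 k n \in W.
  rewrite inE => /orP [/eqP -> //|Ws].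
  have /allP/(_ W Ws)/andP [VW _] := order_path_min (@ltv_trans _ _) p.
  exact: (subvP VW).
have isoW W : W \in V :: s -> isotropic W.
  by rewrite inE => /orP [/eqP -> //|Ws]; apply: (allP isos).
have E : V :: s = map (dsum (line_e k)) (map (@proj_v k n) (V :: s)).
  rewrite -map_comp -[LHS]map_id; apply/eq_in_map => W Ws /=.
  by apply: isotropic_e1; [apply: isoW | apply: eW].
split=> //; last first.
  by apply/allP => _ /mapP [W Ws ->]; apply: isotropic_proj; apply: isoW.
move: E p => /= [EV Es]; rewrite {1}EV {1}Es [X in is_true X -> _]path_map.
by apply: sub_path => U W; rewrite /= ltv_dsum.
Qed.

Lemma Sp_e1_mem n (V : {vspace 'cV[k]_(n.+1.*2)}) : V != 0%VS ->
  exists A : Sp k n.+1, A *m e1 k n \in V.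
Proof.
rewrite -vpick0 => V0; have [A [c vA]] := field_line_transitive V0.
have c0 : c != 0 by apply: contraNneq V0 => c0; rewrite vA c0 scale0r.
exists A; have := memvZ c^-1 (memv_pick V).
by rewrite vA scalerA mulVf // scale1r.
Qed.

Lemma vspace_dim0 (V : {vspace 'cV[k]_(0.*2)}) : V = 0%VS.
Proof. by apply/vspaceP => v; rewrite [v]flatmx0 !mem0v. Qed.

Lemma flag_size_max n (s : seq {vspace 'cV[k]_(n.*2)}) :
  path (@ltv _ _) 0%VS s -> all (@isotropic k _) s -> (size s <= n)%N.
Proof.
elim: n s => [|n IHn] [|V s] //= /andP [/andP [_ V0] p] /andP [isoV isos].
  by case/eqP: V0; rewrite [RHS]vspace_dim0.
rewrite eq_sym in V0; have [A eV] := Sp_e1_mem V0.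
have [||||_] := @e1_proj_flag n (gact A^-1%g V) (map (gact A^-1%g) s).
- by rewrite mem_gact invgK.
- by rewrite path_gact.
- by rewrite isotropic_gact.
- by rewrite all_map; apply: sub_all isos => W; rewrite /= isotropic_gact.
rewrite ltnS -(size_map (gact A^-1%g)) -(size_map (@proj_v k n)).
set t := map (@proj_v k n) _ => pt /= /andP [isot isots].
(* The first space projects to 0 exactly when it is a line, and is then dropped; otherwise it stays
   and the projected chain is one longer. *)
have [p0|p0] := eqVneq (proj_v (gact A^-1%g V)) 0%VS.
  by apply: IHn => //; rewrite -p0.
suff : (size (proj_v (gact A^-1%g V) :: t) <= n)%N by apply: ltnW.
by apply: IHn => /=; rewrite ?isot // /ltv sub0v eq_sym p0.
Qed.

(** If the first space were larger than a line, its projection would be nonzero and give n + 1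
    isotropic spaces in dimension 2n, against [flag_size_max]. *)
Lemma flagSP n (s : seq {vspace 'cV[k]_(n.+1.*2)}) : flag s ->
  exists A s', flag s' /\ s = map (gact A) (joinq s').
Proof.
case: s => [[]//|V s] [[sz] /= /andP [/andP [_ V0] p] /andP [isoV isos]].
rewrite eq_sym in V0; have [A eV] := Sp_e1_mem V0.
have [||||E] := @e1_proj_flag n (gact A^-1%g V) (map (gact A^-1%g) s).
- by rewrite mem_gact invgK.
- by rewrite path_gact.
- by rewrite isotropic_gact.
- by rewrite all_map; apply: sub_all isos => W; rewrite /= isotropic_gact.
set t := map (@proj_v k n) (map _ s) => pt /= /andP [isot isots].
have szt : size t = n by rewrite !size_map.
have [pV0|pV0] := eqVneq (proj_v (gact A^-1%g V)) 0%VS.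
  exists A, t; split; first by split=> //; rewrite -pV0.
  move: E => /= -[E1 E2]; rewrite /joinq /= -pV0 -E1 -E2.
  by rewrite gactVK -map_comp (eq_map (gactVK A)) map_id.
suff : (size (proj_v (gact A^-1%g V) :: t) <= n)%N by rewrite /= szt ltnn.
by apply: flag_size_max => /=; rewrite ?isot // /ltv sub0v eq_sym pV0.
Qed.

Lemma head_flag n (s : seq {vspace 'cV[k]_(n.+1.*2)}) : flag s ->
  exists A : Sp k n.+1, head 0%VS s = <[A *m e1 k n]>%VS.
Proof.
by move=> /flagSP [A [s' [_ ->]]]; exists A; rewrite /= dsum_e0 gact_line.
Qed.

Lemma head_flag_line n (s : seq {vspace 'cV[k]_(n.*2)}) v : flag s ->
  v \in head 0%VS s -> v != 0 -> head 0%VS s = <[v]>%VS.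
Proof.
case: n s v => [|n] s v fs; first by rewrite [v]flatmx0 eqxx.
have [A ->] := head_flag fs => /vlineP [c ->] cv0.
have c0 : c != 0 by apply: contraNneq cv0 => ->; rewrite scale0r.
apply/eqP; rewrite eqEsubv -!memvE memvZ ?memv_line // andbT.
by rewrite -[X in X \in _](scalerK c0) memvZ ?memv_line.
Qed.

Lemma flag_proj n (s : seq {vspace 'cV[k]_(n.+1.*2)}) : flag s ->
  head 0%VS s = dsum (line_e k) 0 -> s = joinq (projq s) /\ flag (projq s).
Proof.
case: s => [[]//|V s] [[sz] /= /andP [/andP [_ V0] p] /andP [isoV isos]] EV.
have [||||] := @e1_proj_flag n V s => //; first by rewrite EV e1_dsum_e.
rewrite /= EV dsumK => E pt /andP [_ isot]; split; first by rewrite [LHS]E.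
by split; rewrite ?size_map.
Qed.

End Flags.

(** * Cycles of flags *)

Section FlagCycles.
Variable k : fieldType.

Definition flagchain n : Type := {freeg (seq {vspace 'cV[k]_(n.*2)})}.
HB.instance Definition _ n := GRing.Zmodule.on (flagchain n).

(* Faces of full flags at distinct positions are distinct, so the vanishing of the
   alternating sum of the faces amounts to that of each of its terms. *)
Definition flag_cycle n (z : flagchain n) : Prop :=
  (forall s, s \in dom z -> flag s) /\ (forall i, (i < n)%N -> push (del i) z = 0).

Lemma flag_cycle0 n : flag_cycle (0 : flagchain n).
Proof. by split=> [s|i _]; rewrite ?dom0 ?raddf0. Qed.

Lemma flag_cycleB n (x y : flagchain n) :
  flag_cycle x -> flag_cycle y -> flag_cycle (x - y).
Proof.
move=> [fx dx] [fy dy]; split=> [s /mem_domB [/fx|/fy] //|i ltin].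
by rewrite raddfB /= dx ?dy // subrr.
Qed.

Lemma flag_cycle_sum n (I : eqType) (r : seq I) (F : I -> flagchain n) :
  (forall i, i \in r -> flag_cycle (F i)) -> flag_cycle (\sum_(i <- r) F i).
Proof.
elim: r => [|i r IHr] rF; first by rewrite big_nil; apply: flag_cycle0.
rewrite big_cons -[\sum_(_ <- _) _]opprK; apply: flag_cycleB.
  by apply: rF; rewrite mem_head.
rewrite -sub0r; apply: flag_cycleB; first exact: flag_cycle0.
by apply: IHr => j jr; apply: rF; rewrite inE jr orbT.
Qed.

Definition cact n (A : Sp k n) : flagchain n -> flagchain n := push (map (gact A)).
HB.instance Definition _ n (A : Sp k n) := GRing.Additive.on (cact A).

Lemma cactM n (A B : Sp k n) z : cact (A * B)%g z = cact A (cact B z).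
Proof.
rewrite /cact push_comp; apply: eq_push_dom => s _ /=.
by rewrite -map_comp; apply: eq_map => V /=; rewrite gactM.
Qed.

Lemma cact1 n (z : flagchain n) : cact 1%g z = z.
Proof.
rewrite -[RHS]push_id; apply: eq_push_dom => s _.
by rewrite (eq_map (@gact1 k n)) map_id.
Qed.

Lemma cactK n (A : Sp k n) : cancel (cact A) (cact A^-1%g).
Proof. by move=> z; rewrite -cactM mulVg cact1. Qed.
Lemma cactVK n (A : Sp k n) : cancel (cact A^-1%g) (cact A).
Proof. by move=> z; rewrite -cactM mulgV cact1. Qed.

Lemma mem_dom_cact n (A : Sp k n) z s :
  (map (gact A) s \in dom (cact A z)) = (s \in dom z).
Proof.
have sub B (x : flagchain n) t : t \in dom x -> map (gact B) t \in dom (cact B x).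
  move=> tx; apply: push_isolated => // u _; apply: inj_map.
  exact: can_inj (gactK B).
apply/idP/idP; last exact: sub.
by move/(sub A^-1%g); rewrite cactK -map_comp (eq_map (gactK A)) map_id.
Qed.

Lemma flag_cycle_act n (A : Sp k n) z : flag_cycle z -> flag_cycle (cact A z).
Proof.
move=> [fz dz]; split=> [_ /mem_dom_push [s /fz fs ->]|i /dz dzi].
  exact: flag_gact.
have -> : push (del i) (cact A z) = cact A (push (del i) z).
  by rewrite /cact !push_comp; apply: eq_push_dom => s _ /=; rewrite map_del.
by rewrite dzi raddf0.
Qed.

(** The part of a chain at the line of [e1], read in e1^perp/<e1>. For any other line, the group
    first moves it to that of [e1]. *)
Definition link_part n : flagchain n.+1 -> flagchain n :=
  lext (fun s => if head 0%VS s == dsum (line_e k) 0 then << projq s >> else 0).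
HB.instance Definition _ n := GRing.Additive.on (@link_part n).

Lemma coeff_link n (z : flagchain n.+1) s :
  (forall t, t \in dom z -> flag t) -> coeff s (link_part z) = coeff (joinq s) z.
Proof.
move=> fz; rewrite coeff_lext.
have zero t : t \in dom z -> t != joinq s ->
    coeff s (if head 0%VS t == dsum (line_e k) 0 then << projq t >> else 0) *
    coeff t z = 0.
  move=> /fz ft tns; case: eqP => [ht|_]; last by rewrite coeff0 mul0r.
  have [tE _] := flag_proj ft ht; rewrite coeffU; have [ps|_] := eqVneq (projq t) s.
    by move: tns; rewrite -ps -tE eqxx.
  by rewrite mulr0 mul0r.
have [js|js] := boolP (joinq s \in dom z); last first.
  rewrite (coeff_outdom js) big_seq big1 // => t tz; apply: zero => //.
  by apply: contraNneq js => <-.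
rewrite (bigD1_seq (joinq s)) ?uniq_dom //= big_seq_cond big1 => [|t /andP [tz ts]].
  by rewrite -/(joinq s) eqxx joinqK coeffU eqxx mulr1 mul1r addr0.
exact: zero.
Qed.

Lemma mem_dom_link n (z : flagchain n.+1) s :
  (forall t, t \in dom z -> flag t) -> (s \in dom (link_part z)) = (joinq s \in dom z).
Proof. by move=> fz; rewrite !mem_dom coeff_link. Qed.

Lemma link_eq0 n (z : flagchain n.+1) : (forall t, t \in dom z -> flag t) ->
  link_part z = 0 -> forall s, s \in dom z -> head 0%VS s != dsum (line_e k) 0.
Proof.
move=> fz z0 s sz; apply/eqP => hs; have [sE _] := flag_proj (fz s sz) hs.
by move: sz; rewrite sE -mem_dom_link // z0 dom0.
Qed.

Lemma link_none n (z : flagchain n.+1) :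
  (forall s, s \in dom z -> head 0%VS s != dsum (line_e k) 0) -> link_part z = 0.
Proof.
move=> hz; rewrite /link_part lextE big_seq big1 // => s /hz /negPf ->.
by rewrite mul0rz.
Qed.

(** Deleting a space other than the first keeps the first line, so the vanishing at position i + 1
    can be split by first lines. *)
Lemma flag_cycle_link n (z : flagchain n.+1) : flag_cycle z -> flag_cycle (link_part z).
Proof.
move=> [fz dz]; split=> [s|i ltin].
  rewrite mem_dom_link // => /fz fs.
  have [] := flag_proj fs; first by [].
  by rewrite joinqK.
have -> : push (del i) (link_part z) = link_part (push (del i.+1) z).
  rewrite /link_part /push !lext_comp; apply: eq_lext_dom => s /fz [].
  case: s => [//|V s] _ _ _; rewrite lextU /= /del /=.
  case: ifP => _; last by rewrite raddf0.
  by rewrite lextU /projq /= map_cat map_take map_drop.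
by rewrite dz // raddf0.
Qed.

(** [h] is the action induced on e1^perp/<e1>. It is a mere function so as to cover both block
    matrices and [eichE], for which it is the identity. *)
Lemma link_act n (A : Sp k n.+1) (h : {vspace 'cV[k]_(n.*2)} -> {vspace 'cV[k]_(n.*2)})
    (z : flagchain n.+1) : (forall t, t \in dom z -> flag t) -> h 0%VS = 0%VS ->
  (forall W, gact A (dsum (line_e k) W) = dsum (line_e k) (h W)) ->
  link_part (cact A z) = push (map h) (link_part z).
Proof.
move=> fz h0 Ah; rewrite /link_part /cact /push !lext_comp.
apply: eq_lext_dom => s /fz fs; rewrite lextU.
have -> : head 0%VS (map (gact A) s) = gact A (head 0%VS s) by case: s {fs} => //=; rewrite gact0.
have -> : (gact A (head 0%VS s) == dsum (line_e k) 0) = (head 0%VS s == dsum (line_e k) 0).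
  by rewrite -(inj_eq (can_inj (gactK A)) (head _ _)) Ah h0.
case: eqP => [hs|_]; last by rewrite raddf0.
have [-> _] := flag_proj fs hs; move: (projq s) => t.
rewrite lextU joinqK; congr << _ >>; rewrite /projq /joinq /= -!map_comp.
by apply: eq_map => W /=; rewrite Ah dsumK.
Qed.

Lemma link_emb n h (z : flagchain n.+1) : (forall t, t \in dom z -> flag t) ->
  link_part (cact (emb h) z) = cact h (link_part z).
Proof. by move=> fz; apply: link_act => // *; rewrite ?gact0 ?gact_emb. Qed.

Lemma link_eichE n w c (z : flagchain n.+1) : (forall t, t \in dom z -> flag t) ->
  link_part (cact (eichE w c) z) = link_part z.
Proof.
move=> fz; rewrite (@link_act _ _ id) //; last by move=> W; apply: gact_eichE.
by rewrite (eq_push_dom (g := id)) ?push_id // => s _; rewrite map_id.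
Qed.

(* In the link of the first line [l] of a flag of [z], the cycle again lies in
   the perpendicular of the image of [e]: if the second space [W] of a flag is not
   perpendicular to [e] then [l] is the only line of [W] perpendicular to [e], and
   the flag cannot cancel in the boundary. So [e] lies in [l] by induction, and
   then no two flags of [z] have a common face opposite to [l]. *)
Lemma flag_cycle_perp n (e : 'cV[k]_(n.*2)) (z : flagchain n) : e != 0 -> flag_cycle z ->
  (forall s v, s \in dom z -> v \in head 0%VS s -> omega e v = 0) -> z = 0.
Proof.
elim: n => [|n IHn] in e z *; first by rewrite [e]flatmx0 eqxx.
move=> e0 cz perp; have [fz dz] := cz.
have eh s : s \in dom z -> e \in head 0%VS s.
  move=> sz; apply: contrapT => /negP es.
  have [A [s' [fs' sE]]] := flagSP (fz s sz).
  pose z1 := cact A^-1%g z; pose e' := A^-1%g *m e.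
  have cz1 : flag_cycle z1 := flag_cycle_act _ cz; have [fz1 dz1] := cz1.
  have perp1 t v : t \in dom z1 -> v \in head 0%VS t -> omega e' v = 0.
    move=> /mem_dom_push [u uz ->] vu; rewrite -(omega_sp A) SpKVv.
    apply: (perp u) => //; case: u vu {uz} => [|U u] /=.
      by rewrite !memv0 => /eqP ->; rewrite mulmx0.
    by rewrite mem_gact invgK.
  have sz1 : joinq s' \in dom z1.
    by rewrite -(mem_dom_cact A) cactVK -sE.
  have e'h : e' \notin dsum (line_e k) (0 : {vspace 'cV[k]_(n.*2)}).
    by apply: contra es => e'h; rewrite sE /= mem_gact.
  have oe : omega e' (e1 k n) = 0 by apply: perp1 sz1 _; rewrite /= e1_dsum_e.
  have p1e' : p1 e' = 0 by apply/eqP; rewrite -oppr_eq0 -omega_e1r oe.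
  have se' : sndv e' != 0.
    by apply: contraNneq e'h => se'; rewrite mem_dsum_e p1e' eqxx se' mem0v.
  have : s' \in dom (link_part z1) by rewrite mem_dom_link.
  rewrite (IHn (sndv e') (link_part z1)) ?dom0 //; first exact: flag_cycle_link.
  move=> t w; rewrite mem_dom_link // => tz1 wt; apply: contrapT => /eqP ew.
  have w0 : w != 0 by apply: contraNneq ew => ->; rewrite omega0r.
  have [_ ft] : joinq t = joinq (projq (joinq t)) /\ flag (projq (joinq t)).
    by apply: flag_proj => //; apply: fz1.
  rewrite joinqK in ft; have tw := head_flag_line ft wt w0.
  have : push (del 0) z1 = 0 by apply: dz1.
  suff : del 0 (joinq t) \in dom (push (del 0) z1) by move=> + E; rewrite E dom0.
  apply: push_isolated => // u uz1; rewrite /del /= !drop1 drop0 => bu.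
  have fu := fz1 u uz1; case: u uz1 bu fu => [|U u] uz1 /= ut fu; first by case: fu.
  rewrite ut in fu uz1 *; congr (_ :: _).
  have [B UB] := head_flag fu; rewrite /= in UB.
  have UW : (U <= dsum (line_e k) <[w]>)%VS.
    case: t tz1 wt tw ft ut fu uz1 => [|W t] _ wt tw ft _ fu _.
      by move: wt w0; rewrite /= memv0 => ->.
    by case: fu => _ /= /and3P [_ /andP [UW _] _] _; rewrite -tw.
  pose v := B *m e1 k n; rewrite -/v in UB; have vU : v \in U by rewrite UB memv_line.
  have := subvP UW v vU; rewrite mem_dsum_e => /andP [/eqP p1v /vlineP [b svb]].
  have v0 : v != 0 by rewrite Sp_mul_eq0 e1_neq0.
  have b0 : b = 0.
    have : omega e' v = 0 by apply: perp1 uz1 vU.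
    rewrite [v]vecE p1v scale0r addr0 omegaDr omegaZr oe mulr0 add0r omega_iotar.
    by rewrite svb omegaZr => /eqP; rewrite mulf_eq0 (negPf ew) orbF => /eqP.
  have vE : v = p0 v *: e1 k n.
    by rewrite [LHS]vecE p1v scale0r addr0 svb b0 scale0r iota_v0 addr0.
  have fj := head_flag_line (fz1 _ tz1); rewrite /= in fj.
  by rewrite UB; apply/esym/fj => //; rewrite {1}vE memvZ // e1_dsum_e.
have he s : s \in dom z -> head 0%VS s = <[e]>%VS.
  by move=> sz; apply: head_flag_line => //; [apply: fz | apply: eh].
apply: (@push_inj_on _ _ (del 0) (fun s => flag s /\ head 0%VS s = <[e]>%VS)).
- by move=> s sz; split; [apply: fz | apply: he].
- move=> [|U s] [|V t] [[sz1 _ _] h1] [[sz2 _ _] h2] //.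
  by rewrite /del /= !drop0 => ->; rewrite /= in h1 h2; rewrite h1 h2.
exact: dz.
Qed.

End FlagCycles.

(** * Suspensions and apartments *)

Section Suspension.
Variable k : fieldType.

Section Words.
Variable n : nat.
Local Notation VS := {vspace 'cV[k]_(n.*2)}.
Implicit Types (L : {vspace 'cV[k]_2}) (b W : VS) (s : seq VS).

(* For b = 0 and s = W_1 < ... < W_n, this is
   W_1 < ... < W_i < W_i + L < W_{i+1} + L < ... < W_n + L. *)
Definition prism L b i s := take i (map (dsum 0) s) ++ drop i (map (dsum L) (b :: s)).

(* W_1 < ... < W_i < W_{i+1} + L < ... < W_n + L, a face of two consecutive prisms. *)
Definition shift L i s := take i (map (dsum 0) s) ++ drop i (map (dsum L) s).

(** The base [b] is arbitrary because the induction on [s] replaces it by the first space of [s]. *)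
Lemma del_prism_lt L b j i s : (j.+1 < i <= size s)%N ->
  del j (prism L b i s) = prism L b i.-1 (del j s).
Proof.
elim: s b i j => [|W s IHs] b [|[|i]] [|j] //=; first by rewrite /del /prism /= ?take0 ?drop0.
rewrite !ltnS => ij; have /= := IHs W i.+1 j ij.
by rewrite /del /prism /= => ->.
Qed.

Lemma del_prism_eqS L b i s : (i < size s)%N ->
  del i (prism L b i.+1 s) = shift L i s.
Proof.
elim: s b i => [|W s IHs] b [|i] //=; first by rewrite /del /prism /shift /= ?take0 ?drop0.
by rewrite ltnS => /(IHs W); rewrite /del /prism /shift /= => ->.
Qed.

Lemma del_prism_eq L b i s : (i <= size s)%N -> del i (prism L b i s) = shift L i s.
Proof.
elim: s b i => [|W s IHs] b i; first by rewrite leqn0 => /eqP ->.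
case: i => [|i] /=; first by rewrite /del /prism /shift /= ?take0 ?drop0.
by rewrite ltnS => /(IHs W); rewrite /del /prism /shift /= => ->.
Qed.

Lemma del_prism_gt L b j i s : (i < j <= size s)%N ->
  del j (prism L b i s) = prism L b i (del j.-1 s).
Proof.
elim: s b i j => [|W s IHs] b i [|j]; rewrite /= ?ltn0 ?andbF //.
rewrite !ltnS; case: i => [|i] ij.
  by rewrite /del /prism /= take0 map_cat map_take map_drop.
case: j ij => [//|j] ij; have /= := IHs W i j.+1 ij.
by rewrite /del /prism /= => ->.
Qed.

Lemma shift_size L s : shift L (size s) s = map (dsum 0) s.
Proof. by rewrite /shift drop_oversize ?size_map // cats0 take_oversize ?size_map. Qed.

Lemma prism_cons L b i W s : prism L b i.+1 (W :: s) = dsum 0 W :: prism L W i s.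
Proof. by []. Qed.

Lemma path_prism L b i s : (exists2 a, a \in L & a != 0) -> (i <= size s)%N ->
  path (@ltv _ _) b s -> path (@ltv _ _) (dsum 0 b) (prism L b i s).
Proof.
move=> [a aL a0]; elim: s b i => [|W s IHs] b i.
  rewrite leqn0 => /eqP -> _; rewrite /prism /= andbT /ltv dsum_subl /=.
  apply: contraNneq a0 => E; have : cv a 0 \in dsum L b by rewrite mem_dsum fstvK sndvK aL mem0v.
  by rewrite -E mem_dsum fstvK memv0 => /andP [].
case: i => [|i] ile p.
  rewrite /prism drop0 /= path_map; apply/andP; split.
    rewrite /ltv dsum_subl /=.
    apply: contraNneq a0 => E.
    have : cv a 0 \in dsum L b by rewrite mem_dsum fstvK sndvK aL mem0v.
    by rewrite -E mem_dsum fstvK memv0 => /andP [].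
  move: p => /= /andP [bW p]; rewrite ltv_dsum bW /=.
  by apply: sub_path p => U V /=; rewrite ltv_dsum.
rewrite prism_cons /= ltv_dsum; move: p => /= /andP [-> p] /=.
exact: IHs.
Qed.

Lemma flag_prism L i s : L \in [:: line_e k; line_f k] -> (i <= n)%N ->
  flag s -> flag (prism L 0 i s).
Proof.
move=> LL ilen [sz p iso]; split.
- rewrite size_cat size_drop /= size_map size_takel ?size_map ?sz //.
  by rewrite subnKC // ltnW.
- rewrite -[0%VS](dsum00 k n); apply: path_prism => //; last by rewrite sz.
  move: LL; rewrite !inE => /orP [] /eqP ->.
    exists (delta_mx 0 0); first exact: memv_line.
    by apply/eqP => /matrixP/(_ 0 0)/eqP; rewrite !mxE oner_eq0.
  exists (delta_mx 1 0); first exact: memv_line.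
  by apply/eqP => /matrixP/(_ 1 0)/eqP; rewrite !mxE oner_eq0.
have iso0 : isotropic (0%VS : VS).
  by apply/asboolP => u v; rewrite !memv0 => /eqP -> _; rewrite omega0l.
rewrite all_cat; apply/andP; split; apply/allP => V.
  move/mem_take/mapP => [W Ws ->]; apply: isotropic_dsum; first by rewrite !inE eqxx.
  exact: (allP iso).
move/mem_drop/mapP => [W Ws ->]; apply: isotropic_dsum.
  by rewrite inE [_ \in _]LL orbT.
by move: Ws; rewrite inE => /orP [/eqP -> //|]; apply: (allP iso).
Qed.

Lemma head_prism L i s : (i <= size s)%N ->
  head 0%VS (prism L 0 i s) = if i == 0%N then dsum L 0 else dsum 0 (head 0%VS s).
Proof. by case: s i => [|W s] [|i] //=; rewrite ?ltn0. Qed.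

Lemma map_prism_emb (h : Sp k n) L i s :
  map (gact (emb h)) (prism L 0 i s) = prism L 0 i (map (gact h) s).
Proof.
have E K t : map (gact (emb h)) (map (dsum K) t) = map (dsum K) (map (gact h) t).
  by rewrite -!map_comp; apply: eq_map => W /=; rewrite gact_emb.
by rewrite /prism map_cat map_take map_drop !E /= gact0.
Qed.

End Words.

Definition cone n (L : {vspace 'cV[k]_2}) (z : flagchain k n) : flagchain k n.+1 :=
  \sum_(i < n.+1) push (prism L 0 i) z *~ (-1) ^+ i.

Definition susp n (z : flagchain k n) : flagchain k n.+1 :=
  cone (line_e k) z - cone (line_f k) z.

Lemma cone_is_zmod_morphism n L : zmod_morphism (@cone n L).
Proof.
move=> x y; rewrite /cone -sumrB; apply: eq_bigr => i _.
by rewrite raddfB mulrzBl.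
Qed.
HB.instance Definition _ n L :=
  GRing.isZmodMorphism.Build (flagchain k n) (flagchain k n.+1) _ (@cone_is_zmod_morphism n L).

Lemma susp_is_zmod_morphism n : zmod_morphism (@susp n).
Proof.
move=> x y; rewrite /susp [cone (line_e k) _]raddfB [cone (line_f k) _]raddfB /= !opprD !opprK.
by rewrite addrACA.
Qed.
HB.instance Definition _ n :=
  GRing.isZmodMorphism.Build (flagchain k n) (flagchain k n.+1) _ (@susp_is_zmod_morphism n).

(** A deletion away from the jump of a prism is a deletion in [z] and gives 0; the two deletions at
    a jump give the same [shift] in consecutive prisms, with opposite signs. What remains is the
    last face of the last prism, a copy of [z] that does not depend on [L] and so cancels in
    [susp]. *)
Lemma del_cone n L j (z : flagchain k n) : flag_cycle z -> (j <= n)%N ->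
  push (del j) (cone L z) = (if j == n then push (map (dsum 0)) z *~ (-1) ^+ n else 0).
Proof.
move=> [fz dz] jn; rewrite /cone raddf_sum.
have szP s : s \in dom z -> size s = n by case/fz.
have T i : push (del j) (push (prism L 0 i) z *~ (-1) ^+ i) =
    push (del j \o prism L 0 i) z *~ (-1) ^+ i.
  by rewrite raddfMz /= push_comp.
have Tlt i : (i < j)%N -> push (del j \o prism L 0 i) z = 0.
  move=> ij; transitivity (push (prism L 0 i) (push (del j.-1) z)).
    rewrite push_comp; apply: eq_push_dom => s sz /=.
    by rewrite del_prism_gt // ij szP.
  by rewrite dz ?raddf0 //; case: j ij jn {T}.
have Tgt i : (j.+1 < i)%N -> (i <= n)%N -> push (del j \o prism L 0 i) z = 0.
  move=> ij ilen; transitivity (push (prism L 0 i.-1) (push (del j) z)).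
    rewrite push_comp; apply: eq_push_dom => s sz /=.
    by rewrite del_prism_lt // ij szP.
  by rewrite dz ?raddf0 //; apply: leq_trans ilen; apply: ltnW.
have Teq : push (del j \o prism L 0 j) z = push (shift L j) z.
  by apply: eq_push_dom => s sz /=; rewrite del_prism_eq ?szP.
have TeqS : (j < n)%N -> push (del j \o prism L 0 j.+1) z = push (shift L j) z.
  by move=> jltn; apply: eq_push_dom => s sz /=; rewrite del_prism_eqS ?szP.
have jlt : (j < n.+1)%N by [].
rewrite (bigD1 (Ordinal jlt)) //= T Teq.
have [jn'|jn'] := eqVneq j n.
  rewrite big1 ?addr0 => [|i /eqP ij].
    rewrite jn'; congr (_ *~ _); apply: eq_push_dom => s sz /=.
    by have := shift_size L s; rewrite (szP s sz).
  rewrite T Tlt ?mul0rz // jn' ltn_neqAle -ltnS ltn_ord andbT.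
  by apply/eqP => E; apply: ij; apply/val_inj; rewrite /= E jn'.
have jltn : (j < n)%N by rewrite ltn_neqAle jn'.
have j1lt : (j.+1 < n.+1)%N by [].
rewrite (bigD1 (Ordinal j1lt)) /=; last by rewrite -(inj_eq val_inj) /= gtn_eqF.
rewrite T TeqS // big1 ?addr0 => [|i /andP [/eqP ij /eqP ij1]].
  by rewrite exprS mulN1r mulrNz subrr.
rewrite T; case: (ltngtP i j) => [ilt|igt|E]; first by rewrite Tlt ?mul0rz.
  have igt1 : (j.+1 < i)%N.
    by rewrite ltn_neqAle igt andbT; apply/eqP => E; apply: ij1; apply/val_inj.
  by rewrite (Tgt _ igt1) ?mul0rz // -ltnS ltn_ord.
by case: ij; apply/val_inj.
Qed.

Lemma mem_dom_cone n L (z : flagchain k n) s : s \in dom (cone L z) ->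
  exists t i, [/\ t \in dom z, (i <= n)%N & s = prism L 0 i t].
Proof.
move=> /mem_dom_sum [i _ /mem_domMz /mem_dom_push [t tz ->]].
by exists t, i; split=> //; rewrite -ltnS.
Qed.

Lemma flag_cycle_susp n (z : flagchain k n) : flag_cycle z -> flag_cycle (susp z).
Proof.
move=> cz; have [fz _] := cz; split=> [s /mem_domB [] /mem_dom_cone|j].
- move=> [t [i [/fz ft ilen ->]]]; apply: flag_prism => //; exact: mem_head.
- move=> [t [i [/fz ft ilen ->]]]; apply: flag_prism => //.
  by rewrite !inE eqxx orbT.
by rewrite ltnS => jn; rewrite raddfB /= !del_cone // subrr.
Qed.

Lemma head_susp n (z : flagchain k n) s : (forall t, t \in dom z -> flag t) ->
  s \in dom (susp z) ->
  [\/ head 0%VS s = dsum (line_e k) 0, head 0%VS s = dsum (line_f k) 0 |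
      exists2 t, t \in dom z & head 0%VS s = dsum 0 (head 0%VS t)].
Proof.
move=> fz; have szP t : t \in dom z -> size t = n by case/fz.
case/mem_domB => /mem_dom_cone [t [i [tz ilen ->]]]; rewrite head_prism ?szP //;
  case: eqP => _; by [apply: Or31 | apply: Or32 | apply: Or33; exists t].
Qed.

(** Only the prisms with [i = 0] and [L = line_e k] start with the line of [e1]: every other first
    space misses [e1]. *)
Lemma link_susp n (z : flagchain k n) : (forall t, t \in dom z -> flag t) ->
  link_part (susp z) = z.
Proof.
move=> fz; have szP t : t \in dom z -> size t = n by case/fz.
have e1h L W : e1 k n \notin dsum L W -> (dsum L W == dsum (line_e k) 0) = false.
  by move=> H; apply: contraNF H => /eqP ->; apply: e1_dsum_e.
have none L i : (i <= n)%N -> (i != 0%N) || (L == line_f k) ->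
    link_part (push (prism L 0 i) z *~ (-1) ^+ i) = 0.
  move=> ilen iL; apply: link_none => s /mem_domMz /mem_dom_push [t tz ->].
  rewrite head_prism ?szP //; move: iL; case: eqP => /= _ => [/eqP ->|_].
    by rewrite e1h // e1_dsum_f.
  by rewrite e1h // e1_dsum0.
have E L : link_part (cone L z) =
    \sum_(i < n.+1) link_part (push (prism L 0 i) z *~ (-1) ^+ i) by exact: raddf_sum.
rewrite /susp raddfB /= !E [X in _ - X]big1 => [|i _]; last first.
  by apply: none; rewrite ?eqxx ?orbT // -ltnS ltn_ord.
rewrite subr0 big_ord_recl big1 => [|i _]; last by apply: none; rewrite // lift0 ltn_ord.
rewrite addr0 /= expr0 /link_part /push lext_comp -[RHS]lext_id.
apply: eq_lext_dom => s sz; rewrite lextU /prism take0 drop0 /= eqxx.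
exact: (congr1 (fun t => << t >>) (joinqK s)).
Qed.

Lemma susp_emb n h (z : flagchain k n) : cact (emb h) (susp z) = susp (cact h z).
Proof.
have E L : cact (emb h) (cone L z) = cone L (cact h z).
  rewrite /cone raddf_sum; apply: eq_bigr => i _.
  rewrite raddfMz /= /cact !push_comp; congr (_ *~ _).
  by apply: eq_push_dom => s _ /=; rewrite map_prism_emb.
by rewrite /susp raddfB /= !E.
Qed.

(** The apartment of the standard symplectic basis as an iterated suspension: a signed sum of 2^n n!
    flags. *)
Fixpoint apartment n : flagchain k n :=
  if n is m.+1 then susp (apartment m) else << [::] >>.

Lemma flag_cycle_apartment n : flag_cycle (apartment n).
Proof.
elim: n => [|n IHn]; last exact: flag_cycle_susp.
by split=> // s; rewrite domU1 inE => /eqP ->.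
Qed.

Lemma head_apartment n s : s \in dom (apartment n.+1) ->
  exists j, head 0%VS s = <[(delta_mx j 0)%R]>%VS.
Proof.
have fdom m t : t \in dom (apartment m) -> flag t.
  by have [fa _] := flag_cycle_apartment m; apply: fa.
elim: n s => [|n IHn] s sa.
  have [A hA] := head_flag (fdom _ _ sa).
  case: (head_susp (fdom _) sa) => [hs|hs|[t]].
  - by exists (ord_e1 0); rewrite hs dsum_e0 e1_delta.
  - by have [j fj] := f1_delta k 0; exists j; rewrite hs dsum_f0 fj.
  (* Here [t] is the empty flag, whose head is 0 by default, while the head of a flag is a line. *)
  rewrite domU1 inE => /eqP -> /=; rewrite dsum00 hA => /eqP.
  by rewrite -subv0 -memvE memv0 Sp_mul_eq0 (negPf (e1_neq0 _ _)).
case: (head_susp (fdom _) sa) => [hs|hs|[t /IHn [j tj] hs]].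
- by exists (ord_e1 n.+1); rewrite hs dsum_e0 e1_delta.
- by have [j fj] := f1_delta k n.+1; exists j; rewrite hs dsum_f0 fj.
by have [j' jE] := iota_delta k j; exists j'; rewrite hs tj dsum0_line jE.
Qed.

End Suspension.

(** * Decomposition of a cycle along the lines not perpendicular to f1 *)

Section Charts.
Variables (k : fieldType) (n : nat).
Local Notation Theta := (k * 'cV[k]_(n.*2))%type.
Implicit Types (th : Theta).

(** The pair th = (c, w) parametrizes the line of e1 + w + c f1; each line not perpendicular to [f1]
    has exactly one parameter. As [uni th] fixes [f1], [chart th x] is a suspension by this line and
    that of [f1]. *)
Definition uni th : Sp k n.+1 := eichF th.2 th.1.
Definition chart th (x : flagchain k n) : flagchain k n.+1 := cact (uni th) (susp x).
HB.instance Definition _ th := GRing.isZmodMorphism.Build (flagchain k n)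
  (flagchain k n.+1) (chart th)
  (fun x y => etrans (congr1 (cact (uni th)) (raddfB (@susp k n) x y)) (raddfB _ _ _)).

Lemma uni_e1 th : uni th *m e1 k n = e1 k n + iota_v th.2 + th.1 *: f1 k n.
Proof. exact: eichF_e1. Qed.

Lemma p0_uni th v : p0 (uni th *m v) = p0 v.
Proof. by rewrite -omega_f1r -(eichF_f1 th.2 th.1) omega_sp omega_f1r. Qed.

Lemma uni_line v : p0 v != 0 -> exists th, <[v]>%VS = <[uni th *m e1 k n]>%VS.
Proof.
move=> v0; exists ((p0 v)^-1 * p1 v, (p0 v)^-1 *: sndv v).
have -> : uni ((p0 v)^-1 * p1 v, (p0 v)^-1 *: sndv v) *m e1 k n = (p0 v)^-1 *: v.
  transitivity ((p0 v)^-1 *: (p0 v *: e1 k n + p1 v *: f1 k n + iota_v (sndv v))).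
    by rewrite uni_e1 /= !scalerDr !scalerA mulVf // scale1r -iota_vZ addrAC.
  by rewrite -vecE.
apply/eqP; rewrite eqEsubv -!memvE memvZ ?memv_line // andbT.
by rewrite -{1}[v](scalerKV v0) memvZ ?memv_line.
Qed.

Lemma uni_line_inj th th' : <[uni th *m e1 k n]>%VS = <[uni th' *m e1 k n]>%VS -> th = th'.
Proof.
move=> E; have /vlineP [c cE] : uni th *m e1 k n \in <[uni th' *m e1 k n]>%VS.
  by rewrite -E memv_line.
have c1 : c = 1.
  by have /(congr1 (@p0 k n)) := cE; rewrite p0Z !p0_uni p0_e1 mulr1 => <-.
move: cE; rewrite c1 scale1r !uni_e1 => cE.
have := congr1 (@sndv k n) cE; have := congr1 (@p1 k n) cE.
rewrite !p1D !p1Z !p1_iota p1_e1 p1_f1 !mulr1 !add0r => e1E.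
rewrite !sndvD !sndvZ !sndv_iota sndv_e1 sndv_f1 !scaler0 !addr0 !add0r => e2E.
by case: th th' e1E e2E {E cE} => a b [a' b'] /= -> ->.
Qed.

Lemma head_cact (A : Sp k n.+1) (t : seq {vspace 'cV[k]_(n.+1.*2)}) :
  head 0%VS (map (gact A) t) = gact A (head 0%VS t).
Proof. by case: t => //=; rewrite gact0. Qed.

(** Among the first lines of a suspension only that of [e1] is not perpendicular to [f1], and
    [uni th] preserves the pairing with [f1]. *)
Lemma head_chart th x s v : (forall t, t \in dom x -> flag t) -> s \in dom (chart th x) ->
  v \in head 0%VS s -> p0 v != 0 -> head 0%VS s = <[uni th *m e1 k n]>%VS.
Proof.
move=> fx /mem_dom_push [t tx ->]; rewrite head_cact mem_gact.
set v' := _ *m v => v't; have -> : p0 v = p0 v' by rewrite -(p0_uni th v') SpKVv.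
case: (head_susp fx tx) v't => [->|->|[t' _ ->]].
- by rewrite dsum_e0 gact_line.
- by rewrite mem_dsum_f => /andP [->].
by rewrite mem_dsum0 => /andP [->].
Qed.

Lemma flag_cycle_chart th x : flag_cycle x -> flag_cycle (chart th x).
Proof. by move=> cx; apply/flag_cycle_act/flag_cycle_susp. Qed.

Definition chart_link th (z : flagchain k n.+1) : flagchain k n :=
  link_part (cact (uni th)^-1%g z).
HB.instance Definition _ th := GRing.isZmodMorphism.Build (flagchain k n.+1)
  (flagchain k n) (chart_link th)
  (fun x y => etrans (congr1 (@link_part k n) (raddfB (cact (uni th)^-1%g) x y)) (raddfB _ _ _)).

Lemma flag_cycle_chart_link th z : flag_cycle z -> flag_cycle (chart_link th z).
Proof. by move=> cz; apply/flag_cycle_link/flag_cycle_act. Qed.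

Lemma chart_link_eq0 th z : flag_cycle z -> chart_link th z = 0 ->
  forall s, s \in dom z -> head 0%VS s != <[uni th *m e1 k n]>%VS.
Proof.
move=> cz z0 s sz; have [fz _] := flag_cycle_act (uni th)^-1%g cz.
have := link_eq0 fz z0; move/(_ (map (gact (uni th)^-1%g) s)).
rewrite mem_dom_cact head_cact => /(_ sz); apply: contra => /eqP ->.
by rewrite -gact_line gactK dsum_e0.
Qed.

Lemma chart_linkK th x : (forall t, t \in dom x -> flag t) -> chart_link th (chart th x) = x.
Proof. by move=> fx; rewrite /chart_link /chart cactK link_susp. Qed.

Lemma chart_link_neq th th' x : (forall t, t \in dom x -> flag t) -> th != th' ->
  chart_link th (chart th' x) = 0.
Proof.
move=> fx thN; apply: link_none => s /mem_dom_push [t tx ->].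
rewrite head_cact; apply/eqP => E.
have ht : head 0%VS t = <[uni th *m e1 k n]>%VS.
  by rewrite -(gactVK (uni th) (head _ _)) E dsum_e0 gact_line.
case/eqP: thN; apply: uni_line_inj; rewrite -ht.
apply: (head_chart fx tx (v := uni th *m e1 k n)); first by rewrite ht memv_line.
by rewrite p0_uni p0_e1 oner_eq0.
Qed.

(** Both sides have the same links at the parameters in [r], so the first lines of the difference
    are perpendicular to [f1] and [flag_cycle_perp] applies. The list [r] may contain parameters of
    lines that do not occur in [z]. *)
Lemma chart_decomposition (z : flagchain k n.+1) (r : seq Theta) : flag_cycle z -> uniq r ->
  (forall s v, s \in dom z -> v \in head 0%VS s -> p0 v != 0 ->
    exists2 th, th \in r & head 0%VS s = <[uni th *m e1 k n]>%VS) ->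
  z = \sum_(th <- r) chart th (chart_link th z).
Proof.
move=> cz ur hz.
have cl th : flag_cycle (chart_link th z) by apply: flag_cycle_chart_link.
have fl th t : t \in dom (chart_link th z) -> flag t by case: (cl th) => + _; apply.
set S := \sum_(_ <- _) _.
have cD : flag_cycle (z - S).
  by apply: flag_cycleB => //; apply: flag_cycle_sum => th _; apply: flag_cycle_chart.
have linkD th : th \in r -> chart_link th (z - S) = 0.
  move=> thr; rewrite raddfB /= /S raddf_sum (bigD1_seq th) //= chart_linkK; last exact: fl.
  rewrite big1 ?addr0 ?subrr // => th' thN.
  by rewrite chart_link_neq // 1?eq_sym //; apply: fl.
apply/eqP; rewrite -subr_eq0; apply/eqP.
apply: (flag_cycle_perp (e := f1 k n)) => //.
  exact: f1_neq0.
move=> s v sD vs; rewrite omega_f1l; apply/eqP; rewrite oppr_eq0.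
apply: contrapT => /negP v0.
have [th thr hs] : exists2 th, th \in r & head 0%VS s = <[uni th *m e1 k n]>%VS.
  case/mem_domB: (sD) => [sz|]; first exact: (hz s v).
  case/mem_dom_sum => th thr sc; exists th => //.
  by apply: (head_chart _ sc vs v0); apply: fl.
by have := chart_link_eq0 cD (linkD th thr) sD; rewrite hs eqxx.
Qed.

End Charts.

(** * Generation by integral apartments *)

Section IntegralApartments.
Variables (R : comUnitRingType) (N : R -> nat) (K : fieldType) (i : {rmorphism R -> K}).
Hypothesis NP : euclidean_function N.
Hypothesis frac : forall x : K, exists a b, i b != 0 /\ x * i b = i a.

Lemma common_denominator m (v : 'cV[K]_m) : exists r b, i b != 0 /\ i b *: v = map_mx i r.
Proof.
have /choice [a] : forall j, exists a, exists b, i b != 0 /\ v j 0 * i b = i a.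
  by move=> j; apply: frac.
move=> /choice [b bP]; pose d := \prod_j b j.
exists (\col_j (a j * \prod_(l | l != j) b l)), d; split.
  by rewrite rmorph_prod /=; apply/prodf_neq0 => j _; case: (bP j).
apply/colP => j; rewrite !mxE rmorphM -(bP j).2 /d (bigD1 j) //= rmorphM /=.
by rewrite mulrC mulrA.
Qed.

(** After clearing denominators the vector is a multiple of g e1 for an integral [g], by Euclidean
    transitivity. *)
Lemma integral_line n (v : 'cV[K]_(n.+1.*2)) : v != 0 ->
  exists g : Sp R n.+1, <[v]>%VS = <[Sp_map i g *m e1 K n]>%VS.
Proof.
move=> v0; have [r [b [b0 bv]]] := common_denominator v.
have r0 : r != 0.
  by apply: contraNneq v0 => r0; rewrite -(scalerK b0 v) bv r0 map_mx0 scaler0.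
have [g [c gc]] := Sp_line_transitive NP r0; exists g.
have bvE : i b *: v = i c *: (Sp_map i g *m e1 K n).
  by rewrite bv gc map_mxZ Sp_map_mul map_e1.
have c0 : i c != 0.
  by apply: contraNneq v0 => c0; rewrite -(scalerK b0 v) bvE c0 scale0r scaler0.
apply/eqP; rewrite eqEsubv -!memvE; apply/andP; split.
  by rewrite -(scalerK b0 v) bvE memvZ // memvZ // memv_line.
by rewrite -(scalerK c0 (Sp_map i g *m _)) -bvE memvZ // memvZ // memv_line.
Qed.

Definition integral n : flagchain K n -> Prop :=
  zspan (fun z => exists g : Sp R n, z = cact (Sp_map i g) (apartment K n)).

(* The generator is required to be primitive because [N] need not be monotone for
   divisibility. *)
Definition small n (m : nat) (l : {vspace 'cV[K]_(n.+1.*2)}) : Prop :=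
  exists g : Sp R n.+1, l = <[Sp_map i g *m e1 K n]>%VS /\
    (p0 (g *m e1 R n) = 0 \/ (N (p0 (g *m e1 R n)) < m)%N).

Lemma small_le n m m' (l : {vspace 'cV[K]_(n.+1.*2)}) : (m <= m')%N -> small m l -> small m' l.
Proof.
move=> mm' [g [lg [g0|gm]]]; exists g; split=> //; [by left | right].
exact: leq_trans mm'.
Qed.

(** All entries of the first row are divided by the first one at once: [w] encodes the quotients on
    the complement of the pair, and [c] the one for [f1]. *)
Lemma reduce_row n (g : Sp R n.+1) : p0 (g *m e1 R n) != 0 ->
  exists w c, forall j, delta_mx j 0 != e1 R n ->
    p0 (g *m (eichE w c *m delta_mx j 0)) = 0 \/
    (N (p0 (g *m (eichE w c *m delta_mx j 0%R))) < N (p0 (g *m e1 R n)))%N.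
Proof.
move=> m0; set m := p0 (g *m e1 R n) in m0 *.
have /choice [q] : forall j : 'I_(n.*2), exists q, exists r,
    p0 (g *m iota_v (delta_mx j 0)) = q * m + r /\ (r = 0 \/ (N r < N m)%N).
  by move=> j; apply: NP.
move=> /choice [r qrP]; have [w wP] := omega_solve (fun j => - q j).
(* The image of [f1] under [eichE w c] involves [w], so this quotient is taken once [w] is fixed. *)
have [q' [r' [qr' rP']]] := NP (p0 (g *m f1 R n) + p0 (g *m iota_v w)) m0.
exists w, (- q') => j; case: (delta_cases R j) => [->|->|[l ->]] jN; first by rewrite eqxx in jN.
  rewrite eichE_f1 !mulmxDr !p0D -scalemxAr p0Z qr' -/m.
  by have -> : q' * m + r' + - q' * m = r' by ring.
rewrite eichE_iota wP mulmxDr p0D -scalemxAr p0Z (qrP l).1 -/m.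
have -> : q l * m + r l + - q l * m = r l by ring.
by case: (qrP l).
Qed.

(* The apartment of [h], lifted along [g] and sheared along the line of [g e1] so
   that its other lines get small [e1] coordinates. *)
Lemma integral_lift n (g : Sp R n.+1) m (x : flagchain K n) :
  p0 (g *m e1 R n) != 0 -> (N (p0 (g *m e1 R n)) <= m)%N -> integral x ->
  exists y, [/\ integral y, flag_cycle y,
    link_part (cact (Sp_map i g)^-1%g y) = x &
    forall s, s \in dom y ->
      head 0%VS s = <[Sp_map i g *m e1 K n]>%VS \/ small m (head 0%VS s)].
Proof.
move=> g0 gm; elim=> [_ [h ->]||x1 x2 _ [y1 [iy1 cy1 ly1 sy1]] _ [y2 [iy2 cy2 ly2 sy2]]].
- pose g1 := (g * emb h)%g.
  have g1e : g1 *m e1 R n = g *m e1 R n by rewrite SpMv emb_e1.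
  have [|w [c wcP]] := @reduce_row _ g1; first by rewrite g1e.
  exists (cact (Sp_map i (g1 * eichE w c)%g) (apartment K n.+1)); split.
  + by apply: zspan_gen; exists (g1 * eichE w c)%g.
  + exact/flag_cycle_act/flag_cycle_apartment.
  + have [fa _] := flag_cycle_apartment K n.
    have [fsa _] := flag_cycle_apartment K n.+1.
    rewrite -cactM !Sp_mapM -!mulgA mulKg cactM Sp_map_emb Sp_map_eichE link_emb; last first.
      by case: (flag_cycle_act (eichE (map_mx i w) (i c)) (flag_cycle_apartment K n.+1)).
    by rewrite link_eichE // link_susp.
  move=> s /mem_dom_push [t /head_apartment [j tj] ->].
  rewrite head_cact tj gact_line.
  have dE : delta_mx j 0 = map_mx i (delta_mx j 0) :> 'cV[K]_(n.+1.*2).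
    by rewrite map_delta_mx.
  have [je|je] := eqVneq (delta_mx j 0) (e1 R n).
    left; rewrite dE je -Sp_map_mul SpMv eichE_e1 g1e Sp_map_mul map_e1 //.
  right; have [|t' t'E] := @Sp_unimodular_transitive _ _ NP n (delta_mx j 0) j.
    by rewrite mxE !eqxx unitr1.
  exists (g1 * eichE w c * t')%g; split.
    by rewrite dE -Sp_map_mul t'E -SpMv Sp_map_mul map_e1.
  rewrite (SpMv (g1 * eichE w c)%g) (SpMv g1) -t'E; case: (wcP j je) => [E|lt]; first by left.
  by right; apply: leq_trans lt _; rewrite g1e.
- exists 0; split; [exact: zspan0 | exact: flag_cycle0 | by rewrite !raddf0 |].
  by move=> s; rewrite dom0.
exists (y1 - y2); split; [exact: zspanB | exact: flag_cycleB | |].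
  by rewrite raddfB [link_part _]raddfB /= ly1 ly2.
by move=> s /mem_domB [/sy1|/sy2].
Qed.

Theorem integral_apartments n (z : flagchain K n) : flag_cycle z -> integral z.
Proof.
elim: n z => [|n IHn] z cz.
  have [fz _] := cz; rewrite [z]freeg_sumMz; apply: zspan_sum => s /fz [/size0nil -> _ _].
  apply: zspanMz; apply: zspan_gen; exists 1%g.
  have -> : Sp_map i 1%g = 1%g :> Sp K 0 by apply/val_inj; rewrite [LHS]flatmx0 [RHS]flatmx0.
  by rewrite cact1.
have bounded m (z' : flagchain K n.+1) : flag_cycle z' ->
    (forall s, s \in dom z' -> small m (head 0%VS s)) -> integral z'.
  elim: m z' => [|m IHm] z' cz' sz'.
    (* No norm is below 0, so every first line is perpendicular to [f1]. *)
    suff -> : z' = 0 by apply: zspan0.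
    apply: (@flag_cycle_perp K n.+1 (f1 K n) z') => //.
      exact: f1_neq0.
    move=> s v /sz' [g [-> [g0|//]]] /vlineP [c ->].
    by rewrite omega_f1l p0Z -(map_e1 i) -Sp_map_mul map_p0 g0 rmorph0 mulr0 oppr0.
  (* [r] lists first lines only known to be [small m.+1]. Each step of the induction on [r] cancels
     the part of [z'] at one of them, adding only lines that are [small m]. *)
  have : exists r : seq {vspace 'cV[K]_(n.+1.*2)}, forall s, s \in dom z' ->
      small m (head 0%VS s) \/ head 0%VS s \in r /\ small m.+1 (head 0%VS s).
    exists (map (head 0%VS) (dom z')) => s sd; right; split; last exact: sz'.
    exact: map_f.
  case=> r; elim: r z' cz' {sz'} => [|l r IHr] z' cz' rz'.
    by apply: IHm => // s /rz' [|[]].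
  have [lm|lm] := pselect (small m l).
    apply: IHr => // s /rz' [|[]]; first by left.
    by rewrite inE => /orP [/eqP ->|]; [left | right].
  have [[g [lg gm]]|lm1] := pselect (small m.+1 l); last first.
    apply: IHr => // s /rz' [|[]]; first by left.
    by rewrite inE => /orP [/eqP ->|]; [|right].
  have g0 : p0 (g *m e1 R n) != 0.
    by apply/eqP => g0; apply: lm; exists g; split; [|left].
  have {}gm : (N (p0 (g *m e1 R n)) <= m)%N by case: gm => // /eqP; rewrite (negPf g0).
  have cA : flag_cycle (cact (Sp_map i g)^-1%g z') by apply: flag_cycle_act.
  have [y [iy cy ly sy]] := integral_lift g0 gm (IHn _ (flag_cycle_link cA)).
  have cD : flag_cycle (z' - y) by apply: flag_cycleB.
  suff : integral (z' - y) by move=> iD; rewrite -[z'](subrK y); apply: zspanD.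
  have hD s : s \in dom (z' - y) -> head 0%VS s != l.
    move=> sD; have [fD _] := flag_cycle_act (Sp_map i g)^-1%g cD.
    have := link_eq0 fD; rewrite raddfB [link_part _]raddfB /= ly subrr => /(_ erefl).
    move/(_ (map (gact (Sp_map i g)^-1%g) s)); rewrite -raddfB mem_dom_cact head_cact => /(_ sD).
    by apply: contra => /eqP ->; rewrite lg -gact_line gactK dsum_e0.
  apply: IHr => // s sD; have sl := hD s sD.
  case/mem_domB: sD => [/rz' [|[]]|/sy [E|]]; try by left.
    by rewrite inE (negPf sl); right.
  by rewrite E -lg eqxx in sl.
have [m mP] : exists m, forall s, s \in dom z -> small m (head 0%VS s).
  have [fz _] := cz; elim: (dom z) fz => [|s d IHd] fz; first by exists 0%N.
  have [|m mP] := IHd; first by move=> t td; apply: fz; rewrite inE td orbT.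
  have [A hA] := head_flag (fz s (mem_head _ _)).
  have [|g gE] := @integral_line n (A *m e1 K n); first by rewrite Sp_mul_eq0 e1_neq0.
  exists (maxn m (N (p0 (g *m e1 R n))).+1) => t.
  rewrite inE => /orP [/eqP ->|/mP]; last by apply: small_le; apply: leq_maxl.
  by exists g; split; [rewrite hA gE | right; apply: leq_maxr].
exact: bounded mP.
Qed.

End IntegralApartments.

(** * Reduction modulo the prime *)

(** Among the subspaces contained in [P], one of maximal dimension contains every vector of [P]. *)
Lemma vspace_of_pred (k : fieldType) (T : vectType k) (P : T -> Prop) :
  P 0 -> (forall u v, P u -> P v -> P (u + v)) -> (forall c u, P u -> P (c *: u)) ->
  exists U : {vspace T}, forall v, v \in U <-> P v.
Proof.
move=> P0 PD PZ.
pose good d := `[< exists U : {vspace T}, \dim U = d /\ forall v, v \in U -> P v >].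
have ex_good : exists d, good d.
  exists 0%N; apply/asboolP; exists 0%VS; rewrite dimv0; split=> // v.
  by rewrite memv0 => /eqP ->.
have good_le d : good d -> (d <= \dim {:T})%N.
  by move=> /asboolP [U [<- _]]; apply: dimvS; apply: subvf.
have [d /asboolP [U [dU UP]] max_d] := ex_maxnP ex_good good_le.
exists U => v; split=> [/UP //|Pv].
have : good (\dim (U + <[v]>)).
  apply/asboolP; exists (U + <[v]>)%VS; split=> // _ /memv_addP [u uU [_ /vlineP [c ->] ->]].
  by apply: PD; [apply: UP | apply: PZ].
move/max_d; rewrite -dU => dimle.
have /eqP -> : U == (U + <[v]>)%VS by rewrite eqEdim addvSl.
by rewrite memvE addvSr.
Qed.

Lemma big_uniq_sub (M : nmodType) (I : eqType) (r r' : seq I) (F : I -> M) :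
  uniq r -> uniq r' -> {subset r <= r'} -> (forall j, j \notin r -> F j = 0) ->
  \sum_(j <- r') F j = \sum_(j <- r) F j.
Proof.
move=> ur ur' sub F0; rewrite (bigID (mem r)) /= [X in _ + X]big1 // addr0 -big_filter.
apply: perm_big; apply: uniq_perm; rewrite ?filter_uniq // => j.
by rewrite mem_filter; apply/andP/idP => [[]//|jr]; rewrite [_ \in r']sub.
Qed.

Section Reduction.
Variables (R : comUnitRingType) (N : R -> nat) (K F : fieldType).
Variables (i : {rmorphism R -> K}) (rho : {rmorphism R -> F}).
Hypothesis NP : euclidean_function N.
Hypothesis frac : forall x : K, exists a b, i b != 0 /\ x * i b = i a.
Hypothesis i_inj : injective i.
Hypothesis rho_surj : forall x, exists a, rho a = x.
Hypothesis rho_unit : forall x, x != 0 -> exists2 u, u \is a GRing.unit & rho u = x.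

(** The reduction of [V] is the image mod p of its integral vectors. It is stable under scalars
    because [rho] is surjective. *)
Lemma red_ex m (V : {vspace 'cV[K]_m}) : exists U : {vspace 'cV[F]_m},
  forall v, v \in U <-> exists r : 'cV[R]_m, map_mx i r \in V /\ map_mx rho r = v.
Proof.
apply: vspace_of_pred.
- by exists 0; rewrite !map_mx0 mem0v.
- move=> _ _ [r [rV <-]] [s [sV <-]]; exists (r + s).
  by rewrite !map_mxD memvD.
move=> c _ [r [rV <-]]; have [a <-] := rho_surj c; exists (a *: r).
by rewrite !map_mxZ memvZ.
Qed.

Definition red m (V : {vspace 'cV[K]_m}) : {vspace 'cV[F]_m} := projT1 (cid (red_ex V)).

Lemma mem_red m (V : {vspace 'cV[K]_m}) v :
  v \in red V <-> exists r : 'cV[R]_m, map_mx i r \in V /\ map_mx rho r = v.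
Proof. exact: (projT2 (cid (red_ex V))). Qed.

Lemma map_i_inj m k : injective (@map_mx R K i m k).
Proof. by move=> A B /matrixP AB; apply/matrixP => j l; have := AB j l; rewrite !mxE => /i_inj. Qed.

Lemma red_sub m (U V : {vspace 'cV[K]_m}) : (U <= V)%VS -> (red U <= red V)%VS.
Proof.
move=> UV; apply/subvP => v /mem_red [r [rU <-]]; apply/mem_red.
by exists r; split=> //; apply: (subvP UV).
Qed.

Lemma red0 m : red (0%VS : {vspace 'cV[K]_m}) = 0%VS.
Proof.
apply/vspaceP => v; rewrite memv0; apply/idP/eqP => [/mem_red [r []]|->]; last exact: mem0v.
by rewrite memv0 -(map_mx0 i) => /eqP /map_i_inj -> <-; rewrite map_mx0.
Qed.

Lemma red_gact n (g : Sp R n) V : red (gact (Sp_map i g) V) = gact (Sp_map rho g) (red V).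
Proof.
apply/vspaceP => v; rewrite mem_gact; apply/idP/idP => /mem_red [r].
  rewrite mem_gact -Sp_mapV -Sp_map_mul => -[rV <-]; apply/mem_red.
  by exists (g^-1%g *m r); split=> //; rewrite -Sp_mapV -Sp_map_mul.
move=> [rV rE]; apply/mem_red; exists (g *m r).
by rewrite !Sp_map_mul mem_gactE rE SpKVv.
Qed.

Lemma red_line_e : red (line_e K) = line_e F.
Proof.
apply/vspaceP => v; rewrite mem_line_e; apply/idP/eqP => [/mem_red [r [rV <-]]|v1].
  move: rV; rewrite mem_line_e !mxE -(rmorph0 i) => /eqP /i_inj ->.
  by rewrite rmorph0.
have [a aE] := rho_surj (v 0 0); apply/mem_red; exists (a *: delta_mx 0 0); split.
  by rewrite mem_line_e !mxE mulr0 rmorph0.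
have : v \in line_e F by rewrite mem_line_e v1.
case/vlineP=> c vE; rewrite map_mxZ map_delta_mx vE aE vE; congr (_ *: _).
by rewrite !mxE mulr1.
Qed.

Lemma red_line_f : red (line_f K) = line_f F.
Proof.
apply/vspaceP => v; rewrite mem_line_f; apply/idP/eqP => [/mem_red [r [rV <-]]|v1].
  move: rV; rewrite mem_line_f !mxE -(rmorph0 i) => /eqP /i_inj ->.
  by rewrite rmorph0.
have [a aE] := rho_surj (v 1 0); apply/mem_red; exists (a *: delta_mx 1 0); split.
  by rewrite mem_line_f !mxE mulr0 rmorph0.
have : v \in line_f F by rewrite mem_line_f v1.
case/vlineP=> c vE; rewrite map_mxZ map_delta_mx vE aE vE; congr (_ *: _).
by rewrite !mxE mulr1.
Qed.

Lemma map_fstv (S : fieldType) (f : {rmorphism R -> S}) n (r : 'cV[R]_(n.+1.*2)) :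
  map_mx f (fstv r) = fstv (map_mx f r).
Proof. by rewrite -[r in RHS]cvK map_cv fstvK. Qed.

Lemma red_dsum n L (W : {vspace 'cV[K]_(n.*2)}) : red (dsum L W) = dsum (red L) (red W).
Proof.
apply/vspaceP => v; rewrite mem_dsum; apply/idP/andP => [/mem_red [r [rV <-]]|].
  move: rV; rewrite mem_dsum -!map_fstv -!map_sndv => /andP [rL rW].
  by split; apply/mem_red; [exists (fstv r) | exists (sndv r)].
move=> [/mem_red [a [aL aE]] /mem_red [y [yW yE]]]; apply/mem_red.
by exists (cv a y); rewrite !map_cv mem_dsum fstvK sndvK aL yW aE yE cvK.
Qed.

Lemma red_isotropic n (V : {vspace 'cV[K]_(n.*2)}) : isotropic V -> isotropic (red V).
Proof.
move=> /asboolP isoV; apply/asboolP => _ _ /mem_red [r [rV <-]] /mem_red [s [sV <-]].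
rewrite map_omega; have := isoV _ _ rV sV; rewrite map_omega -(rmorph0 i) => /i_inj ->.
by rewrite rmorph0.
Qed.

Lemma Sp_e1_red n (V : {vspace 'cV[K]_(n.+1.*2)}) : V != 0%VS ->
  exists g : Sp R n.+1, Sp_map i g *m e1 K n \in V.
Proof.
move=> V0; have [A AV] := Sp_e1_mem V0.
have [|g gE] := integral_line NP frac (v := A *m e1 K n).
  by rewrite Sp_mul_eq0 e1_neq0.
by exists g; rewrite memvE -gE -memvE.
Qed.

(** Strictness of inclusions survives reduction. Instead of comparing dimensions, an integral [g]
    moves a line of [U] to that of [e1]; this line splits off both spaces, before and after
    reduction, and the induction applies. *)
Lemma red_eq n (U V : {vspace 'cV[K]_(n.*2)}) : isotropic U -> isotropic V ->
  (U <= V)%VS -> red U = red V -> U = V.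
Proof.
elim: n => [|n IHn] in U V *; first by rewrite [U]vspace_dim0 [V]vspace_dim0.
move=> isoU isoV UV rUV; have [U0|U0] := eqVneq U 0%VS.
  have [->//|V0] := eqVneq V 0%VS.
  have [g gV] := Sp_e1_red V0; have : Sp_map rho g *m e1 F n \in red V.
    by apply/mem_red; exists (g *m e1 R n); rewrite !Sp_map_mul !map_e1.
  by rewrite -rUV U0 red0 memv0 Sp_mul_eq0 (negPf (e1_neq0 _ _)).
have [g gU] := Sp_e1_red U0.
pose U' := gact (Sp_map i g^-1%g) U; pose V' := gact (Sp_map i g^-1%g) V.
have eU : e1 K n \in U' by rewrite mem_gact Sp_mapV invgK.
have UV' : (U' <= V')%VS by rewrite gact_sub.
have eV := subvP UV' _ eU.
have isoU' : isotropic U' by rewrite isotropic_gact.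
have isoV' : isotropic V' by rewrite isotropic_gact.
have UE := isotropic_e1 isoU' eU; have VE := isotropic_e1 isoV' eV.
have rUV' : red U' = red V' by rewrite !red_gact rUV.
apply: (can_inj (gactK (Sp_map i g^-1%g))); rewrite -/U' -/V' UE VE; congr dsum.
apply: IHn; rewrite ?isotropic_proj //.
  by rewrite -(dsum_sub (line_e K)) -UE -VE.
apply: (can_inj (dsumK (line_e F))).
by rewrite -red_line_e -!red_dsum -UE -VE.
Qed.

Lemma ltv_red n (U V : {vspace 'cV[K]_(n.*2)}) : isotropic U -> isotropic V ->
  ltv U V -> ltv (red U) (red V).
Proof.
move=> isoU isoV /andP [UV nUV]; rewrite /ltv red_sub //=.
by apply: contraNneq nUV => /(red_eq isoU isoV UV) ->.
Qed.

Lemma flag_red n (s : seq {vspace 'cV[K]_(n.*2)}) : flag s -> flag (map (@red _) s).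
Proof.
move=> [sz p iso]; split; first by rewrite size_map.
  have iso0 : isotropic (0%VS : {vspace 'cV[K]_(n.*2)}).
    by apply/asboolP => u v; rewrite !memv0 => /eqP -> _; rewrite omega0l.
  rewrite -(red0 n.*2); elim: s 0%VS iso0 iso p {sz} => [//|W s IHs] V isoV /=.
  by move=> /andP [isoW iso] /andP [VW p]; rewrite ltv_red //= IHs.
by rewrite all_map; apply: sub_all iso => V /= /red_isotropic.
Qed.

Definition cred n : flagchain K n -> flagchain F n := push (map (@red _)).
HB.instance Definition _ n := GRing.Additive.on (@cred n).

Lemma cred_act n (g : Sp R n) z : cred (cact (Sp_map i g) z) = cact (Sp_map rho g) (cred z).
Proof.
rewrite /cred /cact !push_comp; apply: eq_push_dom => s _ /=.
by rewrite -!map_comp; apply: eq_map => V /=; rewrite red_gact.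
Qed.

Lemma flag_cycle_red n (z : flagchain K n) : flag_cycle z -> flag_cycle (cred z).
Proof.
move=> [fz dz]; split=> [_ /mem_dom_push [s /fz fs ->]|j /dz dzj].
  exact: flag_red.
have -> : push (del j) (cred z) = cred (push (del j) z).
  by rewrite /cred !push_comp; apply: eq_push_dom => s _ /=; rewrite map_del.
by rewrite dzj raddf0.
Qed.

Lemma cred_susp n (z : flagchain K n) : cred (susp z) = susp (cred z).
Proof.
have E L : cred (cone L z) = cone (red L) (cred z).
  rewrite /cone raddf_sum; apply: eq_bigr => j _.
  rewrite raddfMz /= /cred !push_comp; congr (_ *~ _).
  apply: eq_push_dom => s _ /=.
  have mE T t : map (@red _) (map (dsum T) t) = map (dsum (red T)) (map (@red _) t).
    by rewrite -!map_comp; apply: eq_map => W /=; rewrite red_dsum.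
  by rewrite /prism map_cat map_take map_drop !mE /= !red0.
by rewrite /susp raddfB /= !E red_line_e red_line_f.
Qed.

Section Charts.
Variable n : nat.
Local Notation ThR := (R * 'cV[R]_(n.*2))%type.
Local Notation ThF := (F * 'cV[F]_(n.*2))%type.

Definition uniR (th : ThR) : Sp R n.+1 := eichF th.2 th.1.
Definition mapT (S : comUnitRingType) (f : {rmorphism R -> S}) (th : ThR) :
  (S * 'cV[S]_(n.*2))%type := (f th.1, map_mx f th.2).

Lemma Sp_map_uniR (S : fieldType) (f : {rmorphism R -> S}) th :
  Sp_map f (uniR th) = uni (mapT f th).
Proof. exact: Sp_map_eichF. Qed.

Lemma cred_chart th (x : flagchain K n) :
  cred (chart (mapT i th) x) = chart (mapT rho th) (cred x).
Proof. by rewrite /chart -!Sp_map_uniR cred_act cred_susp. Qed.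

Lemma mapT_section : exists sg : ThF -> ThR, cancel sg (mapT rho).
Proof.
suff /choice [sg sgP] : forall th, exists th', mapT rho th' = th by exists sg.
move=> [c w]; have [a aE] := rho_surj c; have [v vE] := map_mx_surj rho_unit w.
by exists (a, v); rewrite /mapT /= aE vE.
Qed.

End Charts.

Definition gamma_span n : flagchain K n -> Prop :=
  zspan (fun z => exists (g : Sp R n) (x : flagchain K n),
    [/\ Sp_map rho g = 1%g, flag_cycle x & z = cact (Sp_map i g) x - x]).

(** The quotient g h^-1 reduces to 1, so modulo the relations the action of an integral matrix on a
    cycle depends only on its reduction. *)
Lemma gamma_span_congr n (g h : Sp R n) (x : flagchain K n) : flag_cycle x ->
  Sp_map rho g = Sp_map rho h ->
  gamma_span (cact (Sp_map i g) x - cact (Sp_map i h) x).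
Proof.
move=> cx gh; apply: zspan_gen; exists (g * h^-1)%g, (cact (Sp_map i h) x); split.
- by rewrite Sp_mapM Sp_mapV gh mulgV.
- exact: flag_cycle_act.
by rewrite Sp_mapM Sp_mapV cactM cactK.
Qed.

Lemma cred_gamma_span n (z : flagchain K n) : gamma_span z -> cred z = 0.
Proof.
elim=> [_ [g [x [g1 cx ->]]]||x y _ x0 _ y0]; last by rewrite raddfB /= x0 y0 subrr.
  by rewrite raddfB /= cred_act g1 cact1 subrr.
by rewrite raddf0.
Qed.

(** Suspension turns the action of [g] into that of the block matrix [emb g], which still reduces to
    1; composing with [uniR th] does not change the comparison of reductions. *)
Lemma gamma_span_chart n (th : R * 'cV[R]_(n.*2)) (x : flagchain K n) :
  gamma_span x -> gamma_span (chart (mapT i th) x).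
Proof.
apply: (zspan_map (f := chart (mapT i th))) => _ [g [y [g1 cy ->]]].
rewrite raddfB /= /chart -susp_emb -Sp_map_emb -Sp_map_uniR -!cactM -!Sp_mapM.
apply: gamma_span_congr; first exact: flag_cycle_susp.
rewrite Sp_mapM Sp_map_emb g1.
have -> : emb 1%g = 1%g :> Sp F n.+1 by apply: Sp_ext => v; rewrite -[v]cvK embE !Sp1v.
by rewrite mulg1.
Qed.

Section Step.
Variable n : nat.
Local Notation chart_span := (zspan (fun z => exists (th : R * 'cV[R]_(n.*2)) x,
    flag_cycle x /\ z = chart (mapT i th) x)).

Lemma apartment_chart_span (g : Sp R n.+1) :
  (forall j, p0 (g *m delta_mx j 0) = 0 \/ p0 (g *m delta_mx j 0) \is a GRing.unit) ->
  chart_span (cact (Sp_map i g) (apartment K n.+1)).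
Proof.
move=> gU; set z := cact _ _.
have cz : flag_cycle z by apply/flag_cycle_act/flag_cycle_apartment.
(* Each column is normalized by its first coordinate. If that is 0, its inverse is 0 too and the
   parameter is (0, 0), a harmless extra entry of the list. *)
pose th j := let c := g *m delta_mx j 0 in ((p0 c)^-1 * p1 c, (p0 c)^-1 *: sndv c).
rewrite (@chart_decomposition _ _ z (undup [seq mapT i (th j) | j <- enum 'I_(n.+1.*2)])) //.
- apply: zspan_sum => t; rewrite mem_undup => /mapP [j _ ->]; apply: zspan_gen.
  exists (th j), (chart_link (mapT i (th j)) z); split=> //.
  exact: flag_cycle_chart_link.
- exact: undup_uniq.
move=> s v /mem_dom_push [t /head_apartment [j tj] ->].
rewrite head_cact tj gact_line => vh v0; exists (mapT i (th j)).
  by rewrite mem_undup; apply: map_f; rewrite mem_enum.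
have dE : Sp_map i g *m delta_mx j 0 = map_mx i (g *m delta_mx j 0) :> 'cV_(n.+1.*2).
  by rewrite Sp_map_mul map_delta_mx.
have cU : p0 (g *m delta_mx j 0) \is a GRing.unit.
  case: (gU j) => // c0; case/eqP: v0; move: vh => /vlineP [c ->].
  by rewrite p0Z dE map_p0 c0 rmorph0 mulr0.
set c := g *m delta_mx j 0 in cU dE *.
have uE : uniR (th j) *m e1 R n = (p0 c)^-1 *: c.
  rewrite eichF_e1 [X in _ = _ *: X]vecE !scalerDr !scalerA mulVr // scale1r -iota_vZ.
  by rewrite addrAC.
rewrite -Sp_map_uniR -(map_e1 i) -Sp_map_mul uE map_mxZ dE.
have ic0 : i (p0 c)^-1 != 0.
  apply/eqP => E; have /eqP := rmorph1 i.
  by rewrite -(mulVr cU) rmorphM E mul0r eq_sym oner_eq0.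
apply/eqP; rewrite eqEsubv -!memvE memvZ ?memv_line // andbT.
by rewrite -{1}[map_mx i c](scalerK ic0) memvZ ?memv_line.
Qed.

(** The matrix of each apartment is exchanged for a lift of its reduction whose first row consists
    of zeros and units. *)
Lemma cycle_chart_span (z : flagchain K n.+1) : flag_cycle z ->
  exists2 z', chart_span z' & gamma_span (z - z').
Proof.
move/(integral_apartments NP frac); elim=> [_ [g ->]||x y _ [x' cx' gx] _ [y' cy' gy]].
- have [g' g'g gU] := Sp_lift_row NP rho_surj rho_unit (Sp_map rho g).
  exists (cact (Sp_map i g') (apartment K n.+1)); first exact: apartment_chart_span.
  by apply: gamma_span_congr; [apply: flag_cycle_apartment | rewrite g'g].
- by exists 0; [apply: zspan0 | rewrite subrr; apply: zspan0].
exists (x' - y'); first exact: zspanB.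
have -> : x - y - (x' - y') = (x - x') - (y - y') by rewrite !opprD !opprK addrACA.
exact: zspanB.
Qed.

(** Parameters with the same reduction give charts that agree modulo [gamma_span], so each is
    replaced by its representative. [X] is total and 0 outside [r], so that two such forms can be
    subtracted over a common list. *)
Lemma chart_span_normal_form (sg : F * 'cV[F]_(n.*2) -> R * 'cV[R]_(n.*2))
    (sgK : cancel sg (mapT rho)) (z : flagchain K n.+1) : chart_span z ->
  exists (r : seq (F * 'cV[F]_(n.*2))) (X : F * 'cV[F]_(n.*2) -> flagchain K n),
    [/\ uniq r, forall th, flag_cycle (X th), forall th, th \notin r -> X th = 0 &
        gamma_span (z - \sum_(th <- r) chart (mapT i (sg th)) (X th))].
Proof.
elim=> [_ [th [x [cx ->]]]||x y _ [r1 [X1 [u1 c1 n1 g1]]] _ [r2 [X2 [u2 c2 n2 g2]]]].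
- exists [:: mapT rho th], (fun t => if t == mapT rho th then x else 0); split=> //.
  + by move=> t; case: ifP => _ //; apply: flag_cycle0.
  + by move=> t; rewrite inE => /negPf ->.
  rewrite big_seq1 eqxx /chart -!Sp_map_uniR; apply: gamma_span_congr.
    exact: flag_cycle_susp.
  by rewrite !Sp_map_uniR sgK.
- exists [::], (fun=> 0); split=> // [t|]; first exact: flag_cycle0.
  by rewrite big_nil subrr; apply: zspan0.
pose r := undup (r1 ++ r2); exists r, (fun t => X1 t - X2 t); split.
- exact: undup_uniq.
- by move=> t; apply: flag_cycleB.
- move=> t; rewrite mem_undup mem_cat negb_or => /andP [t1 t2].
  by rewrite n1 // n2 // subrr.
have sumE r' X : uniq r' -> {subset r' <= r} -> (forall t, t \notin r' -> X t = 0) ->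
    \sum_(t <- r) chart (mapT i (sg t)) (X t) = \sum_(t <- r') chart (mapT i (sg t)) (X t).
  move=> ur' sub X0; apply: big_uniq_sub; rewrite ?undup_uniq // => t /X0 ->.
  by rewrite raddf0.
have -> : \sum_(t <- r) chart (mapT i (sg t)) (X1 t - X2 t) =
    \sum_(t <- r1) chart (mapT i (sg t)) (X1 t) - \sum_(t <- r2) chart (mapT i (sg t)) (X2 t).
  rewrite -(sumE r1 X1) // -?(sumE r2 X2) // -?sumrB.
  - by apply: eq_bigr => t _; rewrite raddfB.
  - by move=> t tr; rewrite mem_undup mem_cat tr orbT.
  by move=> t tr; rewrite mem_undup mem_cat tr.
set a := \sum_(_ <- r1) _; set b := \sum_(_ <- r2) _.
have -> : x - y - (a - b) = (x - a) - (y - b) by rewrite !opprD !opprK addrACA.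
exact: zspanB.
Qed.

End Step.

Theorem reduction_coinvariants n :
  (forall z : flagchain K n, flag_cycle z -> cred z = 0 -> gamma_span z) /\
  (forall y : flagchain F n, flag_cycle y -> exists2 x, flag_cycle x & cred x = y).
Proof.
elim: n => [|n [IHinj IHsurj]].
  split=> [z [fz _] z0|y [fy _]].
    suff -> : z = 0 by apply: zspan0.
    apply: (push_inj_on (P := fun s => s = [::])) z0 => [s /fz [/size0nil //]|s t -> -> //].
  exists (push (fun=> [::]) y).
    by split=> // s /mem_dom_push [_ _ ->].
  rewrite /cred push_comp -[RHS]push_id; apply: eq_push_dom => s /fy [/size0nil -> //].
have [sg sgK] := mapT_section n.
split=> [z cz z0|y cy].
  have [z' cz' gz'] := cycle_chart_span cz.
  have [r [X [ur cX nX gX]]] := chart_span_normal_form sgK cz'.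
  set S := \sum_(_ <- r) _ in gX.
  have gS : gamma_span (z - S) by rewrite -[z](subrK z') -addrA; apply: zspanD.
  have S0 : cred S = 0.
    by have := cred_gamma_span gS; rewrite raddfB /= z0 sub0r => /eqP; rewrite oppr_eq0 => /eqP.
  suff gSS : gamma_span S by rewrite -[z](subrK S); apply: zspanD.
  have cSE : cred S = \sum_(th <- r) chart th (cred (X th)).
    by rewrite /S raddf_sum; apply: eq_bigr => th _ /=; rewrite cred_chart sgK.
  apply: zspan_sum => th thr; apply: gamma_span_chart; apply: IHinj => //.
  have fX t s : s \in dom (cred (X t)) -> flag s by have [f _] := flag_cycle_red (cX t); apply: f.
  (* The link at [th] isolates the reduction of [X th], since the other reduced charts have
     different parameters. *)
  have : chart_link th (cred S) = 0 by rewrite S0 raddf0.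
  rewrite cSE raddf_sum (bigD1_seq th) //= chart_linkK; last exact: fX.
  by rewrite big1 ?addr0 // => t tth; rewrite chart_link_neq // 1?eq_sym //; apply: fX.
have [fy _] := cy.
have /choice [tau tauP] : forall s, exists th, s \in dom y -> forall v, v \in head 0%VS s ->
    p0 v != 0 -> head 0%VS s = <[uni th *m e1 F n]>%VS.
  move=> s; have [sy|sy] := boolP (s \in dom y); last by exists (0, 0).
  have [[v [vs v0]]|none] := pselect (exists v, v \in head 0%VS s /\ p0 v != 0); last first.
    by exists (0, 0) => _ v vs v0; case: none; exists v.
  have [th thE] := uni_line v0; exists th => _ _ _ _; rewrite -thE.
  apply: head_flag_line => //; first exact: fy.
  by apply: contraNneq v0 => ->; rewrite -(scale0r 0) p0Z mul0r.
have /choice [X XP] : forall th, exists x : flagchain K n,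
    flag_cycle x /\ cred x = chart_link th y.
  move=> th; have [x cx xE] := IHsurj _ (flag_cycle_chart_link th cy).
  by exists x.
pose r := undup (map tau (dom y)).
exists (\sum_(th <- r) chart (mapT i (sg th)) (X th)).
  by apply: flag_cycle_sum => th _; apply: flag_cycle_chart; case: (XP th).
rewrite raddf_sum [RHS](@chart_decomposition _ _ y r) ?undup_uniq //.
  by apply: eq_bigr => th _ /=; rewrite cred_chart sgK (XP th).2.
move=> s v sy vs v0; exists (tau s); first by rewrite mem_undup map_f.
exact: tauP v0.
Qed.

End Reduction.

(** * Steinberg modules as modules of flag cycles *)

Lemma fraction_quotient (R : idomainType) (x : {fraction R}) :
  exists a b : R, @tofrac R b != 0 /\ x * @tofrac R b = @tofrac R a.
Proof.
elim/quotW: x => r; exists r.1, r.2; rewrite tofrac_eq0 denom_ratioP; split=> //.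
unlock FracField.tofrac; rewrite -[LHS]FracField.pi_mul; apply/eqmodP.
rewrite /= FracField.equivfE /FracField.mulf /= !numden_Ratio ?oner_neq0 ?mulr1 ?denom_ratioP //.
by rewrite mulrC.
Qed.

Lemma path_take_drop (T : Type) (e : rel T) (x : T) s s' m :
  path e x s -> path e x s' -> (m < size s)%N -> (m <= size s')%N ->
  (forall x0, nth x0 s m = last x (take m s')) -> path e x (take m.+1 s ++ drop m s').
Proof.
move=> p p' ms ms' E; rewrite cat_path.
have -> : last x (take m.+1 s) = last x (take m s').
  by rewrite -(E x) (take_nth x) // last_rcons.
move: p; rewrite -{1}(cat_take_drop m.+1 s) cat_path => /andP [-> _] /=.
by move: p'; rewrite -{1}(cat_take_drop m s') cat_path => /andP [_ ->].
Qed.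

Section Bridge.
Variables (k : fieldType) (n : nat).
Local Notation T := (isotropic_space k n).

(* Otherwise the initial part of [s] followed by the final part of [s'] would be a
   chain of n + 1 isotropic subspaces. *)
Lemma del_flag_lt (s s' : seq {vspace 'cV[k]_(n.*2)}) j l : flag s -> flag s' ->
  (j < l)%N -> (l < n)%N -> del j s <> del l s'.
Proof.
move=> [sz p iso] [sz' p' iso'] jl ln E.
have : (size (take j.+2 s ++ drop j.+1 s') <= n)%N.
  apply: flag_size_max; last first.
    rewrite all_cat; apply/andP; split; apply/allP => V.
      by move/mem_take; apply: (allP iso).
    by move/mem_drop; apply: (allP iso').
  apply: path_take_drop; rewrite ?sz ?sz' //; try by lia.
  move=> x0; have := congr1 (fun t => nth x0 t j) E.
  rewrite /del !nth_cat !size_takel ?sz ?sz' ?ltnn ?subnn; try by lia.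
  rewrite jl nth_drop addn0 nth_take // => ->.
  by rewrite (take_nth x0) ?sz' ?last_rcons //; lia.
rewrite size_cat size_takel ?size_drop ?sz ?sz'; lia.
Qed.

Definition simplex_seq m (s : simplex T m) : seq {vspace 'cV[k]_(n.*2)} :=
  map (@space_val k n) (simplex_val s).

Lemma simplex_seq_inj m : injective (@simplex_seq m).
Proof.
by move=> s t; move/inj_map => /(_ val_inj) E; apply/val_inj/val_inj.
Qed.

Lemma simplex_seq_path m (s : simplex T m) : path (@ltv _ _) 0%VS (simplex_seq s).
Proof.
have := valP s; rewrite /simplex_seq /=; case: (tval (simplex_val s)) => [//|U t] /= p.
rewrite /ltv sub0v eq_sym /=; have /andP [-> _] /= := valP U.
rewrite path_map; apply: sub_path p => V W /=; rewrite lt_def => /andP [VW leVW].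
apply/andP; split; first exact: leVW.
by apply: contraNneq VW => E; apply/eqP/val_inj.
Qed.

Lemma simplex_seq_isotropic m (s : simplex T m) : all (@isotropic k n) (simplex_seq s).
Proof.
rewrite all_map; apply/allP => V _ /=; by have /andP [] := valP V.
Qed.

Lemma simplex_size_max m (s : simplex T m) : (m <= n)%N.
Proof.
have := flag_size_max (simplex_seq_path s) (simplex_seq_isotropic s).
by rewrite size_map size_tuple.
Qed.

Lemma flag_simplex (s : simplex T n) : flag (simplex_seq s).
Proof.
split; first by rewrite size_map size_tuple.
  exact: simplex_seq_path.
exact: simplex_seq_isotropic.
Qed.

Lemma simplex_of_flag (s : seq {vspace 'cV[k]_(n.*2)}) : flag s ->
  exists t : simplex T n, simplex_seq t = s.
Proof.
move=> [sz p iso].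
have [t tE] : exists t : seq T, map (@space_val k n) t = s.
  have s0 V : V \in s -> V != 0%VS.
    move=> Vs; have /allP/(_ V Vs) /andP [_] := order_path_min (@ltv_trans _ _) p.
    by rewrite eq_sym.
  elim: s s0 iso {sz p} => [|V s IHs] s0 /= => [_|/andP [isoV iso]]; first by exists [::].
  have [|t tE] := IHs _ iso; first by move=> W Ws; apply: s0; rewrite inE Ws orbT.
  have V0 : (V != 0%VS) && isotropic V by rewrite s0 ?mem_head.
  by exists (IsotropicSpace V0 :: t); rewrite /= tE.
have szt : size t == n by move: sz; rewrite -tE size_map => ->.
have st : sorted <%O t.
  move: p; rewrite -tE; case: t {tE szt} => [//|U t] /= /andP [_]; rewrite path_map.
  apply: sub_path => V W /= /andP [VW nVW]; rewrite lt_def; apply/andP; split=> //.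
  by apply: contraNneq nVW => ->.
by exists (@Simplex _ T n (Tuple szt) st).
Qed.

Definition chain_flag m : chain T m -> {freeg (seq {vspace 'cV[k]_(n.*2)})} :=
  push (@simplex_seq m).
HB.instance Definition _ m := GRing.Additive.on (@chain_flag m).

Lemma chain_flag_inj m : injective (@chain_flag m).
Proof.
move=> c d E; apply/eqP; rewrite -subr_eq0; apply/eqP.
apply: (@push_inj_on _ _ (@simplex_seq m) (fun=> True)) => //.
  by move=> s t _ _; apply: simplex_seq_inj.
by have := raddfB (@chain_flag m) c d; rewrite /= E subrr.
Qed.

Lemma chain_flag_boundary m (c : chain T m.+1) :
  chain_flag (boundary c) = \sum_(j < m.+1) push (del j) (chain_flag c) *~ (-1) ^+ j.
Proof.
transitivity (lext (fun s => chain_flag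
    (\sum_(j < m.+1) (-1) ^+ j *: << face j s >> : chain T m)) c).
  exact: lext_comp.
transitivity (lext (fun s => \sum_(j < m.+1) << del j (simplex_seq s) >> *~ (-1) ^+ j) c).
  apply: eq_lext => s; rewrite raddf_sum; apply: eq_bigr => j _.
  have -> : (-1) ^+ j *: << face j s >> = << face j s >> *~ (-1) ^+ j :> chain T m.
    by rewrite -[X in X *: _]intz scaler_int.
  rewrite raddfMz; congr (_ *~ _); apply: etrans (pushU _ _) _; congr << _ >>.
  by rewrite /simplex_seq /= map_del.
rewrite lext_sum; apply: eq_bigr => j _; rewrite lext_Mz; congr (_ *~ _).
by rewrite /chain_flag push_comp.
Qed.

End Bridge.

Section SteinbergCycles.
Variables (k : fieldType) (m : nat).
Local Notation T := (isotropic_space k m.+1).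
Local Notation St := (Steinberg k m.+1).
Local Notation cycles := (Defs.cycle (@boundary _ T m)).

Definition cycle_flag (z : cycles) : flagchain k m.+1 := chain_flag (cycle_val z).

Lemma cycle_flag_zmod_morphism : zmod_morphism cycle_flag.
Proof. by move=> x y; rewrite /cycle_flag /= raddfB. Qed.
HB.instance Definition _ := GRing.isZmodMorphism.Build cycles (flagchain k m.+1)
  cycle_flag cycle_flag_zmod_morphism.

(** By [del_flag_lt] a list is a face at one position only, so its coefficient in the boundary is,
    up to sign, its coefficient in a single [push (del j)]. *)
Lemma cycle_flag_cycle (z : cycles) : flag_cycle (cycle_flag z).
Proof.
have /eqP c0 : boundary (cycle_val z) == 0 := valP z.
rewrite /cycle_flag; move: (cycle_val z) c0 => c c0.
have fc s : s \in dom (chain_flag c) -> flag s.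
  by move=> /mem_dom_push [t _ ->]; apply: flag_simplex.
split=> // j jm; apply/eqP; rewrite -dom_eq0; apply/negPn/negP => nz.
have [t tj] : exists t, t \in dom (push (del j) (chain_flag c)).
  by case: (dom _) nz => [//|t d] _; exists t; rewrite mem_head.
have := congr1 (coeff t) (chain_flag_boundary c).
rewrite c0 raddf0 coeff0 raddf_sum (bigD1 (Ordinal jm)) //= big1 => [|l lj].
  rewrite addr0 raddfMz /= => /esym/eqP; rewrite mulrz_eq0.
  by rewrite signr_eq0 /= -[_ == 0]negbK -mem_dom tj.
rewrite raddfMz /= coeff_outdom ?mul0rz //; apply/negP => /mem_dom_push [s' s'c tE'].
have [s sc tE] := mem_dom_push tj; rewrite tE in tE'.
have lj' : (l : nat) != j by apply: contraNneq lj => lj; apply/eqP/val_inj.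
case: (ltngtP l j) lj' => // [lltj|jltl] _.
  exact: (del_flag_lt (fc _ s'c) (fc _ sc) lltj jm (esym tE')).
exact: (del_flag_lt (fc _ sc) (fc _ s'c) jltl (ltn_ord l) tE').
Qed.

Lemma cycle_flag_surj (x : flagchain k m.+1) : flag_cycle x -> exists z, cycle_flag z = x.
Proof.
move=> [fx dx].
have /choice [t tP] : forall s, exists c : chain T m.+1,
    s \in dom x -> chain_flag c = << s >>.
  move=> s; have [sx|_] := boolP (s \in dom x); last by exists 0.
  by have [u uE] := simplex_of_flag (fx s sx); exists << u >>; rewrite /chain_flag pushU uE.
pose c : chain T m.+1 := lext t x.
have cE : chain_flag c = x.
  rewrite /chain_flag /push lext_comp -[RHS]lext_id; apply: eq_lext_dom => s sx.
  exact: tP.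
have bc : boundary c == 0.
  apply/eqP; apply: chain_flag_inj; rewrite raddf0 chain_flag_boundary cE.
  by rewrite big1 // => j _; rewrite dx // mul0rz.
by exists (Cycle bc).
Qed.

Definition steinberg_class : {additive cycles -> St} := homology_class (@boundary _ T m.+1).

(** This is top-degree homology: by [simplex_size_max] there are no chains one degree higher, hence
    no boundaries to divide by. *)
Lemma steinberg_class_eq0 z : steinberg_class z = 0 <-> cycle_flag z = 0.
Proof.
split=> [/homology_class_eq0 [a az]|z0].
  rewrite /cycle_flag -az; have -> : a = 0; last by rewrite !raddf0.
  apply/eqP; rewrite -dom_eq0; case: (dom a) => [//|s d].
  by have := simplex_size_max s; rewrite ltnn.
have -> : z = 0; last by rewrite raddf0.
apply/val_inj/(@chain_flag_inj _ _ m.+1); rewrite raddf0; exact: z0.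
Qed.

Lemma steinberg_class_surj (x : St) : exists z, steinberg_class z = x.
Proof. exact: homology_class_surj. Qed.

Lemma steinberg_class_eq z w : cycle_flag z = cycle_flag w -> steinberg_class z = steinberg_class w.
Proof.
move=> zw; apply/eqP; rewrite -subr_eq0 -raddfB; apply/eqP/steinberg_class_eq0.
by rewrite raddfB /= zw subrr.
Qed.

End SteinbergCycles.
Arguments steinberg_class {k m}.

(** Phrased through some cycle [w], so that both the group action and the reduction are computed on
    flags, never on classes. *)
Lemma steinberg_map_class (k k' : fieldType) m
    (h : isotropic_space k m.+1 -> isotropic_space k' m.+1)
    (h_mono : {homo h : x y / (x < y)%O})
    (g : {vspace 'cV[k]_(m.+1.*2)} -> {vspace 'cV[k']_(m.+1.*2)})
    (hg : forall V, space_val (h V) = g (space_val V)) (z : Defs.cycle (@boundary _ _ m)) :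
  exists2 w, reduced_homology_map h_mono m (steinberg_class z) = steinberg_class w &
             cycle_flag w = push (map g) (cycle_flag z).
Proof.
exists (Defs.cycle_map (@chain_map_boundary _ _ _ _ _ h_mono m) z).
  exact: homology_mapE.
rewrite /cycle_flag /=; set c := cycle_val z.
rewrite /chain_flag [RHS]push_comp; apply: etrans (push_comp _ _ _) _.
apply: eq_push_dom => s _ /=; rewrite /simplex_seq /= -!map_comp.
by apply: eq_map => V /=; rewrite hg.
Qed.

(** * Coinvariants and additive maps out of them *)

Section CoinvariantMaps.
Variables (G : groupType) (H : {pred G}) (M M' : zmodType) (act : G -> M -> M).
Variable f : {additive M -> M'}.
Hypothesis f_inv : forall h x, h \in H -> f (act h x) = f x.

Lemma coinvariant_relations_ker x : x \in coinvariant_relations H act -> f x = 0.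
Proof.
move=> /asboolP /(_ [pred y | f y == 0]) ker; apply/eqP; apply: ker.
  split=> [|y z]; rewrite !inE ?raddf0 // raddfB => /eqP -> /eqP ->.
  by rewrite subrr.
by move=> h y hH; rewrite inE raddfB f_inv // subrr.
Qed.

Hypothesis f_ker : forall x, f x = 0 -> x \in coinvariant_relations H act.
Hypothesis f_surj : forall y, exists x, f x = y.

Lemma coinvariants_iso : exists g : {additive coinvariants H act -> M'}, bijective g.
Proof.
pose C := coinvariants H act.
have f_repr x : f (repr (\pi_C x)) = f x.
  apply/eqP; rewrite -subr_eq0 -raddfB; apply/eqP/coinvariant_relations_ker.
  by rewrite Quotient.idealrBE reprK.
pose g (q : C) := f (repr q).
have gB : zmod_morphism g.
  move=> x y; rewrite -[x]reprK -[y]reprK /g.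
  have -> : \pi_C (repr x) - \pi_C (repr y) = \pi_C (repr x - repr y) by rewrite raddfB.
  by rewrite !f_repr raddfB.
pose gadd : {additive C -> M'} := HB.pack g (GRing.isZmodMorphism.Build C M' g gB).
exists gadd; have [h hK] := choice f_surj.
have gh y : g (\pi_C (h y)) = y by rewrite /g f_repr hK.
exists (fun y => \pi_C (h y)) => [q|y]; last exact: gh.
have inj x : gadd x = 0 -> x = 0.
  move=> gx; have xr : repr x \in coinvariant_relations H act by apply: f_ker.
  have C0 : \pi_C 0 = 0 by rewrite raddf0.
  by rewrite -[x]reprK -C0; apply/eqP; rewrite -Quotient.idealrBE subr0.
apply/eqP; rewrite -subr_eq0; apply/eqP/inj; rewrite raddfB /=.
by rewrite gh subrr.
Qed.

(** Lifts are chosen on the generators of the span and combined additively. The resulting [z] is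
    controlled only through its flags, which suffices since flags determine the class. *)
Lemma zspan_coinvariant_relations (C X : zmodType) (cls : {additive C -> M})
    (fl : {additive C -> X}) (Q : X -> Prop) :
  (forall x, Q x -> exists h z w,
     [/\ h \in H, cls w = act h (cls z) & fl w - fl z = x]) ->
  forall x, zspan Q x -> exists2 z, fl z = x & cls z \in coinvariant_relations H act.
Proof.
move=> QP x; elim=> [{}x /QP [h [z [w [hH wz <-]]]]||_ _ _ [z <- zr] _ [w <- wr]].
- exists (w - z); first by rewrite raddfB.
  by rewrite raddfB wz; apply/asboolP => P _; apply.
- by exists 0; rewrite raddf0 // rpred0.
by exists (z - w); rewrite raddfB // rpredB.
Qed.

End CoinvariantMaps.

(** * The reduction map between Steinberg modules *)

Section Coinvariants.
Variables (R : euclideanDomainType) (p : R) (pr : prime_element p).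
Hypothesis units_surj : forall u : residue_field pr, u \is a GRing.unit ->
  exists2 v : R, v \is a GRing.unit & reduction pr v = u.
Variable m : nat.
Local Notation K := {fraction R}.
Local Notation F := (residue_field pr).
Local Notation i := (@tofrac R : {rmorphism R -> K}).
Local Notation rho := (reduction pr : {rmorphism R -> F}).
Local Notation n := m.+1.

Let i_inj : injective i.
Proof. by move=> x y /eqP; rewrite tofrac_eq => /eqP. Qed.

Let rho_unit (x : F) : x != 0 -> exists2 u, u \is a GRing.unit & rho u = x.
Proof. by rewrite -unitfE; apply: units_surj. Qed.

Let rho_surj (x : F) : exists a, rho a = x.
Proof. exact: reduction_surj. Qed.

Local Notation redv := (@red R K F i rho rho_surj n.*2).

(** [V] contains g e1 for some integral symplectic [g], and this vector has nonzero reduction. *)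
Lemma red_space_subproof (V : isotropic_space K n) :
  (redv V != 0%VS) && isotropic (redv V).
Proof.
have /andP [V0 isoV] := valP V; rewrite (red_isotropic i_inj) // andbT.
have [N NP] := @euclidean_subproof R.
have [g gV] := Sp_e1_red NP (@fraction_quotient R) V0.
apply/eqP => rV0; have : Sp_map rho g *m e1 F m \in redv V.
  by apply/mem_red; exists (g *m e1 R m); rewrite !Sp_map_mul !map_e1.
by rewrite rV0 memv0 Sp_mul_eq0 (negPf (e1_neq0 _ _)).
Qed.

Definition red_space (V : isotropic_space K n) : isotropic_space F n :=
  IsotropicSpace (red_space_subproof V).

Lemma red_space_mono : {homo red_space : U V / (U < V)%O}.
Proof.
move=> U V; rewrite !lt_def => /andP [UV leUV].
have /andP [_ isoU] := valP U; have /andP [_ isoV] := valP V.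
have [N NP] := @euclidean_subproof R.
have /andP [leR neR] : ltv (redv U) (redv V).
  apply: (ltv_red NP (@fraction_quotient R) i_inj) => //; apply/andP; split; first exact: leUV.
  by apply: contraNneq UV => E; apply/eqP/val_inj.
apply/andP; split; last exact: leR.
apply: contraNneq neR => E; apply/eqP.
exact: (congr1 (@space_val F n) (esym E)).
Qed.

Definition steinberg_reduction : {additive Steinberg K n -> Steinberg F n} :=
  reduced_homology_map red_space_mono m.

Lemma steinberg_reduction_class z :
  exists2 w, steinberg_reduction (steinberg_class z) = steinberg_class w &
             cycle_flag w = @cred R K F i rho rho_surj n (cycle_flag z).
Proof. exact: steinberg_map_class. Qed.

Lemma steinberg_act_class (A : Sp R n) z :
  exists2 w, Steinberg_Sp_act A (steinberg_class z) = steinberg_class w &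
             cycle_flag w = cact (Sp_map i A) (cycle_flag z).
Proof. exact: (steinberg_map_class (@isotropic_space_map_mono _ _ (Sp_map i A))). Qed.

Lemma steinberg_reduction_act (A : Sp R n) (x : Steinberg K n) :
  A \in @congruence_subgroup R p pr n ->
  steinberg_reduction (Steinberg_Sp_act A x) = steinberg_reduction x.
Proof.
move=> AG; have A1 : Sp_map rho A = 1%g by apply/eqP.
have [z <-] := steinberg_class_surj x.
have [w -> wz] := steinberg_act_class A z.
have [u -> uw] := steinberg_reduction_class w.
have [v -> vz] := steinberg_reduction_class z.
apply: steinberg_class_eq; rewrite uw vz wz cred_act.
rewrite A1.
exact: cact1.
Qed.

Lemma steinberg_reduction_surj (y : Steinberg F n) : exists x, steinberg_reduction x = y.
Proof.
have [w <-] := steinberg_class_surj y.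
have [N NP] := @euclidean_subproof R.
have [_ surj] := reduction_coinvariants NP (@fraction_quotient R) i_inj rho_surj rho_unit n.
have [x cx xw] := surj _ (cycle_flag_cycle w); have [z zx] := cycle_flag_surj cx.
exists (steinberg_class z); have [w' -> w'E] := steinberg_reduction_class z.
by apply: steinberg_class_eq; rewrite w'E zx.
Qed.

Lemma steinberg_reduction_ker (x : Steinberg K n) : steinberg_reduction x = 0 ->
  x \in coinvariant_relations (@congruence_subgroup R p pr n)
          (fun A : Sp R n => Steinberg_Sp_act A : Steinberg K n -> Steinberg K n).
Proof.
have [z <-] := steinberg_class_surj x; have [w -> wz] := steinberg_reduction_class z.
move/steinberg_class_eq0; rewrite wz => z0.
have [N NP] := @euclidean_subproof R.
have [ker _] := reduction_coinvariants NP (@fraction_quotient R) i_inj rho_surj rho_unit n.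
have gz := ker _ (cycle_flag_cycle z) z0.
have [|z' z'z z'r] := zspan_coinvariant_relations (H := @congruence_subgroup R p pr n)
  (act := fun A : Sp R n => Steinberg_Sp_act A : Steinberg K n -> Steinberg K n)
  (cls := @steinberg_class K m) (fl := @cycle_flag K m) _ gz.
  move=> _ [A [y [A1 cy ->]]]; have [u uy] := cycle_flag_surj cy.
  have [v vE vu] := steinberg_act_class A u; exists A, u, v; split=> //.
    by apply/eqP.
  by rewrite -uy -vu.
by rewrite -(steinberg_class_eq z'z).
Qed.

End Coinvariants.

Theorem theorem1p5 (R : euclideanDomainType) (p : R) (pr : prime_element p)
    (units_surj : forall u : residue_field pr, u \is a GRing.unit ->
      exists2 v : R, v \is a GRing.unit & reduction pr v = u)
    (n : nat) (n_ge1 : (1 <= n)%N) :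
  exists f : {additive Steinberg_coinvariants pr n ->
                       Steinberg (residue_field pr) n},
    bijective f.
Proof.
case: n n_ge1 => [//|m] _.
apply: (coinvariants_iso (f := steinberg_reduction pr m)).
- by move=> A x; apply: steinberg_reduction_act.
- exact: steinberg_reduction_ker.
exact: steinberg_reduction_surj.
Qed.
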